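(* Let $[a,b]\subset\mathbb{R}$ be a compact interval, let $m\geq1$, $r\geq2$, $n\geq0$ be integers, let $0<\alpha\leq1$, and let $\varepsilon_0>0$. For each $\varepsilon\in[0,\varepsilon_0)$ let $A_{r-j}(\cdot,\varepsilon)\in(C^{n,\alpha})^{m\times m}$ for $j=1,\dots,r$, let $f(\cdot,\varepsilon)\in(C^{n,\alpha})^{m}$, let $c(\varepsilon)\in\mathbb{C}^{rm}$, and let $B(\varepsilon):(C^{n+r,\alpha})^{m}\to\mathbb{C}^{rm}$ be a continuous linear operator (no regularity in $\varepsilon$ is assumed). Consider the parameter-dependent boundary-value problem $$L(\varepsilon)y(t,\varepsilon)\equiv y^{(r)}(t,\varepsilon)+\sum_{j=1}^{r}A_{r-j}(t,\varepsilon)y^{(r-j)}(t,\varepsilon)=f(t,\varepsilon),\quad a\leq t\leq b,\qquad B(\varepsilon)y(\cdot,\varepsilon)=c(\varepsilon),$$ with unknown $y(\cdot,\varepsilon)\in(C^{n+r,\alpha})^{m}$. Then the solution to this problem depends continuously on the parameter $\varepsilon$ at $\varepsilon=0$ (in the sense defined in the context) if and only if the following three conditions hold: (0) the homogeneous problem $L(0)y=0$ on $[a,b]$, $B(0)y=0$, has only the trivial solution $y=0$ in $(C^{n+r,\alpha})^{m}$; (I) $A_{r-j}(\cdot,\varepsilon)\to A_{r-j}(\cdot,0)$ in $(C^{n,\alpha})^{m\times m}$ as $\varepsilon\to0+$, for each $j\in\{1,\dots,r\}$; (II) $B(\varepsilon)y\to B(0)y$ in $\mathbb{C}^{rm}$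 as $\varepsilon\to0+$, for every $y\in(C^{n+r,\alpha})^{m}$.
   Context: $C^{n,\alpha}$ denotes the complex Hölder space of all $n$ times continuously differentiable functions $x:[a,b]\to\mathbb{C}$ with $\|x\|'_{n,\alpha}:=\sup_{a\leq t_1<t_2\leq b}|x^{(n)}(t_2)-x^{(n)}(t_1)|/|t_2-t_1|^{\alpha}<\infty$, normed by $\|x\|_{n,\alpha}:=\sum_{j=0}^{n}\max_{[a,b]}|x^{(j)}|+\|x\|'_{n,\alpha}$. $(C^{n,\alpha})^{m}$ and $(C^{n,\alpha})^{m\times m}$ are the spaces of $m$-column vector-valued and $m\times m$ matrix-valued functions on $[a,b]$ with entries in $C^{n,\alpha}$, normed by the sum of the norms of the entries. Definition: the solution to the problem depends continuously on $\varepsilon$ at $\varepsilon=0$ if ( * ) there is $\varepsilon_1\in(0,\varepsilon_0)$ such that for every $\varepsilon\in[0,\varepsilon_1)$ and arbitrary $f(\cdot,\varepsilon)\in(C^{n,\alpha})^{m}$, $c(\varepsilon)\in\mathbb{C}^{rm}$ the problem has a unique solution $y(\cdot,\varepsilon)\in(C^{n+r,\alpha})^{m}$; and ( ** ) whenever $f(\cdot,\varepsilon)\to f(\cdot,0)$ in $(C^{n,\alpha})^{m}$ and $c(\varepsilon)\to c(0)$ in $\mathbb{C}^{rm}$ as $\varepsilon\to0+$, it follows that $y(\cdot,\varepsilon)\to y(\cdot,0)$ in $(C^{n+r,\alpha})^{m}$ as $\varepsilon\to0+$. *)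

(* Defs.v *)
From Stdlib Require Import Reals ClassicalEpsilon.
From Coquelicot Require Import Coquelicot.
Open Scope R_scope.

Notation CC := Complex.C.

Fixpoint fsum (n : nat) (f : nat -> R) : R :=
  match n with O => 0 | S k => fsum k f + f k end.
Fixpoint Csum (n : nat) (f : nat -> CC) : CC :=
  match n with O => RtoC 0 | S k => Cplus (Csum k f) (f k) end.

(* sup of a set of reals (0 if empty or unbounded) *)
Definition supR (S : R -> Prop) : R := real (Lub_Rbar S).

(* g' is the derivative of g on [a,b] (one-sided at the endpoints) *)
Definition DerivOn (a b : R) (g g' : R -> CC) : Prop :=
  forall t, a <= t <= b -> forall eps, 0 < eps -> exists delta, 0 < delta /\
    forall s, a <= s <= b -> Rabs (s - t) < delta ->
      Cmod (Cminus (Cminus (g s) (g t)) (Cmult (RtoC (s - t)) (g' t)))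
        <= eps * Rabs (s - t).

Definition ContOn (a b : R) (g : R -> CC) : Prop :=
  forall t, a <= t <= b -> forall eps, 0 < eps -> exists delta, 0 < delta /\
    forall s, a <= s <= b -> Rabs (s - t) < delta -> Cmod (Cminus (g s) (g t)) < eps.

Definition IsDerivs (a b : R) (n : nat) (g : R -> CC) (D : nat -> R -> CC) : Prop :=
  (forall t, a <= t <= b -> D O t = g t) /\
  (forall k, (k < n)%nat -> DerivOn a b (D k) (D (S k))) /\
  ContOn a b (D n).

(* the derivatives g^(j), j <= n, of a C^n function on [a,b] (determined on [a,b]) *)
Definition dW (a b : R) (n : nat) (g : R -> CC) : nat -> R -> CC :=
  epsilon (inhabits (fun _ _ => RtoC 0)) (fun D => IsDerivs a b n g D).

Definition HolderBounded (a b alpha : R) (h : R -> CC) : Prop :=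
  exists K, forall t1 t2, a <= t1 -> t1 < t2 -> t2 <= b ->
    Cmod (Cminus (h t2) (h t1)) <= K * Rpower (t2 - t1) alpha.

Definition InC (a b : R) (n : nat) (alpha : R) (g : R -> CC) : Prop :=
  exists D, IsDerivs a b n g D /\ HolderBounded a b alpha (D n).

Definition maxnorm (a b : R) (h : R -> CC) : R :=
  supR (fun v => exists t, a <= t <= b /\ v = Cmod (h t)).

Definition holder_semi (a b alpha : R) (h : R -> CC) : R :=
  supR (fun v => exists t1 t2, a <= t1 /\ t1 < t2 /\ t2 <= b /\
          v = Cmod (Cminus (h t2) (h t1)) / Rpower (t2 - t1) alpha).

Definition hnorm (a b : R) (n : nat) (alpha : R) (g : R -> CC) : R :=
  fsum (S n) (fun j => maxnorm a b (dW a b n g j)) + holder_semi a b alpha (dW a b n g n).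

Definition InCv a b n alpha (m : nat) (y : nat -> R -> CC) : Prop :=
  forall i, (i < m)%nat -> InC a b n alpha (y i).
Definition InCm a b n alpha (m : nat) (A : nat -> nat -> R -> CC) : Prop :=
  forall i k, (i < m)%nat -> (k < m)%nat -> InC a b n alpha (A i k).
Definition vnorm a b n alpha (m : nat) (y : nat -> R -> CC) : R :=
  fsum m (fun i => hnorm a b n alpha (y i)).
Definition mnorm a b n alpha (m : nat) (A : nat -> nat -> R -> CC) : R :=
  fsum m (fun i => fsum m (fun k => hnorm a b n alpha (A i k))).
Definition cnorm (N : nat) (c : nat -> CC) : R := fsum N (fun i => Cmod (c i)).

Definition vsub (y z : nat -> R -> CC) : nat -> R -> CC := fun i t => Cminus (y i t) (z i t).
Definition msub (A B : nat -> nat -> R -> CC) : nat -> nat -> R -> CC :=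
  fun i k t => Cminus (A i k t) (B i k t).
Definition csub (c d : nat -> CC) : nat -> CC := fun i => Cminus (c i) (d i).

(* Coefficients: A eps p i k t is the (i,k) entry of A_p(t,eps), p = r - j in {0..r-1}.
   (L(eps) y)_i (t) = y_i^(r)(t) + sum_{j=1}^r sum_k A_{r-j}(t,eps)_{ik} y_k^(r-j)(t). *)
Definition Lop (a b : R) (m r n : nat) (alpha : R)
  (A : R -> nat -> nat -> nat -> R -> CC) (eps : R) (y : nat -> R -> CC)
  (i : nat) (t : R) : CC :=
  Cplus (dW a b (n + r) (y i) r t)
    (Csum r (fun p => Csum m (fun k =>
        Cmult (A eps p i k t) (dW a b (n + r) (y k) p t)))).

Definition Solves (a b : R) (m r n : nat) (alpha : R)
  (A : R -> nat -> nat -> nat -> R -> CC) (B : R -> (nat -> R -> CC) -> nat -> CC)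
  (eps : R) (f : nat -> R -> CC) (c : nat -> CC) (y : nat -> R -> CC) : Prop :=
  InCv a b (n + r) alpha m y /\
  (forall i t, (i < m)%nat -> a <= t <= b -> Lop a b m r n alpha A eps y i t = f i t) /\
  (forall i, (i < r * m)%nat -> B eps y i = c i).

(* x(eps) -> x(0) as eps -> 0+ for a real "distance" d eps *)
Definition to0 (d : R -> R) : Prop :=
  forall e, 0 < e -> exists delta, 0 < delta /\ forall eps, 0 < eps < delta -> d eps < e.

Definition ContLinOp (a b : R) (m r n : nat) (alpha : R) (T : (nat -> R -> CC) -> nat -> CC) : Prop :=
  (forall y z, InCv a b (n + r) alpha m y -> InCv a b (n + r) alpha m z ->
     forall i, (i < r * m)%nat -> T (fun j t => Cplus (y j t) (z j t)) i = Cplus (T y i) (T z i)) /\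
  (forall (lam : CC) y, InCv a b (n + r) alpha m y ->
     forall i, (i < r * m)%nat -> T (fun j t => Cmult lam (y j t)) i = Cmult lam (T y i)) /\
  (exists K, forall y, InCv a b (n + r) alpha m y ->
     cnorm (r * m) (T y) <= K * vnorm a b (n + r) alpha m y).

Definition ContDep (a b : R) (m r n : nat) (alpha eps0 : R)
  (A : R -> nat -> nat -> nat -> R -> CC) (B : R -> (nat -> R -> CC) -> nat -> CC) : Prop :=
  exists eps1, 0 < eps1 < eps0 /\
  (forall eps, 0 <= eps < eps1 -> forall f c, InCv a b n alpha m f ->
     (exists y, Solves a b m r n alpha A B eps f c y) /\
     (forall y1 y2, Solves a b m r n alpha A B eps f c y1 ->
        Solves a b m r n alpha A B eps f c y2 ->
        forall i t, (i < m)%nat -> a <= t <= b -> y1 i t = y2 i t)) /\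
  (forall (f : R -> nat -> R -> CC) (c : R -> nat -> CC) (y : R -> nat -> R -> CC),
     (forall eps, 0 <= eps < eps1 -> InCv a b n alpha m (f eps)) ->
     (forall eps, 0 <= eps < eps1 -> Solves a b m r n alpha A B eps (f eps) (c eps) (y eps)) ->
     to0 (fun eps => vnorm a b n alpha m (vsub (f eps) (f 0))) ->
     to0 (fun eps => cnorm (r * m) (csub (c eps) (c 0))) ->
     to0 (fun eps => vnorm a b (n + r) alpha m (vsub (y eps) (y 0)))).

(* Main.v *)
(** Sufficiency: variation of constants writes a function y as z + sum_l d_l phi_l, where z
    solves L(eps) z = L(eps) y with zero Cauchy data at a, the phi_l are the fundamental
    solutions and d is the vector of Cauchy data of y.  The initial value problem is solved
    by Picard iteration, with bounds in C^{n+r,alpha} that depend only on a bound for the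
    coefficients, so phi_l(eps) -> phi_l(0); together with the uniform boundedness principle
    for B(eps), the matrix (B(eps) phi_l(eps)) converges to (B(0) phi_l(0)), which is
    injective by (0).  This yields solvability and the estimate
    |y| <= K (|L(eps) y| + |B(eps) y|), uniformly for small eps >= 0, and convergence follows
    by applying it to y(eps) - y(0).

    Necessity: solve L(eps) z = L(0) y, B(eps) z = B(0) y for y = (t - a)^p / p! e_k.  Since
    z(eps) -> y, this gives (I) by induction on p.  For (II), expand y - z(eps), with
    L(eps) z = L(eps) y and B(eps) z = B(0) y, in the solutions Y_l(eps) of L(eps) Y_l = 0,
    B(eps) Y_l = e_l; the coefficients are those of B(eps) y - B(0) y, and applying B(0)
    shows that they tend to 0. *)

Require Import Defs.
From Stdlib Require Import Reals Lra Lia ClassicalEpsilon Arith.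
From Coquelicot Require Import Coquelicot.
Open Scope R_scope.

(** * Differential calculus on [[a, b]] *)

(** Three estimates have the unknown on both sides: the sup bound for the initial value problem, the
    perturbed linear system, and the coefficients in the necessity part. In the last one nothing is
    known beforehand about the size of [A eps - A 0] as [eps] varies, so L(eps) (y - z(eps)) is
    small only relative to 1 + N, where N is any bound for these differences. All three are closed
    in the same way: start from some finite bound, improve it to a constant plus half of it, and
    iterate; the final constant does not depend on the starting bound. For [B eps], strong
    convergence yields pointwise bounds, valid for all small [eps] and not just along a sequence;
    hence a uniform boundedness principle for a family indexed by a right neighbourhood of 0. The
    norms of the statement are suprema over derivatives picked by [epsilon], hence meaningless
    outside the space. The estimates are carried out with the predicate [hle], which brings its own
    derivatives, and are exchanged for norms only where hypotheses or conclusion require it. *)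

Lemma choice_fun (X Y : Type) (P : X -> Y -> Prop) :
  (forall x, exists y, P x y) -> exists f, forall x, P x (f x).
Proof.
  intros H. exists (fun x => proj1_sig (constructive_indefinite_description _ (H x))).
  intros x. apply (proj2_sig (constructive_indefinite_description _ (H x))).
Qed.

Lemma Cmod_minus_le (x y : CC) : Cmod (x - y)%C <= Cmod x + Cmod y.
Proof. rewrite <- (Cmod_opp y). apply Cmod_triangle. Qed.

Lemma Cmod_minus_sym (x y : CC) : Cmod (x - y)%C = Cmod (y - x)%C.
Proof. rewrite <- Cmod_opp. f_equal. ring. Qed.

Lemma Cmod_triangle3 (x y z : CC) : Cmod (x - z)%C <= Cmod (x - y)%C + Cmod (y - z)%C.
Proof. replace (x - z)%C with ((x - y) + (y - z))%C by ring. apply Cmod_triangle. Qed.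

Lemma Cmod_le_minus (x y : CC) : Cmod x <= Cmod y + Cmod (x - y)%C.
Proof. replace x with (y + (x - y))%C at 1 by ring. apply Cmod_triangle. Qed.

Lemma im_le_Cmod (c : CC) : Rabs (Im c) <= Cmod c.
Proof. eapply Rle_trans; [|apply Rmax_Cmod]. apply Rmax_r. Qed.

Lemma Cmod_le_ReIm (c : CC) : Cmod c <= Rabs (Re c) + Rabs (Im c).
Proof.
  replace c with (RtoC (Re c) + Ci * RtoC (Im c))%C at 1.
  - eapply Rle_trans; [apply Cmod_triangle|].
    rewrite Cmod_mult, Cmod_Ci, !Cmod_R. lra.
  - destruct c as [x y]. unfold Ci, RtoC, Cplus, Cmult; simpl. f_equal; ring.
Qed.

Lemma Cmod_le_0 (c : CC) : Cmod c <= 0 -> c = RtoC 0.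
Proof. intros H. apply Cmod_eq_0. pose proof (Cmod_ge_0 c). lra. Qed.

Lemma Cminus_eq_0 (x y : CC) : (x - y)%C = RtoC 0 -> x = y.
Proof. intros H. replace x with ((x - y) + y)%C by ring. rewrite H. ring. Qed.

Lemma le_all_eps (x y : R) : (forall e, 0 < e -> x <= y + e) -> x <= y.
Proof.
  intros H. destruct (Rle_dec x y) as [|Hn]; [assumption|].
  specialize (H ((x - y) / 2)). lra.
Qed.

Lemma pow_half_small (K e : R) : 0 <= K -> 0 < e -> exists N, K * (/2) ^ N < e.
Proof.
  intros HK He.
  assert (Hp : 0 < e / (K + 1)) by (apply Rdiv_lt_0_compat; lra).
  assert (Ha : Rabs (/2) < 1) by (rewrite Rabs_pos_eq; lra).
  destruct (pow_lt_1_zero (/2) Ha _ Hp) as [N HN]. exists N.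
  specialize (HN N (Nat.le_refl _)). rewrite Rabs_pos_eq in HN by (apply pow_le; lra).
  assert (0 <= (/2) ^ N) by (apply pow_le; lra).
  apply Rle_lt_trans with ((K + 1) * (/2) ^ N). nra.
  apply Rmult_lt_compat_l with (r := K + 1) in HN; [|lra].
  replace ((K + 1) * (e / (K + 1))) with e in HN by (field; lra). exact HN.
Qed.

Lemma is_derive_eps (u : R -> R) (t l : R) : is_derive u t l ->
  forall eps, 0 < eps -> exists delta, 0 < delta /\
    forall s, Rabs (s - t) < delta -> Rabs (u s - u t - (s - t) * l) <= eps * Rabs (s - t).
Proof.
  intros H eps He. apply is_derive_Reals in H. destruct (H eps He) as [d Hd].
  exists d. split; [apply cond_pos|]. intros s Hs.
  destruct (Req_dec s t) as [->|Hne].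
  - replace (u t - u t - (t - t) * l) with 0 by ring. rewrite Rminus_diag, Rabs_R0. lra.
  - specialize (Hd (s - t) ltac:(lra) Hs). replace (t + (s - t)) with s in Hd by ring.
    replace (u s - u t - (s - t) * l) with (((u s - u t) / (s - t) - l) * (s - t)) by (field; lra).
    rewrite Rabs_mult. apply Rmult_le_compat_r; [apply Rabs_pos|lra].
Qed.

Section Interval.
Context (a b : R) (Hab : a < b).

Lemma DerivOn_ext (g g' h h' : R -> CC) :
  (forall t, a <= t <= b -> g t = h t) -> (forall t, a <= t <= b -> g' t = h' t) ->
  DerivOn a b g g' -> DerivOn a b h h'.
Proof.
  intros E E' H t Ht eps He. destruct (H t Ht eps He) as [d [Hd Hs]].
  exists d. split; [assumption|]. intros s Hs1 Hs2.
  rewrite <- !E, <- E' by assumption. auto.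
Qed.

Lemma ContOn_ext (g h : R -> CC) :
  (forall t, a <= t <= b -> g t = h t) -> ContOn a b g -> ContOn a b h.
Proof.
  intros E H t Ht eps He. destruct (H t Ht eps He) as [d [Hd Hs]].
  exists d. split; [assumption|]. intros s Hs1 Hs2. rewrite <- !E by assumption. auto.
Qed.

Lemma DerivOn_plus (g g' h h' : R -> CC) : DerivOn a b g g' -> DerivOn a b h h' ->
  DerivOn a b (fun t => g t + h t)%C (fun t => g' t + h' t)%C.
Proof.
  intros H1 H2 t Ht eps He.
  destruct (H1 t Ht (eps/2) ltac:(lra)) as [d1 [Hd1 Hs1]].
  destruct (H2 t Ht (eps/2) ltac:(lra)) as [d2 [Hd2 Hs2]].
  exists (Rmin d1 d2). split; [apply Rmin_pos; assumption|]. intros s Hs Hst.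
  specialize (Hs1 s Hs (Rlt_le_trans _ _ _ Hst (Rmin_l _ _))).
  specialize (Hs2 s Hs (Rlt_le_trans _ _ _ Hst (Rmin_r _ _))).
  replace (g s + h s - (g t + h t) - RtoC (s - t) * (g' t + h' t))%C with
    ((g s - g t - RtoC (s - t) * g' t) + (h s - h t - RtoC (s - t) * h' t))%C by ring.
  eapply Rle_trans; [apply Cmod_triangle|]. lra.
Qed.

Lemma DerivOn_scal (c : CC) (g g' : R -> CC) : DerivOn a b g g' ->
  DerivOn a b (fun t => c * g t)%C (fun t => c * g' t)%C.
Proof.
  intros H1 t Ht eps He. pose proof (Cmod_ge_0 c) as Hc.
  destruct (H1 t Ht (eps/(Cmod c + 1))) as [d1 [Hd1 Hs1]].
  { apply Rdiv_lt_0_compat; lra. }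
  exists d1. split; [assumption|]. intros s Hs Hst. specialize (Hs1 s Hs Hst).
  replace (c * g s - c * g t - RtoC (s - t) * (c * g' t))%C with
    (c * (g s - g t - RtoC (s - t) * g' t))%C by ring.
  rewrite Cmod_mult.
  apply Rle_trans with ((Cmod c + 1) * (eps / (Cmod c + 1) * Rabs (s - t))).
  - apply Rmult_le_compat; try lra; apply Cmod_ge_0.
  - right. field. lra.
Qed.

Lemma DerivOn_const (c : CC) : DerivOn a b (fun _ => c) (fun _ => RtoC 0).
Proof.
  intros t Ht eps He. exists 1. split; [lra|]. intros s Hs Hst.
  replace (c - c - RtoC (s - t) * RtoC 0)%C with (RtoC 0) by ring.
  rewrite Cmod_0. apply Rmult_le_pos; [lra|apply Rabs_pos].
Qed.

Lemma DerivOn_minus (g g' h h' : R -> CC) : DerivOn a b g g' -> DerivOn a b h h' ->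
  DerivOn a b (fun t => g t - h t)%C (fun t => g' t - h' t)%C.
Proof.
  intros H1 H2. apply DerivOn_ext with (g := fun t => (g t + - RtoC 1 * h t)%C)
    (g' := fun t => (g' t + - RtoC 1 * h' t)%C).
  - intros t _. ring.
  - intros t _. ring.
  - apply DerivOn_plus; [|apply DerivOn_scal]; assumption.
Qed.

Lemma DerivOn_ContOn (g g' : R -> CC) : DerivOn a b g g' -> ContOn a b g.
Proof.
  intros H t Ht eps He. destruct (H t Ht 1 ltac:(lra)) as [d [Hd Hs]].
  pose proof (Cmod_ge_0 (g' t)) as Hg.
  assert (Hq : 0 < eps / (Cmod (g' t) + 1)) by (apply Rdiv_lt_0_compat; lra).
  exists (Rmin d (eps / (Cmod (g' t) + 1))). split; [apply Rmin_pos; assumption|].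
  intros s Hs1 Hst. specialize (Hs s Hs1 (Rlt_le_trans _ _ _ Hst (Rmin_l _ _))).
  assert (Hst2 := Rlt_le_trans _ _ _ Hst (Rmin_r _ _)).
  eapply Rle_lt_trans; [apply (Cmod_le_minus _ (RtoC (s - t) * g' t)%C)|].
  rewrite Cmod_mult, Cmod_R.
  apply Rle_lt_trans with ((Cmod (g' t) + 1) * Rabs (s - t)); [lra|].
  apply Rmult_lt_compat_l with (r := Cmod (g' t) + 1) in Hst2; [|lra].
  replace ((Cmod (g' t) + 1) * (eps / (Cmod (g' t) + 1))) with eps in Hst2 by (field; lra).
  exact Hst2.
Qed.

Lemma ContOn_plus (g h : R -> CC) : ContOn a b g -> ContOn a b h ->
  ContOn a b (fun t => g t + h t)%C.
Proof.
  intros H1 H2 t Ht eps He.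
  destruct (H1 t Ht (eps/2) ltac:(lra)) as [d1 [Hd1 Hs1]].
  destruct (H2 t Ht (eps/2) ltac:(lra)) as [d2 [Hd2 Hs2]].
  exists (Rmin d1 d2). split; [apply Rmin_pos; assumption|]. intros s Hs Hst.
  specialize (Hs1 s Hs (Rlt_le_trans _ _ _ Hst (Rmin_l _ _))).
  specialize (Hs2 s Hs (Rlt_le_trans _ _ _ Hst (Rmin_r _ _))).
  replace (g s + h s - (g t + h t))%C with ((g s - g t) + (h s - h t))%C by ring.
  eapply Rle_lt_trans; [apply Cmod_triangle|]. lra.
Qed.

Lemma ContOn_const (c : CC) : ContOn a b (fun _ => c).
Proof. exact (DerivOn_ContOn _ _ (DerivOn_const c)). Qed.

Lemma ContOn_mult (g h : R -> CC) : ContOn a b g -> ContOn a b h ->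
  ContOn a b (fun t => g t * h t)%C.
Proof.
  intros H1 H2 t Ht eps He.
  set (K := Cmod (g t) + Cmod (h t) + 1).
  pose proof (Cmod_ge_0 (g t)) as Hg. pose proof (Cmod_ge_0 (h t)) as Hh.
  assert (HK : 0 < K) by (unfold K; lra).
  set (e := Rmin 1 (eps / (2 * K))).
  assert (He1 : 0 < e) by (apply Rmin_pos; [lra|apply Rdiv_lt_0_compat; lra]).
  assert (He2 : e <= 1) by apply Rmin_l.
  assert (He3 : 2 * K * e <= eps).
  { apply Rle_trans with (2 * K * (eps / (2 * K))).
    - apply Rmult_le_compat_l; [lra|apply Rmin_r].
    - right. field. lra. }
  destruct (H1 t Ht e He1) as [d1 [Hd1 Hs1]].
  destruct (H2 t Ht e He1) as [d2 [Hd2 Hs2]].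
  exists (Rmin d1 d2). split; [apply Rmin_pos; assumption|]. intros s Hs Hst.
  specialize (Hs1 s Hs (Rlt_le_trans _ _ _ Hst (Rmin_l _ _))).
  specialize (Hs2 s Hs (Rlt_le_trans _ _ _ Hst (Rmin_r _ _))).
  replace (g s * h s - g t * h t)%C with
    ((g s - g t) * (h s - h t) + ((g s - g t) * h t + g t * (h s - h t)))%C by ring.
  eapply Rle_lt_trans; [apply Cmod_triangle|].
  eapply Rle_lt_trans; [apply Rplus_le_compat_l, Cmod_triangle|].
  rewrite !Cmod_mult.
  pose proof (Cmod_ge_0 (g s - g t)%C). pose proof (Cmod_ge_0 (h s - h t)%C).
  unfold K in *. nra.
Qed.

Lemma DerivOn_mult (g g' h h' : R -> CC) : DerivOn a b g g' -> DerivOn a b h h' ->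
  DerivOn a b (fun t => g t * h t)%C (fun t => g' t * h t + g t * h' t)%C.
Proof.
  intros H1 H2 t Ht eps He.
  set (K := Cmod (g t) + Cmod (h t) + Cmod (g' t) + 1).
  pose proof (Cmod_ge_0 (g t)) as Hg. pose proof (Cmod_ge_0 (h t)) as Hh.
  pose proof (Cmod_ge_0 (g' t)) as Hg'.
  assert (HK : 0 < K) by (unfold K; lra).
  set (e := Rmin 1 (eps / (2 * K))).
  assert (He1 : 0 < e) by (apply Rmin_pos; [lra|apply Rdiv_lt_0_compat; lra]).
  assert (He2 : e <= 1) by apply Rmin_l.
  assert (He3 : 2 * K * e <= eps).
  { apply Rle_trans with (2 * K * (eps / (2 * K))).
    - apply Rmult_le_compat_l; [lra|apply Rmin_r].
    - right. field. lra. }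
  destruct (H1 t Ht e He1) as [d1 [Hd1 Hs1]].
  destruct (H2 t Ht e He1) as [d2 [Hd2 Hs2]].
  destruct (DerivOn_ContOn _ _ H2 t Ht e He1) as [d3 [Hd3 Hs3]].
  exists (Rmin d1 (Rmin d2 d3)). split; [repeat apply Rmin_pos; assumption|]. intros s Hs Hst.
  assert (Hst' := Rlt_le_trans _ _ _ Hst (Rmin_r _ _)).
  specialize (Hs1 s Hs (Rlt_le_trans _ _ _ Hst (Rmin_l _ _))).
  specialize (Hs2 s Hs (Rlt_le_trans _ _ _ Hst' (Rmin_l _ _))).
  specialize (Hs3 s Hs (Rlt_le_trans _ _ _ Hst' (Rmin_r _ _))).
  replace (g s * h s - g t * h t - RtoC (s - t) * (g' t * h t + g t * h' t))%C with
    ((g s - g t - RtoC (s - t) * g' t) * (h t + (h s - h t))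
      + (g t * (h s - h t - RtoC (s - t) * h' t) + RtoC (s - t) * g' t * (h s - h t)))%C by ring.
  eapply Rle_trans; [apply Cmod_triangle|].
  eapply Rle_trans; [apply Rplus_le_compat_l, Cmod_triangle|].
  rewrite !Cmod_mult, Cmod_R.
  assert (Hh2 : Cmod (h t + (h s - h t))%C <= Cmod (h t) + e).
  { eapply Rle_trans; [apply Cmod_triangle|]. lra. }
  set (r := Rabs (s - t)) in *. assert (Hr : 0 <= r) by apply Rabs_pos.
  pose proof (Cmod_ge_0 (g s - g t - RtoC (s - t) * g' t)%C).
  pose proof (Cmod_ge_0 (h t + (h s - h t))%C).
  pose proof (Cmod_ge_0 (h s - h t)%C).
  apply Rle_trans with (e * r * (Cmod (h t) + e) + (Cmod (g t) * (e * r) + r * Cmod (g' t) * e)).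
  - apply Rplus_le_compat; [|apply Rplus_le_compat].
    + apply Rmult_le_compat; assumption.
    + apply Rmult_le_compat_l; assumption.
    + apply Rmult_le_compat_l; [apply Rmult_le_pos; assumption|lra].
  - apply Rle_trans with (K * e * r).
    + assert (0 <= e * r) by nra. unfold K. nra.
    + apply Rmult_le_compat_r; [assumption|]. nra.
Qed.

Lemma DerivOn_pair (u u' v v' : R -> R) :
  (forall t, a <= t <= b -> is_derive u t (u' t)) ->
  (forall t, a <= t <= b -> is_derive v t (v' t)) ->
  DerivOn a b (fun t => (u t, v t)) (fun t => (u' t, v' t)).
Proof.
  intros H1 H2 t Ht eps He.
  destruct (is_derive_eps _ _ _ (H1 t Ht) (eps/2) ltac:(lra)) as [d1 [Hd1 Hs1]].
  destruct (is_derive_eps _ _ _ (H2 t Ht) (eps/2) ltac:(lra)) as [d2 [Hd2 Hs2]].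
  exists (Rmin d1 d2). split; [apply Rmin_pos; assumption|]. intros s Hs Hst.
  specialize (Hs1 s (Rlt_le_trans _ _ _ Hst (Rmin_l _ _))).
  specialize (Hs2 s (Rlt_le_trans _ _ _ Hst (Rmin_r _ _))).
  eapply Rle_trans; [apply Cmod_le_ReIm|]. unfold Re, Im. simpl.
  replace (u s + - u t + - ((s - t) * u' t - 0 * v' t)) with (u s - u t - (s - t) * u' t) by ring.
  replace (v s + - v t + - ((s - t) * v' t + 0 * u' t)) with (v s - v t - (s - t) * v' t) by ring.
  lra.
Qed.

(** The retraction of the line onto [[a, b]]. Composition with it turns continuity relative to
    [[a, b]] into continuity on the whole line, where the integral and the mean value theorem of the
    library apply. *)
Definition clamp (u : R) : R := Rmax a (Rmin b u).

Lemma clamp_in (u : R) : a <= clamp u <= b.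
Proof. unfold clamp, Rmax, Rmin. destruct (Rle_dec b u), (Rle_dec a _); lra. Qed.

Lemma clamp_id (u : R) : a <= u <= b -> clamp u = u.
Proof. unfold clamp, Rmax, Rmin. destruct (Rle_dec b u), (Rle_dec a _); lra. Qed.

Lemma clamp_lip (u v : R) : Rabs (clamp u - clamp v) <= Rabs (u - v).
Proof.
  unfold clamp, Rmax, Rmin, Rabs.
  destruct (Rle_dec b u), (Rle_dec b v);
  repeat match goal with
  | |- context [Rle_dec ?x ?y] => destruct (Rle_dec x y)
  | |- context [Rcase_abs ?x] => destruct (Rcase_abs x)
  end; lra.
Qed.

(** The functional [l] stands for [Re] or [Im], so that both are treated at once. *)
Lemma ContOn_clamp (l : CC -> R) (g : R -> CC) :
  (forall x y, Rabs (l x - l y) <= Cmod (x - y)%C) -> ContOn a b g ->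
  forall u, continuous (fun s => l (g (clamp s))) u.
Proof.
  intros Hl H u. apply continuity_pt_filterlim.
  intros eps He. destruct (H (clamp u) (clamp_in u) eps He) as [d [Hd Hs]].
  exists d. split; [assumption|]. intros s [_ Hsu].
  unfold dist in *; simpl in *; unfold R_dist in *.
  eapply Rle_lt_trans; [apply Hl|]. apply Hs; [apply clamp_in|].
  eapply Rle_lt_trans; [apply clamp_lip|exact Hsu].
Qed.

Lemma Re_lip (x y : CC) : Rabs (Re x - Re y) <= Cmod (x - y)%C.
Proof. exact (re_le_Cmod (x - y)%C). Qed.

Lemma Im_lip (x y : CC) : Rabs (Im x - Im y) <= Cmod (x - y)%C.
Proof. exact (im_le_Cmod (x - y)%C). Qed.

(** Real and imaginary parts of [g], composed with [clamp], are integrated separately over the line;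
    on [[a, b]] the clamping disappears. *)
Lemma ContOn_primitive (g : R -> CC) : ContOn a b g ->
  exists G, DerivOn a b G g /\ G a = RtoC 0.
Proof.
  intros H.
  assert (Hd : forall l : CC -> R, (forall x y, Rabs (l x - l y) <= Cmod (x - y)%C) ->
    forall t, is_derive (fun s => RInt (fun u => l (g (clamp u))) a s) t (l (g (clamp t)))).
  { intros l Hl t. pose proof (ContOn_clamp l g Hl H) as Hc.
    apply (is_derive_RInt (V := R_NormedModule) (fun u => l (g (clamp u))) _ a t); [|apply Hc].
    apply filter_forall. intros s. apply (RInt_correct (V := R_CompleteNormedModule)). apply ex_RInt_continuous. intros z _. apply Hc. }
  exists (fun t => (RInt (fun u => Re (g (clamp u))) a t, RInt (fun u => Im (g (clamp u))) a t)).
  split.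
  - apply DerivOn_ext with
      (g := fun t => (RInt (fun u => Re (g (clamp u))) a t, RInt (fun u => Im (g (clamp u))) a t))
      (g' := fun t => (Re (g (clamp t)), Im (g (clamp t)))).
    + reflexivity.
    + intros t Ht. rewrite clamp_id by assumption. destruct (g t); reflexivity.
    + apply DerivOn_pair; intros t _; apply Hd; [apply Re_lip|apply Im_lip].
  - rewrite !RInt_point. reflexivity.
Qed.

(* Apply the real mean value theorem to Re (conj z * g), z being the increment of g. *)
Lemma DerivOn_growth (g g' : R -> CC) (psi psi' : R -> R) :
  DerivOn a b g g' -> (forall t, is_derive psi t (psi' t)) ->
  (forall t, a <= t <= b -> Cmod (g' t) <= psi' t) ->
  forall s t, a <= s -> s <= t -> t <= b -> Cmod (g t - g s)%C <= psi t - psi s.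
Proof.
  intros Hg Hpsi Hle s t Has Hst Htb.
  set (z := (g t - g s)%C).
  set (l := fun w => Re (Cconj z * w)%C).
  assert (Hl1 : forall w, Rabs (l w) <= Cmod z * Cmod w).
  { intros w. eapply Rle_trans; [apply re_le_Cmod|]. rewrite Cmod_mult, Cmod_conj. lra. }
  assert (Hl2 : forall v w, l (v - w)%C = l v - l w).
  { intros v w. unfold l. simpl. ring. }
  assert (Hlz : l z = Cmod z * Cmod z).
  { unfold l. replace (Cmod z * Cmod z) with (Cmod z ^ 2) by ring.
    rewrite Cmod2_alt. unfold z. simpl. ring. }
  (* The bound on [g'] makes the derivative [Cmod z * psi' u - l (g' u)] nonnegative. Since [l z] is
     the square of [Cmod z], the inequality [h s <= h t] is the claim multiplied by [Cmod z]. *)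
  set (h := fun u => Cmod z * psi u - l (g (clamp u))).
  destruct (MVT_gen h s t (fun u => Cmod z * psi' u - l (g' u))) as [c [Hc1 Hc2]].
  - rewrite Rmin_left, Rmax_right by assumption. intros u Hu.
    unfold h. apply (is_derive_minus (fun u => Cmod z * psi u) (fun u => l (g (clamp u)))).
    { apply is_derive_scal. apply Hpsi. }
    apply is_derive_Reals. intros eps He.
    destruct (Hg u ltac:(lra) (eps / (2 * (Cmod z + 1)))) as [d [Hd Hd2]].
    { pose proof (Cmod_ge_0 z). apply Rdiv_lt_0_compat; lra. }
    assert (Hm : 0 < Rmin d (Rmin (u - s) (t - u))) by (repeat apply Rmin_pos; lra).
    exists (mkposreal _ Hm). simpl. intros k Hk Hk2.
    assert (Hk3 := Rlt_le_trans _ _ _ Hk2 (Rmin_l _ _)).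
    assert (Hk4 := Rlt_le_trans _ _ _ Hk2 (Rmin_r _ _)).
    assert (Hk5 := Rlt_le_trans _ _ _ Hk4 (Rmin_l _ _)).
    assert (Hk6 := Rlt_le_trans _ _ _ Hk4 (Rmin_r _ _)).
    apply Rabs_lt_between in Hk5. apply Rabs_lt_between in Hk6.
    rewrite !clamp_id by lra.
    specialize (Hd2 (u + k) ltac:(lra)). replace (u + k - u) with k in Hd2 by ring.
    specialize (Hd2 Hk3).
    replace ((l (g (u + k)) - l (g u)) / k - l (g' u)) with
      (l (g (u + k)%R - g u - RtoC k * g' u)%C / k).
    2:{ rewrite !Hl2. unfold l. simpl. field. assumption. }
    unfold Rdiv. rewrite Rabs_mult, Rabs_inv.
    apply Rle_lt_trans with (Cmod z * (eps / (2 * (Cmod z + 1)) * Rabs k) * / Rabs k).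
    + apply Rmult_le_compat_r.
      { apply Rlt_le, Rinv_0_lt_compat, Rabs_pos_lt; assumption. }
      eapply Rle_trans; [apply Hl1|]. apply Rmult_le_compat_l; [apply Cmod_ge_0|assumption].
    + assert (Rabs k <> 0) by (apply Rabs_no_R0; assumption).
      pose proof (Cmod_ge_0 z).
      replace (Cmod z * (eps / (2 * (Cmod z + 1)) * Rabs k) * / Rabs k) with
        (eps * (Cmod z / (2 * (Cmod z + 1)))) by (field; lra).
      assert (Cmod z / (2 * (Cmod z + 1)) < 1).
      { apply Rlt_div_l; lra. }
      nra.
  - rewrite Rmin_left, Rmax_right by assumption. intros u Hu.
    unfold h. apply continuity_pt_filterlim.
    apply (continuous_minus (fun u => Cmod z * psi u) (fun u => l (g (clamp u)))).
    + apply (continuous_scal_r (K := R_AbsRing) (V := R_NormedModule) (Cmod z) psi).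
      apply (ex_derive_continuous psi). exists (psi' u). apply Hpsi.
    + apply continuity_pt_filterlim.
      intros eps He. destruct (DerivOn_ContOn _ _ Hg (clamp u) (clamp_in u) (eps / (Cmod z + 1)))
        as [d [Hd Hs]].
      { pose proof (Cmod_ge_0 z). apply Rdiv_lt_0_compat; lra. }
      exists d. split; [assumption|]. intros v [_ Hv].
      unfold dist in *; simpl in *; unfold R_dist in *.
      rewrite <- Hl2. eapply Rle_lt_trans; [apply Hl1|].
      assert (Hb : Cmod (g (clamp v) - g (clamp u))%C < eps / (Cmod z + 1)).
      { apply Hs; [apply clamp_in|]. eapply Rle_lt_trans; [apply clamp_lip|exact Hv]. }
      pose proof (Cmod_ge_0 z).
      apply Rle_lt_trans with ((Cmod z + 1) * Cmod (g (clamp v) - g (clamp u))%C).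
      { apply Rmult_le_compat_r; [apply Cmod_ge_0|lra]. }
      apply Rmult_lt_compat_l with (r := Cmod z + 1) in Hb; [|lra].
      replace ((Cmod z + 1) * (eps / (Cmod z + 1))) with eps in Hb by (field; lra). exact Hb.
  - rewrite Rmin_left, Rmax_right in Hc1 by assumption.
    assert (Hpos : 0 <= Cmod z * psi' c - l (g' c)).
    { pose proof (Hl1 (g' c)) as H1. apply Rabs_le_between in H1.
      specialize (Hle c ltac:(lra)). pose proof (Cmod_ge_0 z). nra. }
    assert (Hh : h t - h s = Cmod z * (psi t - psi s) - Cmod z * Cmod z).
    { unfold h. rewrite !clamp_id by lra. rewrite <- Hlz. unfold z at 4. rewrite Hl2. ring. }
    assert (Hp2 : 0 <= h t - h s).
    { rewrite Hc2. apply Rmult_le_pos; lra. }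
    (* For [z = 0] the factor [Cmod z] cannot be cancelled. The claim is then that [psi] does not
       decrease, which holds because [psi'] dominates a modulus. *)
    destruct (Req_dec (Cmod z) 0) as [Hz|Hz].
    + fold z. rewrite Hz.
      destruct (MVT_gen psi s t psi') as [c2 [Hc3 Hc4]].
      * intros; apply Hpsi.
      * intros u _. apply continuity_pt_filterlim. apply (ex_derive_continuous psi).
        exists (psi' u). apply Hpsi.
      * rewrite Rmin_left, Rmax_right in Hc3 by assumption. rewrite Hc4.
        apply Rmult_le_pos; [|lra].
        eapply Rle_trans; [|apply Hle; lra]. apply Cmod_ge_0.
    + pose proof (Cmod_ge_0 z). fold z. apply Rmult_le_reg_l with (Cmod z); lra.
Qed.

Lemma DerivOn_lipschitz (g g' : R -> CC) (K : R) : DerivOn a b g g' ->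
  (forall t, a <= t <= b -> Cmod (g' t) <= K) ->
  forall s t, a <= s -> s <= t -> t <= b -> Cmod (g t - g s)%C <= K * (t - s).
Proof.
  intros H HK s t H1 H2 H3.
  replace (K * (t - s)) with (K * t - K * s) by ring.
  apply (DerivOn_growth g g' (fun u => K * u) (fun _ => K)); try assumption.
  intros u. auto_derive; [trivial|ring].
Qed.

(** Integration of the exponential weight gains the factor [1 / lam]. This gain makes the Picard map
    a contraction and lets the a priori bounds absorb their own right-hand side, on an interval of
    any length. *)
Lemma DerivOn_exp_bound (g g' : R -> CC) (K lam : R) : 0 < lam -> 0 <= K -> DerivOn a b g g' ->
  (forall t, a <= t <= b -> Cmod (g' t) <= K * exp (lam * (t - a))) ->
  forall t, a <= t <= b -> Cmod (g t) <= Cmod (g a) + K / lam * exp (lam * (t - a)).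
Proof.
  intros Hlam HK H Hle t Ht.
  eapply Rle_trans; [apply (Cmod_le_minus _ (g a))|]. apply Rplus_le_compat_l.
  eapply Rle_trans.
  - apply (DerivOn_growth g g' (fun u => K / lam * exp (lam * (u - a)))
      (fun u => K * exp (lam * (u - a)))); try assumption; try lra.
    intros u. auto_derive; [trivial|]. unfold Rminus. field. lra.
  - assert (0 <= K / lam * exp (lam * (a - a))).
    { apply Rmult_le_pos; [apply Rdiv_le_0_compat; lra|apply Rlt_le, exp_pos]. }
    lra.
Qed.

Lemma DerivOn_unique (g g1 g2 : R -> CC) : DerivOn a b g g1 -> DerivOn a b g g2 ->
  forall t, a <= t <= b -> g1 t = g2 t.
Proof.
  intros H1 H2 t Ht. apply Cminus_eq_0, Cmod_le_0. apply le_all_eps. intros e He.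
  destruct (H1 t Ht (e/2) ltac:(lra)) as [d1 [Hd1 Hs1]].
  destruct (H2 t Ht (e/2) ltac:(lra)) as [d2 [Hd2 Hs2]].
  (* As [a < b], there are points of the interval other than [t] arbitrarily close to it: to the
     right if [t < b], to the left if [t = b]. *)
  assert (exists s, a <= s <= b /\ s <> t /\ Rabs (s - t) < Rmin d1 d2) as [s [Hs [Hne Hst]]].
  { assert (Hm : 0 < Rmin d1 d2) by (apply Rmin_pos; assumption).
    destruct (Rlt_dec t b) as [Htb|Htb].
    - exists (t + Rmin ((b - t) / 2) (Rmin d1 d2 / 2)).
      assert (0 < Rmin ((b - t) / 2) (Rmin d1 d2 / 2)) by (apply Rmin_pos; lra).
      pose proof (Rmin_l ((b - t) / 2) (Rmin d1 d2 / 2)).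
      pose proof (Rmin_r ((b - t) / 2) (Rmin d1 d2 / 2)).
      split; [lra|]. split; [lra|]. rewrite Rabs_pos_eq; lra.
    - exists (t - Rmin ((t - a) / 2) (Rmin d1 d2 / 2)).
      assert (0 < Rmin ((t - a) / 2) (Rmin d1 d2 / 2)) by (apply Rmin_pos; lra).
      pose proof (Rmin_l ((t - a) / 2) (Rmin d1 d2 / 2)).
      pose proof (Rmin_r ((t - a) / 2) (Rmin d1 d2 / 2)).
      split; [lra|]. split; [lra|]. rewrite Rabs_left; lra. }
  specialize (Hs1 s Hs (Rlt_le_trans _ _ _ Hst (Rmin_l _ _))).
  specialize (Hs2 s Hs (Rlt_le_trans _ _ _ Hst (Rmin_r _ _))).
  assert (Hp : 0 < Rabs (s - t)) by (apply Rabs_pos_lt; lra).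
  apply Rmult_le_reg_l with (Rabs (s - t)); [assumption|].
  rewrite <- Cmod_R at 1. rewrite <- Cmod_mult.
  replace (RtoC (s - t) * (g1 t - g2 t))%C with
    ((g s - g t - RtoC (s - t) * g2 t) - (g s - g t - RtoC (s - t) * g1 t))%C by ring.
  eapply Rle_trans; [apply Cmod_minus_le|]. lra.
Qed.

Lemma ContOn_uniform_limit (u : nat -> R -> CC) (g : R -> CC) (e : nat -> R) :
  (forall k, ContOn a b (u k)) ->
  (forall k t, a <= t <= b -> Cmod (g t - u k t)%C <= e k) ->
  (forall d, 0 < d -> exists k, e k < d) -> ContOn a b g.
Proof.
  intros Hu Hg He t Ht eps Heps.
  destruct (He (eps / 3) ltac:(lra)) as [k Hk].
  destruct (Hu k t Ht (eps / 3) ltac:(lra)) as [d [Hd Hs]].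
  exists d. split; [assumption|]. intros s Hs1 Hst. specialize (Hs s Hs1 Hst).
  eapply Rle_lt_trans; [apply (Cmod_triangle3 _ (u k s))|].
  eapply Rle_lt_trans; [apply Rplus_le_compat_l, (Cmod_triangle3 _ (u k t))|].
  pose proof (Hg k s Hs1) as H1. pose proof (Hg k t Ht) as H2.
  rewrite Cmod_minus_sym in H2. lra.
Qed.

End Interval.

(** Real and imaginary parts converge, and passage to the limit in [j] preserves the rate [e k]
    exactly, so the iterations that use it lose no constant. *)
Lemma C_complete (u : nat -> CC) (e : nat -> R) :
  (forall k j, (k <= j)%nat -> Cmod (u j - u k)%C <= e k) ->
  (forall d, 0 < d -> exists k, e k < d) ->
  exists l, forall k, Cmod (l - u k)%C <= e k.
Proof.
  intros H He.
  assert (Hc : forall p : CC -> R, (forall x y, Rabs (p x - p y) <= Cmod (x - y)%C) ->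
    exists l, is_lim_seq (fun k => p (u k)) (Finite l)).
  { intros p Hp. apply ex_lim_seq_cauchy_corr. intros eps.
    destruct (He (eps / 2)) as [N HN]; [pose proof (cond_pos eps); lra|].
    exists N. intros i j Hi Hj.
    eapply Rle_lt_trans; [apply Hp|].
    eapply Rle_lt_trans; [apply (Cmod_triangle3 _ (u N))|].
    pose proof (H N i Hi) as H1. pose proof (H N j Hj) as H2. rewrite Cmod_minus_sym in H2. lra. }
  destruct (Hc Re Re_lip) as [x Hx]. destruct (Hc Im Im_lip) as [y Hy].
  exists (x, y). intros k. apply le_all_eps. intros d Hd.
  apply is_lim_seq_spec in Hx. apply is_lim_seq_spec in Hy.
  assert (Hd2 : 0 < d / 2) by lra.
  destruct (Hx (mkposreal _ Hd2)) as [N1 HN1]. destruct (Hy (mkposreal _ Hd2)) as [N2 HN2].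
  simpl in HN1, HN2.
  set (j := Nat.max k (Nat.max N1 N2)).
  specialize (HN1 j ltac:(lia)). specialize (HN2 j ltac:(lia)).
  eapply Rle_trans; [apply (Cmod_triangle3 _ (u j))|].
  pose proof (H k j ltac:(lia)) as H1.
  assert (Cmod ((x, y) - u j)%C <= d).
  { rewrite Cmod_minus_sym. eapply Rle_trans; [apply Cmod_le_ReIm|].
    change (Re (u j - (x, y))%C) with (Re (u j) - x).
    change (Im (u j - (x, y))%C) with (Im (u j) - y). lra. }
  lra.
Qed.

(** * Hoelder spaces *)

Lemma Csum_ext (n : nat) (f g : nat -> CC) :
  (forall i, (i < n)%nat -> f i = g i) -> Csum n f = Csum n g.
Proof.
  induction n as [|n IH]; intros H; simpl; [reflexivity|].
  rewrite IH by (intros; apply H; lia). rewrite H by lia. reflexivity.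
Qed.

Lemma Csum_plus (n : nat) (f g : nat -> CC) :
  Csum n (fun i => f i + g i)%C = (Csum n f + Csum n g)%C.
Proof. induction n as [|n IH]; simpl; [ring|]. rewrite IH. ring. Qed.

Lemma Csum_scal (n : nat) (c : CC) (f : nat -> CC) :
  Csum n (fun i => c * f i)%C = (c * Csum n f)%C.
Proof. induction n as [|n IH]; simpl; [ring|]. rewrite IH. ring. Qed.

Lemma Csum_minus (n : nat) (f g : nat -> CC) :
  Csum n (fun i => f i - g i)%C = (Csum n f - Csum n g)%C.
Proof. induction n as [|n IH]; simpl; [ring|]. rewrite IH. ring. Qed.

Lemma Csum_0 (n : nat) (f : nat -> CC) :
  (forall i, (i < n)%nat -> f i = RtoC 0) -> Csum n f = RtoC 0.
Proof.
  induction n as [|n IH]; intros H; simpl; [reflexivity|].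
  rewrite IH by (intros; apply H; lia). rewrite H by lia. ring.
Qed.

Lemma Csum_le (n : nat) (f : nat -> CC) (K : R) :
  (forall i, (i < n)%nat -> Cmod (f i) <= K) -> Cmod (Csum n f) <= INR n * K.
Proof.
  induction n as [|n IH]; intros H.
  - simpl. rewrite Cmod_0. lra.
  - rewrite S_INR. simpl. eapply Rle_trans; [apply Cmod_triangle|].
    specialize (IH (fun i Hi => H i (Nat.lt_lt_succ_r _ _ Hi))). specialize (H n ltac:(lia)). lra.
Qed.

Lemma Csum_pick (n p : nat) (f : nat -> CC) : (p < n)%nat ->
  Csum n f = (f p + Csum n (fun i => if Nat.eq_dec i p then RtoC 0 else f i))%C.
Proof.
  induction n as [|n IH]; intros H; [lia|]. simpl.
  destruct (Nat.eq_dec n p) as [->|Hne].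
  - rewrite (Csum_ext p f (fun i => if Nat.eq_dec i p then RtoC 0 else f i)); [ring|].
    intros i Hi. destruct (Nat.eq_dec i p); [lia|reflexivity].
  - rewrite IH by lia. ring.
Qed.

Lemma Csum_single (n p : nat) (f : nat -> CC) : (p < n)%nat ->
  (forall i, (i < n)%nat -> i <> p -> f i = RtoC 0) -> Csum n f = f p.
Proof.
  intros Hp H. rewrite (Csum_pick n p f Hp). rewrite Csum_0; [ring|].
  intros i Hi. destruct (Nat.eq_dec i p); auto.
Qed.

Lemma Csum_exchange (n p : nat) (f : nat -> nat -> CC) :
  Csum n (fun i => Csum p (fun j => f i j)) = Csum p (fun j => Csum n (fun i => f i j)).
Proof.
  induction n as [|n IH]; simpl; [symmetry; apply Csum_0; reflexivity|].
  rewrite IH, Csum_plus. reflexivity.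
Qed.

Lemma fsum_le (n : nat) (f : nat -> R) (K : R) :
  (forall i, (i < n)%nat -> f i <= K) -> fsum n f <= INR n * K.
Proof.
  induction n as [|n IH]; intros H; [simpl; lra|].
  rewrite S_INR. simpl.
  specialize (IH (fun i Hi => H i (Nat.lt_lt_succ_r _ _ Hi))). specialize (H n ltac:(lia)). lra.
Qed.

Lemma fsum_nonneg (n : nat) (f : nat -> R) :
  (forall i, (i < n)%nat -> 0 <= f i) -> 0 <= fsum n f.
Proof.
  induction n as [|n IH]; intros H; simpl; [lra|].
  pose proof (IH (fun i Hi => H i (Nat.lt_lt_succ_r _ _ Hi))). pose proof (H n ltac:(lia)). lra.
Qed.

Lemma fsum_ge_term (n : nat) (f : nat -> R) (j : nat) :
  (forall i, (i < n)%nat -> 0 <= f i) -> (j < n)%nat -> f j <= fsum n f.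
Proof.
  induction n as [|n IH]; intros H Hj; [lia|]. simpl.
  assert (H' : forall i, (i < n)%nat -> 0 <= f i) by (intros; apply H; lia).
  destruct (Nat.eq_dec j n) as [->|Hne].
  - pose proof (fsum_nonneg n f H'). lra.
  - pose proof (IH H' ltac:(lia)). pose proof (H n ltac:(lia)). lra.
Qed.

(** [supR] returns 0 when the supremum is infinite. A member of [S] excludes minus infinity and an
    upper bound excludes plus infinity; the next lemma relies on the same two facts. *)
Lemma supR_le (S : R -> Prop) (M : R) :
  (exists v, S v) -> (forall v, S v -> v <= M) -> supR S <= M.
Proof.
  intros [v Hv] H. unfold supR. destruct (Lub_Rbar_correct S) as [H1 H2].
  specialize (H1 v Hv). specialize (H2 (Finite M) H).
  destruct (Lub_Rbar S); simpl in *; [assumption|contradiction|contradiction].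
Qed.

Lemma supR_ge (S : R -> Prop) (M v : R) :
  (forall v, S v -> v <= M) -> S v -> v <= supR S.
Proof.
  intros H Hv. unfold supR. destruct (Lub_Rbar_correct S) as [H1 H2].
  specialize (H1 v Hv). specialize (H2 (Finite M) H).
  destruct (Lub_Rbar S); simpl in *; [assumption|contradiction|contradiction].
Qed.

(* [hle a b alpha N g K] bounds every derivative of [g] up to order [N], and the Hoelder
   constant of the [N]-th one, by [K]: up to the factor [N + 2] this is [hnorm g <= K]. *)
Fixpoint hle (a b alpha : R) (N : nat) (g : R -> CC) (K : R) : Prop :=
  (forall t, a <= t <= b -> Cmod (g t) <= K) /\
  match N with
  | O => forall t1 t2, a <= t1 -> t1 < t2 -> t2 <= b ->
      Cmod (g t2 - g t1)%C <= K * Rpower (t2 - t1) alpha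
  | S N' => exists g', DerivOn a b g g' /\ hle a b alpha N' g' K
  end.

Section Holder.
Context (a b alpha : R) (Hab : a < b) (Hal : 0 < alpha <= 1).
Notation hle := (hle a b alpha).

Lemma hle_bound (N : nat) (g : R -> CC) (K : R) :
  hle N g K -> forall t, a <= t <= b -> Cmod (g t) <= K.
Proof. destruct N; intros [H _]; exact H. Qed.

Lemma hle_nonneg (N : nat) (g : R -> CC) (K : R) : hle N g K -> 0 <= K.
Proof.
  intros H. pose proof (hle_bound _ _ _ H a ltac:(lra)). pose proof (Cmod_ge_0 (g a)). lra.
Qed.

Lemma hle_ext (N : nat) (g h : R -> CC) (K : R) :
  (forall t, a <= t <= b -> g t = h t) -> hle N g K -> hle N h K.
Proof.
  intros E. destruct N as [|N]; intros [H1 H2]; (split; [intros t Ht; rewrite <- E by assumption; auto|]).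
  - intros t1 t2 Ha Ht Hb. rewrite <- !E by lra. auto.
  - destruct H2 as [g' [Hg Hg']]. exists g'. split; [|assumption].
    apply (DerivOn_ext a b g g'); auto.
Qed.

Lemma hle_mono (N : nat) (g : R -> CC) (K L : R) : K <= L -> hle N g K -> hle N g L.
Proof.
  intros HKL. revert g. induction N as [|N IH]; intros g [H1 H2];
    (split; [intros t Ht; specialize (H1 t Ht); lra|]).
  - intros t1 t2 Ha Ht Hb. eapply Rle_trans; [apply H2; assumption|].
    apply Rmult_le_compat_r; [apply Rlt_le, exp_pos|assumption].
  - destruct H2 as [g' [Hg Hg']]. exists g'. auto.
Qed.

Lemma hle_plus (N : nat) (g h : R -> CC) (K L : R) :
  hle N g K -> hle N h L -> hle N (fun t => g t + h t)%C (K + L).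
Proof.
  revert g h. induction N as [|N IH]; intros g h [H1 H2] [H3 H4];
    (split; [intros t Ht; specialize (H1 t Ht); specialize (H3 t Ht);
             eapply Rle_trans; [apply Cmod_triangle|lra]|]).
  - intros t1 t2 Ha Ht Hb. specialize (H2 t1 t2 Ha Ht Hb). specialize (H4 t1 t2 Ha Ht Hb).
    replace (g t2 + h t2 - (g t1 + h t1))%C with ((g t2 - g t1) + (h t2 - h t1))%C by ring.
    eapply Rle_trans; [apply Cmod_triangle|]. lra.
  - destruct H2 as [g' [Hg Hg']]. destruct H4 as [h' [Hh Hh']].
    exists (fun t => g' t + h' t)%C. split; [apply DerivOn_plus; assumption|]. auto.
Qed.

Lemma hle_scal (N : nat) (c : CC) (g : R -> CC) (K : R) :
  hle N g K -> hle N (fun t => c * g t)%C (Cmod c * K).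
Proof.
  pose proof (Cmod_ge_0 c) as Hc.
  revert g. induction N as [|N IH]; intros g [H1 H2];
    (split; [intros t Ht; rewrite Cmod_mult; apply Rmult_le_compat_l; auto|]).
  - intros t1 t2 Ha Ht Hb. specialize (H2 t1 t2 Ha Ht Hb).
    replace (c * g t2 - c * g t1)%C with (c * (g t2 - g t1))%C by ring.
    rewrite Cmod_mult, Rmult_assoc. apply Rmult_le_compat_l; assumption.
  - destruct H2 as [g' [Hg Hg']]. exists (fun t => c * g' t)%C.
    split; [apply DerivOn_scal; assumption|]. auto.
Qed.

Lemma hle_minus (N : nat) (g h : R -> CC) (K L : R) :
  hle N g K -> hle N h L -> hle N (fun t => g t - h t)%C (K + L).
Proof.
  intros H1 H2. apply (hle_ext N (fun t => g t + (- RtoC 1) * h t)%C); [intros; ring|].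
  apply hle_plus; [assumption|].
  replace L with (Cmod (- RtoC 1)%C * L) by (rewrite Cmod_opp, Cmod_1; ring).
  apply hle_scal. assumption.
Qed.

Lemma hle_zero (N : nat) (K : R) : 0 <= K -> hle N (fun _ => RtoC 0) K.
Proof.
  intros HK. induction N as [|N IH]; (split; [intros; rewrite Cmod_0; assumption|]).
  - intros t1 t2 _ _ _. replace (RtoC 0 - RtoC 0)%C with (RtoC 0) by ring. rewrite Cmod_0.
    apply Rmult_le_pos; [assumption|apply Rlt_le, exp_pos].
  - exists (fun _ => RtoC 0). split; [apply DerivOn_const|assumption].
Qed.

Lemma hle_const (N : nat) (c : CC) : hle N (fun _ => c) (Cmod c).
Proof.
  destruct N as [|N]; (split; [intros; lra|]).
  - intros t1 t2 _ _ _. replace (c - c)%C with (RtoC 0) by ring. rewrite Cmod_0.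
    apply Rmult_le_pos; [apply Cmod_ge_0|apply Rlt_le, exp_pos].
  - exists (fun _ => RtoC 0). split; [apply DerivOn_const|]. apply hle_zero, Cmod_ge_0.
Qed.

Lemma hle_Csum (N n : nat) (F : nat -> R -> CC) (K : R) :
  (forall i, (i < n)%nat -> hle N (F i) K) ->
  hle N (fun t => Csum n (fun i => F i t)) (INR n * K).
Proof.
  induction n as [|n IH]; intros H.
  - simpl. apply hle_zero. lra.
  - rewrite S_INR, Rmult_plus_distr_r, Rmult_1_l. simpl. apply hle_plus; auto.
Qed.

(** The embedding constant of Lipschitz functions on [[a, b]] into Hoelder functions of exponent
    [alpha]. The summand 1 makes it at least 1, so multiplication by it also preserves sup
    bounds. *)
Definition kap : R := 1 + Rpower (b - a) (1 - alpha).

Lemma kap_ge_1 : 1 <= kap.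
Proof. unfold kap. pose proof (exp_pos ((1 - alpha) * ln (b - a))). unfold Rpower. lra. Qed.

Lemma length_le_kap (t1 t2 : R) : a <= t1 -> t1 < t2 -> t2 <= b ->
  t2 - t1 <= kap * Rpower (t2 - t1) alpha.
Proof.
  intros Ha Ht Hb.
  rewrite <- (Rpower_1 (t2 - t1)) at 1 by lra.
  replace 1 with ((1 - alpha) + alpha) at 1 by ring. rewrite Rpower_plus.
  apply Rmult_le_compat_r; [apply Rlt_le, exp_pos|].
  unfold kap. assert (Rpower (t2 - t1) (1 - alpha) <= Rpower (b - a) (1 - alpha)).
  { apply Rle_Rpower_l; lra. }
  lra.
Qed.

Lemma hle_lipschitz (g g' : R -> CC) (K : R) : DerivOn a b g g' ->
  (forall t, a <= t <= b -> Cmod (g t) <= K) ->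
  (forall t, a <= t <= b -> Cmod (g' t) <= K) -> hle 0 g (kap * K).
Proof.
  intros Hd H1 H2. pose proof kap_ge_1 as Hk.
  assert (HK : 0 <= K).
  { pose proof (H1 a ltac:(lra)). pose proof (Cmod_ge_0 (g a)). lra. }
  split.
  - intros t Ht. specialize (H1 t Ht). nra.
  - intros t1 t2 Ha Ht Hb.
    eapply Rle_trans; [apply (DerivOn_lipschitz a b Hab g g' K Hd H2); lra|].
    pose proof (length_le_kap t1 t2 Ha Ht Hb). nra.
Qed.

Lemma hle_pred (N : nat) (g : R -> CC) (K : R) : hle (S N) g K -> hle N g (kap * K).
Proof.
  revert g. induction N as [|N IH]; intros g H.
  - destruct H as [H1 [g' [Hg Hg']]]. apply (hle_lipschitz g g'); [assumption|assumption|].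
    apply (hle_bound _ _ _ Hg').
  - pose proof (hle_nonneg _ _ _ H) as HK. pose proof kap_ge_1 as Hk.
    destruct H as [H1 [g' [Hg Hg']]]. split.
    + intros t Ht. specialize (H1 t Ht). nra.
    + exists g'. auto.
Qed.

Lemma kap_pow_ge_1 (j : nat) : 1 <= kap ^ j.
Proof. apply pow_R1_Rle, kap_ge_1. Qed.

Lemma hle_lower (N j : nat) (g : R -> CC) (K : R) : hle (j + N) g K -> hle N g (kap ^ j * K).
Proof.
  induction j as [|j IH] in K |- *; intros H.
  - rewrite Rmult_1_l. exact H.
  - simpl. replace (kap * kap ^ j * K) with (kap ^ j * (kap * K)) by ring.
    apply IH. apply hle_pred. exact H.
Qed.

(** Since [kap >= 1], one exponent [J] serves every drop in order by at most [J]; this keeps later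
    constants independent of the particular derivative. *)
Lemma hle_lower_le (N M J : nat) (g : R -> CC) (K : R) : (N <= M)%nat -> (M <= J + N)%nat ->
  hle M g K -> hle N g (kap ^ J * K).
Proof.
  intros H1 H2 H. pose proof (hle_nonneg _ _ _ H) as HK.
  replace M with ((M - N) + N)%nat in H by lia. apply hle_lower in H.
  apply hle_mono with (2 := H). apply Rmult_le_compat_r; [assumption|].
  apply Rle_pow; [apply kap_ge_1|lia].
Qed.

(** The constant of the Banach algebra inequality. The 2 counts the two terms of the increment of a
    product, then of the Leibniz rule; in the latter one factor is lowered by one order, which costs
    [kap]. *)
Fixpoint mulc (N : nat) : R := match N with O => 2 | S N' => 2 * kap * mulc N' end.

Lemma mulc_ge_1 (N : nat) : 1 <= mulc N.
Proof. pose proof kap_ge_1. induction N as [|N IH]; simpl; [lra|nra]. Qed.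

Lemma hle_mult (N : nat) (g h : R -> CC) (K L : R) :
  hle N g K -> hle N h L -> hle N (fun t => g t * h t)%C (mulc N * (K * L)).
Proof.
  revert g h K L. induction N as [|N IH]; intros g h K L Hg Hh;
    pose proof (hle_nonneg _ _ _ Hg) as HK; pose proof (hle_nonneg _ _ _ Hh) as HL.
  - destruct Hg as [H1 H2]. destruct Hh as [H3 H4]. simpl mulc. split.
    + intros t Ht. specialize (H1 t Ht). specialize (H3 t Ht). rewrite Cmod_mult.
      pose proof (Cmod_ge_0 (g t)). pose proof (Cmod_ge_0 (h t)). nra.
    + intros t1 t2 Ha Ht Hb. specialize (H2 t1 t2 Ha Ht Hb). specialize (H4 t1 t2 Ha Ht Hb).
      pose proof (H1 t1 ltac:(lra)) as H1'. pose proof (H3 t2 ltac:(lra)) as H3'.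
      replace (g t2 * h t2 - g t1 * h t1)%C with
        ((g t2 - g t1) * h t2 + g t1 * (h t2 - h t1))%C by ring.
      eapply Rle_trans; [apply Cmod_triangle|]. rewrite !Cmod_mult.
      set (w := Rpower (t2 - t1) alpha) in *.
      apply Rle_trans with (K * w * L + K * (L * w)); [|lra].
      apply Rplus_le_compat; apply Rmult_le_compat; assumption || apply Cmod_ge_0.
  - pose proof (mulc_ge_1 N) as HN. pose proof kap_ge_1 as Hk.
    assert (HKL : 0 <= K * L) by nra.
    split.
    + intros t Ht. pose proof (hle_bound _ _ _ Hg t Ht). pose proof (hle_bound _ _ _ Hh t Ht).
      rewrite Cmod_mult. apply Rle_trans with (K * L).
      * apply Rmult_le_compat; assumption || apply Cmod_ge_0.
      * pose proof (mulc_ge_1 (S N)). nra.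
    + pose proof (hle_pred _ _ _ Hg) as Hg1. pose proof (hle_pred _ _ _ Hh) as Hh1.
      destruct Hg as [_ [g' [Hg Hg']]]. destruct Hh as [_ [h' [Hh Hh']]].
      exists (fun t => g' t * h t + g t * h' t)%C. split; [apply DerivOn_mult; assumption|].
      replace (mulc (S N) * (K * L)) with (mulc N * (K * (kap * L)) + mulc N * (kap * K * L))
        by (simpl; ring).
      apply hle_plus; auto.
Qed.

Lemma hle_ContOn (N : nat) (g : R -> CC) (K : R) : hle N g K -> ContOn a b g.
Proof.
  intros H. destruct N as [|N].
  2:{ destruct H as [_ [g' [Hg _]]]. apply (DerivOn_ContOn a b g g' Hg). }
  pose proof (hle_nonneg _ _ _ H) as HK. destruct H as [_ H].
  intros t Ht eps He.
  (* Chosen so that [(K + 1) * Rpower d alpha = eps]; the shift by 1 covers [K = 0]. *)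
  set (d := Rpower (eps / (K + 1)) (/ alpha)).
  assert (Hq : 0 < eps / (K + 1)) by (apply Rdiv_lt_0_compat; lra).
  exists d. split; [apply exp_pos|]. intros s Hs Hst.
  assert (Haux : forall u v, a <= u -> u < v -> v <= b -> v - u < d -> Cmod (g v - g u)%C < eps).
  { intros u v Hu Huv Hv Hd. eapply Rle_lt_trans; [apply H; assumption|].
    assert (Hp : Rpower (v - u) alpha <= eps / (K + 1)).
    { apply Rle_trans with (Rpower d alpha); [apply Rle_Rpower_l; lra|].
      unfold d. rewrite Rpower_mult. rewrite Rinv_l by lra. rewrite Rpower_1 by assumption. lra. }
    pose proof (exp_pos (alpha * ln (v - u))) as Hpos. fold (Rpower (v - u) alpha) in Hpos.
    apply Rlt_le_trans with ((K + 1) * Rpower (v - u) alpha); [nra|].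
    apply Rmult_le_compat_l with (r := K + 1) in Hp; [|lra].
    replace ((K + 1) * (eps / (K + 1))) with eps in Hp by (field; lra). exact Hp. }
  destruct (Rtotal_order s t) as [Hlt|[->|Hgt]].
  - rewrite Cmod_minus_sym. apply Haux; try lra. rewrite Rabs_left in Hst; lra.
  - replace (g t - g t)%C with (RtoC 0) by ring. rewrite Cmod_0. assumption.
  - apply Haux; try lra. rewrite Rabs_pos_eq in Hst; lra.
Qed.

(** * Agreement of [hle] with the derivatives [dW] and the norm [hnorm] *)

Lemma IsDerivs_shift (N : nat) (g : R -> CC) (D : nat -> R -> CC) :
  IsDerivs a b (S N) g D -> IsDerivs a b N (D 1%nat) (fun j => D (S j)).
Proof.
  intros [H1 [H2 H3]]. split; [reflexivity|]. split; [|assumption].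
  intros k Hk. apply H2. lia.
Qed.

Lemma hle_of_IsDerivs (N : nat) (g : R -> CC) (D : nat -> R -> CC) (K : R) :
  IsDerivs a b N g D ->
  (forall j t, (j <= N)%nat -> a <= t <= b -> Cmod (D j t) <= K) ->
  (forall t1 t2, a <= t1 -> t1 < t2 -> t2 <= b ->
     Cmod (D N t2 - D N t1)%C <= K * Rpower (t2 - t1) alpha) ->
  hle N g K.
Proof.
  revert g D. induction N as [|N IH]; intros g D HD HK HH.
  - apply (hle_ext 0 (D 0%nat)); [apply HD|]. split; auto.
  - pose proof HD as [H1 [H2 H3]]. apply (hle_ext (S N) (D 0%nat)); [assumption|].
    split; [intros; apply HK; [lia|assumption]|].
    exists (D 1%nat). split; [apply H2; lia|].
    apply (IH _ (fun j => D (S j))); [apply (IsDerivs_shift N g D HD)|..]; auto.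
    intros; apply HK; [lia|assumption].
Qed.

Lemma hle_to_IsDerivs (N : nat) (g : R -> CC) (K : R) : hle N g K ->
  exists D, IsDerivs a b N g D /\
    (forall j t, (j <= N)%nat -> a <= t <= b -> Cmod (D j t) <= K) /\
    (forall t1 t2, a <= t1 -> t1 < t2 -> t2 <= b ->
       Cmod (D N t2 - D N t1)%C <= K * Rpower (t2 - t1) alpha).
Proof.
  revert g. induction N as [|N IH]; intros g H.
  - exists (fun _ => g). pose proof (hle_ContOn _ _ _ H) as Hc. destruct H as [H1 H2].
    repeat split; auto. intros; lia.
  - destruct H as [H1 [g' [Hg Hg']]]. destruct (IH g' Hg') as [D [[HD1 [HD2 HD3]] [HD4 HD5]]].
    exists (fun j => match j with O => g | S i => D i end). repeat split; auto.
    + intros k Hk. destruct k as [|k]; [|apply HD2; lia].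
      apply (DerivOn_ext a b g g'); auto. intros t Ht. symmetry. auto.
    + intros j t Hj Ht. destruct j; [auto|apply HD4; [lia|assumption]].
Qed.

Lemma IsDerivs_unique (N : nat) (g : R -> CC) (D E : nat -> R -> CC) :
  IsDerivs a b N g D -> IsDerivs a b N g E ->
  forall j t, (j <= N)%nat -> a <= t <= b -> D j t = E j t.
Proof.
  intros [H1 [H2 _]] [H3 [H4 _]] j. induction j as [|j IH]; intros t Hj Ht.
  - rewrite H1, H3; auto.
  - apply (DerivOn_unique a b Hab (D j)); [apply H2; lia| |assumption].
    apply (DerivOn_ext a b (E j) (E (S j))); [|reflexivity|apply H4; lia].
    intros s Hs. symmetry. apply IH; [lia|assumption].
Qed.

Lemma dW_spec (N : nat) (g : R -> CC) (D : nat -> R -> CC) :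
  IsDerivs a b N g D -> IsDerivs a b N g (dW a b N g).
Proof. intros H. unfold dW. apply epsilon_spec. exists D. exact H. Qed.

(** [dW] is an arbitrary choice made by [epsilon]. Uniqueness of derivatives on a nondegenerate
    interval ties it, on [[a, b]] and up to order [N], to any concrete tower. *)
Lemma dW_eq (N : nat) (g : R -> CC) (D : nat -> R -> CC) : IsDerivs a b N g D ->
  forall j t, (j <= N)%nat -> a <= t <= b -> dW a b N g j t = D j t.
Proof. intros H. apply IsDerivs_unique with g; [apply (dW_spec N g D H)|exact H]. Qed.

Lemma hle_IsDerivs (N : nat) (g : R -> CC) (K : R) : hle N g K -> IsDerivs a b N g (dW a b N g).
Proof. intros H. destruct (hle_to_IsDerivs N g K H) as [D [HD _]]. apply (dW_spec N g D HD). Qed.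

Lemma hle_nth_deriv (p q : nat) (g : R -> CC) (D : nat -> R -> CC) (K : R) :
  hle (p + q) g K -> IsDerivs a b (p + q) g D -> hle q (D p) K.
Proof.
  revert g D. induction p as [|p IH]; intros g D H HD.
  - apply (hle_ext q g); [|exact H]. intros t Ht. symmetry. apply HD. assumption.
  - destruct H as [H1 [g' [Hg Hg']]]. apply (IH (D 1%nat) (fun j => D (S j))).
    + apply (hle_ext _ g'); [|exact Hg'].
      apply (DerivOn_unique a b Hab g); [assumption|].
      destruct HD as [HD1 [HD2 _]]. apply (DerivOn_ext a b (D 0%nat) (D 1%nat)); auto.
      apply HD2. simpl. lia.
    + apply (IsDerivs_shift _ g D HD).
Qed.

Lemma hle_dW (N p : nat) (g : R -> CC) (K : R) : (p <= N)%nat -> hle N g K ->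
  hle (N - p) (dW a b N g p) K.
Proof.
  intros Hp H. apply (hle_nth_deriv p (N - p) g).
  - replace (p + (N - p))%nat with N by lia. exact H.
  - replace (p + (N - p))%nat with N by lia. apply (hle_IsDerivs N g K H).
Qed.

Lemma hle_dW_le (n N p : nat) (g : R -> CC) (K : R) : (p + n <= N)%nat -> hle N g K ->
  hle n (dW a b N g p) (kap ^ N * K).
Proof.
  intros Hp H. apply hle_lower_le with (M := (N - p)%nat); [lia|lia|].
  apply hle_dW; [lia|exact H].
Qed.

Lemma dW_0 (N : nat) (g : R -> CC) (K : R) : hle N g K ->
  forall t, a <= t <= b -> dW a b N g 0 t = g t.
Proof. intros H. apply (hle_IsDerivs N g K H). Qed.

Lemma dW_ext (N : nat) (g h : R -> CC) (K : R) : (forall t, a <= t <= b -> g t = h t) ->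
  hle N g K -> forall j t, (j <= N)%nat -> a <= t <= b -> dW a b N g j t = dW a b N h j t.
Proof.
  intros E H j t Hj Ht. apply dW_eq; [|assumption|assumption].
  destruct (hle_IsDerivs N h K (hle_ext _ _ _ _ E H)) as [H1 H2]. split; [|assumption].
  intros s Hs. rewrite E by assumption. auto.
Qed.

Lemma dW_plus (N : nat) (g h : R -> CC) (K L : R) : hle N g K -> hle N h L ->
  forall j t, (j <= N)%nat -> a <= t <= b ->
  dW a b N (fun s => g s + h s)%C j t = (dW a b N g j t + dW a b N h j t)%C.
Proof.
  intros Hg Hh. apply (dW_eq N (fun s => g s + h s)%C (fun j t => dW a b N g j t + dW a b N h j t)%C).
  destruct (hle_IsDerivs N g K Hg) as [H1 [H2 H3]].
  destruct (hle_IsDerivs N h L Hh) as [H4 [H5 H6]].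
  split; [|split].
  - intros t Ht. rewrite H1, H4 by assumption. reflexivity.
  - intros k Hk. apply DerivOn_plus; auto.
  - apply ContOn_plus; auto.
Qed.

Lemma dW_scal (N : nat) (c : CC) (g : R -> CC) (K : R) : hle N g K ->
  forall j t, (j <= N)%nat -> a <= t <= b ->
  dW a b N (fun s => c * g s)%C j t = (c * dW a b N g j t)%C.
Proof.
  intros Hg. apply (dW_eq N (fun s => c * g s)%C (fun j t => c * dW a b N g j t)%C).
  destruct (hle_IsDerivs N g K Hg) as [H1 [H2 H3]].
  split; [|split].
  - intros t Ht. rewrite H1 by assumption. reflexivity.
  - intros k Hk. apply DerivOn_scal; auto.
  - apply ContOn_mult; [apply ContOn_const|assumption].
Qed.

Lemma hle_InC (N : nat) (g : R -> CC) (K : R) : hle N g K -> InC a b N alpha g.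
Proof.
  intros H. destruct (hle_to_IsDerivs N g K H) as [D [HD [_ HH]]].
  exists D. split; [assumption|]. exists K. assumption.
Qed.

Lemma Holder_bounded (h : R -> CC) : HolderBounded a b alpha h ->
  exists K, 0 <= K /\ hle 0 h K.
Proof.
  intros [K HK].
  set (K' := Rabs K). assert (HK' : 0 <= K') by apply Rabs_pos.
  assert (HH : forall t1 t2, a <= t1 -> t1 < t2 -> t2 <= b ->
    Cmod (h t2 - h t1)%C <= K' * Rpower (t2 - t1) alpha).
  { intros t1 t2 H1 H2 H3. eapply Rle_trans; [apply HK; assumption|].
    apply Rmult_le_compat_r; [apply Rlt_le, exp_pos|apply Rle_abs]. }
  (* The value at [a] plus the largest possible Hoelder increment bounds [h]; the additional [K']
     makes [M] a Hoelder constant as well. *)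
  set (M := Cmod (h a) + K' * (1 + Rpower (b - a) alpha)).
  pose proof (exp_pos (alpha * ln (b - a))) as Hp. fold (Rpower (b - a) alpha) in Hp.
  pose proof (Cmod_ge_0 (h a)) as Hha.
  assert (HM : K' <= M) by (unfold M; nra).
  exists M. split; [lra|]. split.
  - intros t Ht. eapply Rle_trans; [apply (Cmod_le_minus _ (h a))|]. unfold M.
    apply Rplus_le_compat_l.
    destruct (Req_dec t a) as [->|Hne].
    + replace (h a - h a)%C with (RtoC 0) by ring. rewrite Cmod_0. nra.
    + eapply Rle_trans; [apply HH; lra|].
      apply Rmult_le_compat_l; [assumption|].
      assert (Rpower (t - a) alpha <= Rpower (b - a) alpha) by (apply Rle_Rpower_l; lra). lra.
  - intros t1 t2 H1 H2 H3. eapply Rle_trans; [apply HH; assumption|].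
    apply Rmult_le_compat_r; [apply Rlt_le, exp_pos|assumption].
Qed.

(** [InC] contains no sup bound. It follows from the value at [a] and a bound on the increments: the
    Hoelder condition at the top order, the mean value inequality below. *)
Lemma InC_hle (N : nat) (g : R -> CC) : InC a b N alpha g -> exists K, 0 <= K /\ hle N g K.
Proof.
  intros [D [HD HH]]. revert g D HD HH. induction N as [|N IH]; intros g D HD HH.
  - destruct (Holder_bounded _ HH) as [K [HK H]]. exists K. split; [assumption|].
    apply (hle_ext 0 (D 0%nat)); [apply HD|assumption].
  - destruct (IH _ _ (IsDerivs_shift N g D HD) HH) as [K [HK H]].
    set (M := Cmod (g a) + K * (1 + (b - a))). pose proof (Cmod_ge_0 (g a)).
    assert (HM : K <= M) by (unfold M; nra).
    assert (Hd : DerivOn a b g (D 1%nat)).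
    { destruct HD as [H1 [H2 _]]. apply (DerivOn_ext a b (D 0%nat) (D 1%nat)); auto.
      apply H2. lia. }
    exists M. split; [lra|]. split.
    + intros t Ht. eapply Rle_trans; [apply (Cmod_le_minus _ (g a))|]. unfold M.
      apply Rplus_le_compat_l.
      eapply Rle_trans; [apply (DerivOn_lipschitz a b Hab g _ K Hd (hle_bound _ _ _ H)); lra|]. nra.
    + exists (D 1%nat). split; [assumption|]. apply hle_mono with K; assumption.
Qed.

Lemma hle_dW_bounds (N : nat) (g : R -> CC) (K : R) : hle N g K ->
  (forall j t, (j <= N)%nat -> a <= t <= b -> Cmod (dW a b N g j t) <= K) /\
  (forall t1 t2, a <= t1 -> t1 < t2 -> t2 <= b ->
    Cmod (dW a b N g N t2 - dW a b N g N t1)%C <= K * Rpower (t2 - t1) alpha).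
Proof.
  intros H. split.
  - intros j t Hj Ht. apply (hle_bound _ _ _ (hle_dW N j g K Hj H) t Ht).
  - pose proof (hle_dW N N g K (Nat.le_refl _) H) as H1. rewrite Nat.sub_diag in H1. apply H1.
Qed.

Lemma maxnorm_set_bound (N j : nat) (g : R -> CC) (K : R) : hle N g K -> (j <= N)%nat ->
  forall v, (exists t, a <= t <= b /\ v = Cmod (dW a b N g j t)) -> v <= K.
Proof. intros H Hj v [t [Ht ->]]. apply (hle_dW_bounds N g K H); assumption. Qed.

Lemma semi_set_bound (N : nat) (g : R -> CC) (K : R) : hle N g K ->
  forall v, (exists t1 t2, a <= t1 /\ t1 < t2 /\ t2 <= b /\
    v = Cmod (Cminus (dW a b N g N t2) (dW a b N g N t1)) / Rpower (t2 - t1) alpha) -> v <= K.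
Proof.
  intros H v [t1 [t2 [H1 [H2 [H3 ->]]]]]. apply Rle_div_l; [apply exp_pos|].
  apply (hle_dW_bounds N g K H); assumption.
Qed.

(** [INR N + 2] counts the [N + 1] maxima and the Hoelder seminorm. *)
Lemma hnorm_le (N : nat) (g : R -> CC) (K : R) : hle N g K ->
  hnorm a b N alpha g <= (INR N + 2) * K.
Proof.
  intros H. unfold hnorm.
  assert (H1 : fsum (S N) (fun j => maxnorm a b (dW a b N g j)) <= INR (S N) * K).
  { apply fsum_le. intros j Hj. apply supR_le.
    - exists (Cmod (dW a b N g j a)), a. split; [lra|reflexivity].
    - apply (maxnorm_set_bound N j g K H). lia. }
  assert (H2 : holder_semi a b alpha (dW a b N g N) <= K).
  { apply supR_le.
    - eexists. exists a, b. split; [lra|]. split; [lra|]. split; [lra|]. reflexivity.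
    - apply (semi_set_bound N g K H). }
  rewrite S_INR in H1. lra.
Qed.

(** The hypothesis with some [K] ensures that the sets behind the norm are bounded, so that their
    [supR] is a true supremum and not the default 0. *)
Lemma hle_hnorm (N : nat) (g : R -> CC) (K : R) : hle N g K -> hle N g (hnorm a b N alpha g).
Proof.
  intros H.
  assert (H1 : forall j t, (j <= N)%nat -> a <= t <= b ->
    Cmod (dW a b N g j t) <= maxnorm a b (dW a b N g j)).
  { intros j t Hj Ht. apply supR_ge with K; [apply (maxnorm_set_bound N j g K H Hj)|].
    exists t. auto. }
  assert (Hm0 : forall j, (j <= N)%nat -> 0 <= maxnorm a b (dW a b N g j)).
  { intros j Hj. eapply Rle_trans; [|apply (H1 j a Hj); lra]. apply Cmod_ge_0. }
  assert (H2 : forall t1 t2, a <= t1 -> t1 < t2 -> t2 <= b ->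
    Cmod (dW a b N g N t2 - dW a b N g N t1)%C
      <= holder_semi a b alpha (dW a b N g N) * Rpower (t2 - t1) alpha).
  { intros t1 t2 Ha Ht Hb. apply Rle_div_l; [apply exp_pos|].
    apply supR_ge with K; [apply (semi_set_bound N g K H)|].
    exists t1, t2. auto. }
  assert (Hs0 : 0 <= holder_semi a b alpha (dW a b N g N)).
  { specialize (H2 a b (Rle_refl _) Hab (Rle_refl _)).
    pose proof (Cmod_ge_0 (dW a b N g N b - dW a b N g N a)%C).
    pose proof (exp_pos (alpha * ln (b - a))) as Hp. fold (Rpower (b - a) alpha) in Hp.
    apply Rmult_le_reg_r with (Rpower (b - a) alpha); lra. }
  assert (Hf0 : forall i, (i < S N)%nat -> 0 <= maxnorm a b (dW a b N g i)).
  { intros; apply Hm0; lia. }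
  apply (hle_of_IsDerivs N g _ _ (hle_IsDerivs N g K H)).
  - intros j t Hj Ht. eapply Rle_trans; [apply H1; assumption|]. unfold hnorm.
    pose proof (fsum_ge_term (S N) (fun j => maxnorm a b (dW a b N g j)) j Hf0 ltac:(lia)). simpl in *; lra.
  - intros t1 t2 Ha Ht Hb. eapply Rle_trans; [apply H2; assumption|].
    apply Rmult_le_compat_r; [apply Rlt_le, exp_pos|]. unfold hnorm.
    pose proof (fsum_nonneg (S N) (fun j => maxnorm a b (dW a b N g j)) Hf0). lra.
Qed.

(** Completeness of the Hoelder space with the rate preserved. Pointwise limits satisfy the
    inequalities in the limit; for [S N] the derivatives converge by induction, and their limit has
    to be identified as the derivative of the limit. *)
Lemma hle_complete (N : nat) (x : nat -> R -> CC) (rho : nat -> R) :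
  (forall k, exists M, hle N (x k) M) ->
  (forall k j, (k <= j)%nat -> hle N (fun t => x j t - x k t)%C (rho k)) ->
  (forall d, 0 < d -> exists k, rho k < d) ->
  exists y, forall k, hle N (fun t => y t - x k t)%C (rho k).
Proof.
  revert x. induction N as [|N IH]; intros x Hx Hc Hrho.
  all: assert (Hy : exists y : R -> CC, forall t, a <= t <= b -> forall k,
    Cmod (y t - x k t)%C <= rho k) by
   (destruct (choice_fun R CC (fun t l => a <= t <= b -> forall k, Cmod (l - x k t)%C <= rho k))
      as [y Hy];
    [ intros t; destruct (excluded_middle_informative (a <= t <= b)) as [Ht|Ht];
      [ destruct (C_complete (fun k => x k t) rho) as [l Hl];
        [ intros k j Hkj; apply (hle_bound _ _ _ (Hc k j Hkj) t Ht)
        | assumption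
        | exists l; auto ]
      | exists (RtoC 0); intros; contradiction ]
    | exists y; intros; auto ]).
  all: destruct Hy as [y Hy]; exists y.
  - intros k. split; [auto|]. intros t1 t2 Ha Ht Hb. apply le_all_eps. intros e He.
    destruct (Hrho (e / 4) ltac:(lra)) as [i Hi].
    (* An index beyond [k], so that the Hoelder bound for [x j - x k] is available, and beyond [i],
       so that [x j] is uniformly within [e / 2] of [y]. *)
    set (j := Nat.max k i).
    assert (Hj : forall t, a <= t <= b -> Cmod (y t - x j t)%C <= e / 2).
    { intros t Ht'. eapply Rle_trans; [apply (Cmod_triangle3 _ (x i t))|].
      pose proof (Hy t Ht' i) as A1.
      pose proof (hle_bound _ _ _ (Hc i j ltac:(lia)) t Ht') as A2. simpl in A2.
      rewrite Cmod_minus_sym in A2. lra. }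
    destruct (Hc k j ltac:(lia)) as [_ Hkj]. specialize (Hkj t1 t2 Ha Ht Hb).
    pose proof (Hj t1 ltac:(lra)) as B1. pose proof (Hj t2 ltac:(lra)) as B2.
    replace (y t2 - x k t2 - (y t1 - x k t1))%C with
      ((x j t2 - x k t2 - (x j t1 - x k t1)) + ((y t2 - x j t2) - (y t1 - x j t1)))%C by ring.
    eapply Rle_trans; [apply Cmod_triangle|]. apply Rplus_le_compat; [assumption|].
    eapply Rle_trans; [apply Cmod_minus_le|]. lra.
  - destruct (choice_fun nat (R -> CC) (fun k g' => DerivOn a b (x k) g' /\ exists M, hle N g' M))
      as [x' Hx'].
    { intros k. destruct (Hx k) as [M [_ [g' [H1 H2]]]]. exists g'. eauto. }
    destruct (IH x') as [y' Hy'].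
    + intros k. apply Hx'.
    + intros k j Hkj. destruct (Hc k j Hkj) as [_ [g' [H1 H2]]].
      apply (hle_ext N g'); [|assumption].
      apply (DerivOn_unique a b Hab _ _ _ H1). apply DerivOn_minus; apply Hx'.
    + assumption.
    + assert (Hyd : DerivOn a b y y').
      (* The limit is not differentiated directly. A primitive [G] of [y'] is taken, and [y a + G]
         coincides with [y] because both stay within a multiple of [rho k] of [x k]. *)
      { destruct (ContOn_primitive a b Hab y') as [G [HG HGa]].
        { apply (ContOn_ext a b (fun t => (y' t - x' 0%nat t) + x' 0%nat t)%C); [intros; ring|].
          apply ContOn_plus.
          - apply (hle_ContOn N _ _ (Hy' 0%nat)).
          - destruct (Hx' 0%nat) as [_ [M HM]]. apply (hle_ContOn N _ _ HM). }
        apply (DerivOn_ext a b (fun t => y a + G t)%C (fun t => RtoC 0 + y' t)%C).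
        - intros t Ht. apply Cminus_eq_0, Cmod_le_0. apply le_all_eps. intros e He.
          assert (Hq : 0 < e / (2 + (b - a))) by (apply Rdiv_lt_0_compat; lra).
          destruct (Hrho _ Hq) as [k Hk].
          assert (Hk' : (2 + (b - a)) * rho k <= e).
          { apply Rlt_le, (Rmult_le_compat_l (2 + (b - a))) in Hk; [|lra].
            replace ((2 + (b - a)) * (e / (2 + (b - a)))) with e in Hk by (field; lra). exact Hk. }
          pose proof (Hy t Ht k) as B1. pose proof (Hy a ltac:(lra) k) as B2.
          assert (B3 : Cmod ((G t - x k t) - (G a - x k a))%C <= rho k * (t - a)).
          { apply (DerivOn_lipschitz a b Hab (fun t => G t - x k t)%C (fun t => y' t - x' k t)%C);
              try lra.
            - apply DerivOn_minus; [assumption|apply Hx'].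
            - apply (hle_bound _ _ _ (Hy' k)). }
          replace (y a + G t - y t)%C with
            ((y a - x k a) - (y t - x k t) + ((G t - x k t) - (G a - x k a)))%C
            by (rewrite HGa; ring).
          eapply Rle_trans; [apply Cmod_triangle|].
          eapply Rle_trans; [apply Rplus_le_compat_r, Cmod_minus_le|].
          pose proof (Cmod_ge_0 (y t - x k t)%C). nra.
        - intros; ring.
        - apply DerivOn_plus; [apply DerivOn_const|assumption]. }
      intros k. split; [auto|]. exists (fun t => y' t - x' k t)%C. split; [|auto].
      apply DerivOn_minus; [assumption|apply Hx'].
Qed.
End Holder.

(** * The initial value problem *)

Lemma exp_nondecreasing (x y : R) : x <= y -> exp x <= exp y.
Proof. intros [H| ->]; [apply Rlt_le, exp_increasing, H|apply Rle_refl]. Qed.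

Section Picard.
Context (a b : R) (Hab : a < b).

Lemma exp_growth_ge_1 (lam t : R) : 0 <= lam -> a <= t -> 1 <= exp (lam * (t - a)).
Proof. intros H1 H2. rewrite <- exp_0. apply exp_nondecreasing. apply Rmult_le_pos; lra. Qed.

Lemma exp_growth_le (lam t : R) : 0 <= lam -> t <= b -> exp (lam * (t - a)) <= exp (lam * (b - a)).
Proof. intros H1 H2. apply exp_nondecreasing. apply Rmult_le_compat_l; lra. Qed.

(* In the norm weighted by exp (- lam (t - a)) with lam > 2 C the Picard map halves distances. *)
Lemma picard (I : Type) (Phi : R -> (I -> CC) -> I -> CC) (C M : R) (d : I -> CC) :
  0 <= C -> 0 <= M ->
  (forall t u v rho, a <= t <= b -> (forall i, Cmod (u i - v i)%C <= rho) ->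
     forall i, Cmod (Phi t u i - Phi t v i)%C <= C * rho) ->
  (forall w : I -> R -> CC, (forall i, ContOn a b (w i)) ->
     forall i, ContOn a b (fun t => Phi t (fun j => w j t) i)) ->
  (forall t i, a <= t <= b -> Cmod (Phi t d i) <= M) ->
  exists w : I -> R -> CC,
    (forall i, w i a = d i) /\
    (forall i, DerivOn a b (w i) (fun t => Phi t (fun j => w j t) i)) /\
    (exists S, forall i t, a <= t <= b -> Cmod (w i t - d i)%C <= S).
Proof.
  intros HC HM Hlip Hcont Hd.
  (* [P] selects the primitive vanishing at [a]; on discontinuous arguments its value is arbitrary,
     and every iterate is shown to be continuous. *)
  destruct (choice_fun (R -> CC) (R -> CC)
    (fun g G => ContOn a b g -> DerivOn a b G g /\ G a = RtoC 0)) as [P HP].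
  { intros g. destruct (excluded_middle_informative (ContOn a b g)) as [H|H].
    - destruct (ContOn_primitive a b Hab g H) as [G HG]. exists G. auto.
    - exists g. intros; contradiction. }
  set (W := fix W (k : nat) : I -> R -> CC := match k with
    | O => fun i _ => d i
    | S k' => fun i t => (d i + P (fun s => Phi s (fun j => W k' j s) i) t)%C end).
  assert (HWc : forall k i, ContOn a b (W k i)).
  { induction k as [|k IH]; intros i.
    - apply ContOn_const.
    - simpl. apply ContOn_plus; [apply ContOn_const|].
      destruct (HP _ (Hcont _ IH i)) as [H _]. apply (DerivOn_ContOn _ _ _ _ H). }
  assert (HWd : forall k i, DerivOn a b (W (S k) i) (fun t => Phi t (fun j => W k j t) i)).
  { intros k i. apply (DerivOn_ext a b (W (S k) i) (fun t => RtoC 0 + Phi t (fun j => W k j t) i)%C);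
      [reflexivity|intros; ring|].
    simpl. apply DerivOn_plus; [apply DerivOn_const|].
    apply (HP _ (Hcont _ (HWc k) i)). }
  assert (HWa : forall k i, W k i a = d i).
  { intros [|k] i; [reflexivity|]. simpl.
    destruct (HP _ (Hcont _ (HWc k) i)) as [_ ->]. ring. }
  (* [lam > 2 * C] gives [C / lam <= 1 / 2], and [lam >= 1] gives [M / lam <= M] for the first
     step. *)
  set (lam := 2 * C + 1). assert (Hlam : 1 <= lam) by (unfold lam; lra).
  set (E := fun t => exp (lam * (t - a))).
  assert (HE : forall t, a <= t <= b -> 1 <= E t <= E b).
  { intros t Ht. split; [apply exp_growth_ge_1; lra|apply exp_growth_le; lra]. }
  assert (Hstep : forall k i t, a <= t <= b ->
    Cmod (W (S k) i t - W k i t)%C <= M * (/2) ^ k * E t).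
  { induction k as [|k IH]; intros i t Ht.
    - rewrite pow_O, Rmult_1_r.
      assert (H : DerivOn a b (fun s => W 1%nat i s - W 0%nat i s)%C
        (fun s => Phi s (fun j => W 0%nat j s) i - RtoC 0)%C).
      { apply DerivOn_minus; [apply HWd|apply DerivOn_const]. }
      eapply Rle_trans; [apply (DerivOn_exp_bound a b Hab _ _ M lam ltac:(lra) HM H)|].
      + intros s Hs. replace (Phi s (fun j => W 0%nat j s) i - RtoC 0)%C
          with (Phi s d i) by (change (fun j => W 0%nat j s) with d; ring).
        specialize (Hd s i Hs). specialize (HE s Hs). fold (E s). nra.
      + assumption.
      + rewrite !HWa. replace (d i - d i)%C with (RtoC 0) by ring. rewrite Cmod_0.
        fold (E t). specialize (HE t Ht). rewrite Rplus_0_l. apply Rmult_le_compat_r; [lra|].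
        apply Rle_div_l; nra.
    - assert (Hk : 0 <= M * (/2) ^ k) by (apply Rmult_le_pos; [assumption|apply pow_le; lra]).
      assert (H : DerivOn a b (fun s => W (S (S k)) i s - W (S k) i s)%C
        (fun s => Phi s (fun j => W (S k) j s) i - Phi s (fun j => W k j s) i)%C).
      { apply DerivOn_minus; apply HWd. }
      eapply Rle_trans; [apply (DerivOn_exp_bound a b Hab _ _ (C * (M * (/2) ^ k)) lam
        ltac:(lra) (Rmult_le_pos _ _ HC Hk) H)|].
      + intros s Hs. rewrite Rmult_assoc. apply Hlip; [assumption|].
        intros j. apply IH. assumption.
      + assumption.
      + rewrite !HWa. replace (d i - d i)%C with (RtoC 0) by ring. rewrite Cmod_0.
        fold (E t). specialize (HE t Ht). rewrite Rplus_0_l. apply Rmult_le_compat_r; [lra|].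
        apply Rle_div_l; [lra|]. simpl. set (q := M * (/2)^k) in *.
        replace (M * (/2 * (/2)^k) * lam) with (q * (lam / 2)) by (unfold q; field).
        unfold lam. nra. }
  (* The tail, from index [k] on, of the geometric series bounding the successive differences. *)
  set (rho := fun k => 2 * (M * E b) * (/2) ^ k).
  assert (HEb : 1 <= E b) by (apply HE; lra).
  assert (HME : 0 <= M * E b) by (apply Rmult_le_pos; lra).
  assert (Htel : forall j k i t, a <= t <= b ->
    Cmod (W (j + k)%nat i t - W k i t)%C <= rho k - rho (j + k)%nat).
  { induction j as [|j IH]; intros k i t Ht.
    - simpl. replace (W k i t - W k i t)%C with (RtoC 0) by ring. rewrite Cmod_0. lra.
    - eapply Rle_trans; [apply (Cmod_triangle3 _ (W (j + k)%nat i t))|].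
      specialize (IH k i t Ht). specialize (Hstep (j + k)%nat i t Ht). specialize (HE t Ht).
      assert (Hp : 0 <= M * (/2) ^ (j + k)) by (apply Rmult_le_pos; [assumption|apply pow_le; lra]).
      assert (M * (/2) ^ (j + k) * E t <= M * (/2) ^ (j + k) * E b) by (apply Rmult_le_compat_l; lra).
      assert (rho (S j + k)%nat = rho (j + k)%nat - M * (/2) ^ (j + k) * E b).
      { unfold rho. simpl. field. }
      change (S j + k)%nat with (S (j + k)) in *. lra. }
  assert (Hcau : forall k j i t, (k <= j)%nat -> a <= t <= b ->
    Cmod (W j i t - W k i t)%C <= rho k).
  { intros k j i t Hkj Ht. replace j with ((j - k) + k)%nat by lia.
    eapply Rle_trans; [apply Htel; assumption|].
    assert (0 <= rho (j - k + k)%nat).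
    { unfold rho. apply Rmult_le_pos; [lra|apply pow_le; lra]. }
    lra. }
  assert (Hrho : forall e, 0 < e -> exists k, rho k < e).
  { intros e He. apply pow_half_small; [lra|assumption]. }
  destruct (choice_fun (I * R) CC (fun it l => a <= snd it <= b ->
    forall k, Cmod (l - W k (fst it) (snd it))%C <= rho k)) as [w' Hw'].
  { intros [i t]. simpl. destruct (excluded_middle_informative (a <= t <= b)) as [Ht|Ht].
    - destruct (C_complete (fun k => W k i t) rho) as [l Hl]; [|assumption|exists l; auto].
      intros k j Hkj. apply Hcau; assumption.
    - exists (RtoC 0). intros; contradiction. }
  set (w := fun i t => w' (i, t)).
  assert (Hw : forall i t, a <= t <= b -> forall k, Cmod (w i t - W k i t)%C <= rho k).
  { intros i t Ht. apply (Hw' (i, t)). assumption. }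
  assert (Hwc : forall i, ContOn a b (w i)).
  { intros i. apply (ContOn_uniform_limit a b (fun k => W k i) (w i) rho); auto. }
  assert (Hwa : forall i, w i a = d i).
  { intros i. apply Cminus_eq_0, Cmod_le_0. apply le_all_eps. intros e He.
    destruct (Hrho e He) as [k Hk]. pose proof (Hw i a ltac:(lra) k) as H. rewrite HWa in H. lra. }
  exists w. split; [assumption|]. split.
  - intros i. destruct (HP _ (Hcont _ Hwc i)) as [HG HGa].
    set (G := P (fun t => Phi t (fun j => w j t) i)) in *.
    apply (DerivOn_ext a b (fun t => d i + G t)%C (fun t => RtoC 0 + Phi t (fun j => w j t) i)%C);
      [|intros; ring|apply DerivOn_plus; [apply DerivOn_const|assumption]].
    (* Both [d i + G] and [w i] are close to the iterate [W (S k) i], the former by integrating the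
       Lipschitz bound, the latter by convergence. Hence they agree and [w] satisfies the integral
       equation. *)
    intros t Ht. apply Cminus_eq_0, Cmod_le_0. apply le_all_eps. intros e He.
    set (L := C * (b - a) + 1). assert (HL : 1 <= L) by (unfold L; nra).
    assert (Hq : 0 < e / L) by (apply Rdiv_lt_0_compat; lra).
    destruct (Hrho _ Hq) as [k Hk].
    assert (Hk' : L * rho k <= e).
    { apply Rlt_le, (Rmult_le_compat_l L) in Hk; [|lra].
      replace (L * (e / L)) with e in Hk by (field; lra). exact Hk. }
    assert (Hr0 : 0 <= rho k) by (unfold rho; apply Rmult_le_pos; [lra|apply pow_le; lra]).
    assert (H1 : Cmod ((d i + G t - W (S k) i t) - (d i + G a - W (S k) i a))%C
      <= C * rho k * (t - a)).
    { apply (DerivOn_lipschitz a b Hab (fun t => d i + G t - W (S k) i t)%C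
        (fun t => (RtoC 0 + Phi t (fun j => w j t) i) - Phi t (fun j => W k j t) i)%C); try lra.
      - apply DerivOn_minus; [|apply HWd]. apply DerivOn_plus; [apply DerivOn_const|assumption].
      - intros s Hs. replace (RtoC 0 + Phi s (fun j => w j s) i - Phi s (fun j => W k j s) i)%C
          with (Phi s (fun j => w j s) i - Phi s (fun j => W k j s) i)%C by ring.
        apply Hlip; auto. }
    rewrite HGa, HWa in H1. pose proof (Hw i t Ht (S k)) as H2.
    replace (d i + G t - w i t)%C with
      ((d i + G t - W (S k) i t - (d i + RtoC 0 - d i)) - (w i t - W (S k) i t))%C by ring.
    eapply Rle_trans; [apply Cmod_minus_le|].
    assert (H3 : rho (S k) <= rho k) by (unfold rho; simpl; assert (0 <= (/2)^k) by (apply pow_le; lra); nra).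
    assert (H4 : C * rho k * (t - a) <= C * rho k * (b - a)).
    { apply Rmult_le_compat_l; [apply Rmult_le_pos; lra|lra]. }
    unfold L in Hk'. lra.
  - exists (rho 0%nat). intros i t Ht. apply (Hw i t Ht 0%nat).
Qed.
End Picard.

Definition opC (m r : nat) (A : nat -> nat -> nat -> R -> CC) (D : nat -> nat -> R -> CC)
  (i : nat) (t : R) : CC :=
  Csum r (fun p => Csum m (fun k => Cmult (A p i k t) (D k p t))).

(* [D i p] plays the role of the p-th derivative of the i-th component of a solution. *)
Definition ivp (a b alpha : R) (n m r : nat) (KA : R) (A : nat -> nat -> nat -> R -> CC)
  (f : nat -> R -> CC) (F delta : R) (D : nat -> nat -> R -> CC) : Prop :=
  (forall p i k, (p < r)%nat -> (i < m)%nat -> (k < m)%nat -> hle a b alpha n (A p i k) KA) /\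
  (forall i, (i < m)%nat -> hle a b alpha n (f i) F) /\
  (forall i p, (i < m)%nat -> (p < r)%nat -> DerivOn a b (D i p) (D i (S p))) /\
  (forall i t, (i < m)%nat -> a <= t <= b -> D i r t = (f i t - opC m r A D i t)%C) /\
  (forall i p, (i < m)%nat -> (p < r)%nat -> Cmod (D i p a) <= delta) /\
  (exists S, forall i p t, (i < m)%nat -> (p < r)%nat -> a <= t <= b -> Cmod (D i p t) <= S).

Section IVP.
Context (a b alpha : R) (Hab : a < b) (Hal : 0 < alpha <= 1) (n m r : nat).
Notation hle := (hle a b alpha).
Notation kap := (kap a b alpha).
Notation mulc := (mulc a b alpha).

Lemma opC_ext (A A' : nat -> nat -> nat -> R -> CC) (D D' : nat -> nat -> R -> CC) (i : nat) (t : R) :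
  (forall p k, (p < r)%nat -> (k < m)%nat -> A p i k t = A' p i k t) ->
  (forall p k, (p < r)%nat -> (k < m)%nat -> D k p t = D' k p t) ->
  opC m r A D i t = opC m r A' D' i t.
Proof.
  intros H1 H2. apply Csum_ext. intros p Hp. apply Csum_ext. intros k Hk.
  rewrite H1, H2 by assumption. reflexivity.
Qed.

Lemma opC_minus_D (A : nat -> nat -> nat -> R -> CC) (D D' : nat -> nat -> R -> CC) (i : nat) (t : R) :
  opC m r A (fun k p t => D k p t - D' k p t)%C i t = (opC m r A D i t - opC m r A D' i t)%C.
Proof.
  unfold opC. rewrite <- Csum_minus. apply Csum_ext. intros p _.
  rewrite <- Csum_minus. apply Csum_ext. intros; ring.
Qed.

Lemma opC_minus_A (A A' : nat -> nat -> nat -> R -> CC) (D : nat -> nat -> R -> CC) (i : nat) (t : R) :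
  opC m r (fun p i k t => A p i k t - A' p i k t)%C D i t = (opC m r A D i t - opC m r A' D i t)%C.
Proof.
  unfold opC. rewrite <- Csum_minus. apply Csum_ext. intros p _.
  rewrite <- Csum_minus. apply Csum_ext. intros; ring.
Qed.

Lemma opC_le (A : nat -> nat -> nat -> R -> CC) (D : nat -> nat -> R -> CC) (i : nat) (t KA rho : R) :
  0 <= KA ->
  (forall p k, (p < r)%nat -> (k < m)%nat -> Cmod (A p i k t) <= KA) ->
  (forall p k, (p < r)%nat -> (k < m)%nat -> Cmod (D k p t) <= rho) ->
  Cmod (opC m r A D i t) <= INR r * (INR m * (KA * rho)).
Proof.
  intros H0 H1 H2. apply Csum_le. intros p Hp. apply Csum_le. intros k Hk.
  rewrite Cmod_mult. apply Rmult_le_compat; auto using Cmod_ge_0.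
Qed.

Lemma hle_opC (N : nat) (A : nat -> nat -> nat -> R -> CC) (D : nat -> nat -> R -> CC) (i : nat) (KA rho : R) :
  (forall p k, (p < r)%nat -> (k < m)%nat -> hle N (A p i k) KA) ->
  (forall p k, (p < r)%nat -> (k < m)%nat -> hle N (D k p) rho) ->
  hle N (opC m r A D i) (INR r * (INR m * (mulc N * (KA * rho)))).
Proof.
  intros H1 H2. apply (hle_Csum a b alpha N r (fun p t => Csum m (fun k => A p i k t * D k p t)%C)).
  intros p Hp. apply (hle_Csum a b alpha N m (fun k t => A p i k t * D k p t)%C).
  intros k Hk. apply hle_mult; auto.
Qed.

Lemma ivp_exists_tower (KA : R) (A : nat -> nat -> nat -> R -> CC) (f : nat -> R -> CC) (F delta : R)
  (d : nat -> nat -> CC) : (1 <= r)%nat -> 0 <= KA -> 0 <= F -> 0 <= delta ->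
  (forall p i k, (p < r)%nat -> (i < m)%nat -> (k < m)%nat -> hle n (A p i k) KA) ->
  (forall i, (i < m)%nat -> hle n (f i) F) ->
  (forall i p, (i < m)%nat -> (p < r)%nat -> Cmod (d i p) <= delta) ->
  exists D, ivp a b alpha n m r KA A f F delta D /\
    (forall i p, (i < m)%nat -> (p < r)%nat -> D i p a = d i p).
Proof.
  intros Hr HKA HF Hdel HA Hf Hd.
  (* The equation as a first-order system in the unknowns indexed by [(i, p)]: rows with [S p < r]
     are shifts, the row with [S p = r] is the equation solved for the top derivative. Pairs with
     [i >= m] get the zero field, since the index type is all of [nat * nat]. *)
  set (Phi := fun (t : R) (u : nat * nat -> CC) (ip : nat * nat) => let (i, p) := ip in
    if lt_dec i m then
      if lt_dec (S p) r then u (i, S p)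
      else (f i t - opC m r A (fun k q _ => u (k, q)) i t)%C
    else RtoC 0).
  set (c := INR r * (INR m * KA)).
  assert (Hc : 0 <= c) by (unfold c; repeat apply Rmult_le_pos; auto using pos_INR).
  set (d' := fun ip : nat * nat => let (i, p) := ip in
    if lt_dec i m then if lt_dec p r then d i p else RtoC 0 else RtoC 0).
  assert (Hd' : forall ip, Cmod (d' ip) <= delta).
  { intros [i p]. simpl. destruct (lt_dec i m), (lt_dec p r); rewrite ?Cmod_0; auto. }
  (* In [1 + c] the 1 is the Lipschitz constant of the shift rows and [c] that of the closing row;
     [delta] and [F + c * delta] bound these rows at the initial data. *)
  destruct (picard a b Hab (nat * nat) Phi (1 + c) (delta + F + c * delta) d') as [w [Hwa [Hwd [S HS]]]].
  - lra.
  - assert (0 <= c * delta) by (apply Rmult_le_pos; assumption). lra.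
  - intros t u v rho Ht Huv [i p]. unfold Phi.
    assert (Hrho : 0 <= rho).
    { eapply Rle_trans; [apply Cmod_ge_0|apply (Huv (0, 0)%nat)]. }
    assert (Hcr : 0 <= c * rho) by (apply Rmult_le_pos; assumption).
    destruct (lt_dec i m) as [Hi|Hi].
    + destruct (lt_dec (Datatypes.S p) r) as [Hp|Hp].
      * specialize (Huv (i, Datatypes.S p)). lra.
      * replace (f i t - opC m r A (fun k q _ => u (k, q)) i t
          - (f i t - opC m r A (fun k q _ => v (k, q)) i t))%C with
          (- opC m r A (fun k q _ => u (k, q) - v (k, q))%C i t)%C.
        2:{ rewrite (opC_minus_D A (fun k q _ => u (k, q)) (fun k q _ => v (k, q))). ring. }
        rewrite Cmod_opp. apply Rle_trans with (c * rho); [|lra].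
        replace (c * rho) with (INR r * (INR m * (KA * rho))) by (unfold c; ring).
        apply opC_le; auto. intros. apply (hle_bound a b alpha n); auto.
    + replace (RtoC 0 - RtoC 0)%C with (RtoC 0) by ring. rewrite Cmod_0. nra.
  - intros w Hw [i p]. unfold Phi.
    destruct (lt_dec i m) as [Hi|Hi]; [destruct (lt_dec (Datatypes.S p) r) as [Hp|Hp]|].
    + apply Hw.
    + assert (Hsum : forall N (G : nat -> R -> CC), (forall j, (j < N)%nat -> ContOn a b (G j)) ->
        ContOn a b (fun t => Csum N (fun j => G j t))).
      { induction N as [|N IH]; intros G HG; simpl; [apply ContOn_const|].
        apply ContOn_plus; auto. }
      apply (ContOn_ext a b (fun t => f i t + (- RtoC 1) * opC m r A (fun k q s => w (k, q) t) i t)%C);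
        [intros; ring|].
      apply ContOn_plus; [apply (hle_ContOn a b alpha Hab Hal n _ F); auto|].
      apply ContOn_mult; [apply ContOn_const|]. unfold opC.
      apply (Hsum r (fun q t => Csum m (fun k => A q i k t * w (k, q) t)%C)). intros q Hq.
      apply (Hsum m (fun k t => A q i k t * w (k, q) t)%C). intros k Hk.
      apply ContOn_mult; [|apply Hw]. apply (hle_ContOn a b alpha Hab Hal n _ KA); auto.
    + apply ContOn_const.
  - intros t [i p] Ht. unfold Phi.
    assert (Hcd : 0 <= c * delta) by (apply Rmult_le_pos; assumption).
    destruct (lt_dec i m) as [Hi|Hi]; [destruct (lt_dec (Datatypes.S p) r) as [Hp|Hp]|].
    + specialize (Hd' (i, Datatypes.S p)). lra.
    + eapply Rle_trans; [apply Cmod_minus_le|].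
      pose proof (hle_bound a b alpha n _ _ (Hf i Hi) t Ht).
      assert (Cmod (opC m r A (fun k q _ => d' (k, q)) i t) <= c * delta); [|lra].
      replace (c * delta) with (INR r * (INR m * (KA * delta))) by (unfold c; ring).
      apply opC_le; auto. intros. apply (hle_bound a b alpha n); auto.
    + rewrite Cmod_0. lra.
  (* The system supplies the orders [p < r]; order [r] is defined by the equation itself. *)
  - set (D := fun i p t => if lt_dec p r then w (i, p) t else
      (f i t - opC m r A (fun k q s => w (k, q) s) i t)%C).
    assert (HDw : forall i p t, (p < r)%nat -> D i p t = w (i, p) t).
    { intros i p t Hp. unfold D. destruct (lt_dec p r); [reflexivity|lia]. }
    assert (HDa : forall i p, (i < m)%nat -> (p < r)%nat -> D i p a = d i p).
    { intros i p Hi Hp. rewrite HDw, Hwa by assumption. unfold d'.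
      destruct (lt_dec i m), (lt_dec p r); lia || reflexivity. }
    exists D. split; [|assumption].
    split; [assumption|]. split; [assumption|]. split; [|split; [|split]].
    + intros i p Hi Hp. eapply DerivOn_ext; [| |apply (Hwd (i, p))].
      * intros t _. rewrite HDw by assumption. reflexivity.
      * intros t _. unfold Phi, D. destruct (lt_dec i m); [|lia].
        destruct (lt_dec (Datatypes.S p) r); [reflexivity|].
        unfold opC. reflexivity.
    + intros i t Hi Ht. unfold D at 1. destruct (lt_dec r r); [lia|]. f_equal.
      apply opC_ext; [reflexivity|]. intros p k Hp _. rewrite HDw by assumption. reflexivity.
    + intros i p Hi Hp. rewrite HDa by assumption. auto.
    + exists (S + delta). intros i p t Hi Hp Ht. rewrite HDw by assumption.
      eapply Rle_trans; [apply (Cmod_le_minus _ (d' (i, p)))|].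
      specialize (HS (i, p) t Ht). specialize (Hd' (i, p)). lra.
Qed.

(** A Gronwall estimate by iteration. If the lower derivatives are at most [rho * E t], integration
    with [lam = 2 * c] improves this to [(rho / 2 + F + delta) * E t]. From the finite bound
    contained in [ivp] the iterates of [rho] tend to the fixed point [2 * (F + delta)], whatever
    that bound was. *)
Lemma ivp_sup_bound (KA : R) : 0 <= KA -> exists K, 0 <= K /\
  forall A f F delta D, 0 <= F -> 0 <= delta -> ivp a b alpha n m r KA A f F delta D ->
  forall i p t, (i < m)%nat -> (p <= r)%nat -> a <= t <= b -> Cmod (D i p t) <= K * (F + delta).
Proof.
  intros HKA. set (c := 1 + INR r * (INR m * KA)).
  assert (Hc' : 0 <= INR r * (INR m * KA)) by (repeat apply Rmult_le_pos; auto using pos_INR).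
  assert (Hc : 1 <= c) by (unfold c; lra).
  set (lam := 2 * c). set (E := fun t => exp (lam * (t - a))).
  assert (HE : forall t, a <= t <= b -> 1 <= E t <= E b).
  { intros t Ht. split; [apply exp_growth_ge_1; unfold lam; lra|apply exp_growth_le; unfold lam; lra]. }
  assert (HEb : 1 <= E b) by (apply HE; lra).
  exists (2 * E b * c). split; [nra|].
  intros A f F delta D HF Hdel [HA [Hf [HD [Heq [Hda [S HS]]]]]].
  set (S' := Rabs S). assert (HS' : 0 <= S') by apply Rabs_pos.
  assert (Htop : forall i t rho, (i < m)%nat -> a <= t <= b ->
    (forall k p, (k < m)%nat -> (p < r)%nat -> Cmod (D k p t) <= rho) ->
    Cmod (D i r t) <= F + INR r * (INR m * KA) * rho).
  { intros i t rho Hi Ht H. rewrite Heq by assumption.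
    eapply Rle_trans; [apply Cmod_minus_le|]. apply Rplus_le_compat.
    - apply (hle_bound a b alpha n _ _ (Hf i Hi) t Ht).
    - replace (INR r * (INR m * KA) * rho) with (INR r * (INR m * (KA * rho))) by ring.
      apply opC_le; auto. intros. apply (hle_bound a b alpha n); auto. }
  assert (Hit : forall N i p t, (i < m)%nat -> (p < r)%nat -> a <= t <= b ->
    Cmod (D i p t) <= (2 * (F + delta) + S' * (/2) ^ N) * E t).
  { induction N as [|N IH]; intros i p t Hi Hp Ht.
    - specialize (HS i p t Hi Hp Ht). pose proof (Rle_abs S). fold S' in H.
      specialize (HE t Ht). rewrite pow_O. nra.
    - set (rho := 2 * (F + delta) + S' * (/2) ^ N) in *.
      assert (Hrho : 0 <= rho).
      { unfold rho. assert (0 <= S' * (/2)^N) by (apply Rmult_le_pos; [assumption|apply pow_le; lra]). lra. }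
      eapply Rle_trans; [apply (DerivOn_exp_bound a b Hab (D i p) (D i (Datatypes.S p)) (c * rho + F) lam)|].
      + unfold lam; lra.
      + nra.
      + apply HD; assumption.
      + intros s Hs. fold (E s). specialize (HE s Hs).
        destruct (Nat.eq_dec (Datatypes.S p) r) as [->|Hne].
        * eapply Rle_trans; [apply (Htop i s (rho * E s) Hi Hs); intros; apply IH; assumption|].
          unfold c. nra.
        * eapply Rle_trans; [apply IH; [assumption|lia|assumption]|].
          apply Rmult_le_compat_r; nra.
      + assumption.
      + fold (E t). specialize (HE t Ht). specialize (Hda i p Hi Hp).
        assert ((c * rho + F) / lam <= rho / 2 + F).
        { apply Rle_div_l; [unfold lam; lra|]. unfold lam. nra. }
        replace (2 * (F + delta) + S' * (/2) ^ Datatypes.S N) with (rho / 2 + F + delta)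
          by (unfold rho; simpl; field).
        assert ((c * rho + F) / lam * E t <= (rho / 2 + F) * E t) by (apply Rmult_le_compat_r; lra).
        nra. }
  assert (Hlow : forall i p t, (i < m)%nat -> (p < r)%nat -> a <= t <= b ->
    Cmod (D i p t) <= 2 * (F + delta) * E b).
  { intros i p t Hi Hp Ht. apply le_all_eps. intros e He.
    destruct (pow_half_small (S' * E b) e ltac:(nra) He) as [N HN].
    eapply Rle_trans; [apply (Hit N i p t Hi Hp Ht)|].
    assert (0 <= S' * (/2) ^ N) by (apply Rmult_le_pos; [assumption|apply pow_le; lra]).
    specialize (HE t Ht).
    apply Rle_trans with ((2 * (F + delta) + S' * (/2)^N) * E b); [apply Rmult_le_compat_l; lra|]. lra. }
  assert (Hpos : 0 <= 2 * (F + delta) * E b) by nra.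
  intros i p t Hi Hp Ht. destruct (Nat.eq_dec p r) as [->|Hne].
  - eapply Rle_trans; [apply (Htop i t (2 * (F + delta) * E b) Hi Ht); intros; apply Hlow; assumption|].
    unfold c. assert (F <= 2 * (F + delta) * E b) by nra. lra.
  - eapply Rle_trans; [apply Hlow; [assumption|lia|assumption]|]. nra.
Qed.

(** The equation expresses the top derivative through [f], the coefficients and the lower
    derivatives, so it inherits their order [k]. The powers of [kap] pay for lowering [f] and the
    coefficients from order [n] to [k]. *)
Lemma hle_ivp_top (KA K : R) (k : nat) (A : nat -> nat -> nat -> R -> CC) (f : nat -> R -> CC)
  (F delta : R) (D : nat -> nat -> R -> CC) : (k <= n)%nat -> 0 <= K -> 0 <= F -> 0 <= delta ->
  ivp a b alpha n m r KA A f F delta D ->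
  (forall i p, (i < m)%nat -> (p < r)%nat -> hle k (D i p) (K * (F + delta))) ->
  forall i, (i < m)%nat ->
  hle k (D i r) ((kap ^ n + INR r * (INR m * (mulc k * (kap ^ n * KA * K)))) * (F + delta)).
Proof.
  intros Hk HK HF Hdel [HA [Hf [_ [Heq _]]]] H i Hi.
  apply (hle_ext a b alpha k (fun t => f i t - opC m r A D i t)%C).
  { intros t Ht. symmetry. auto. }
  pose proof (kap_pow_ge_1 a b alpha n) as Hkp.
  apply (hle_mono a b alpha k) with
    (kap ^ n * F + INR r * (INR m * (mulc k * ((kap ^ n * KA) * (K * (F + delta)))))).
  { assert (0 <= kap ^ n * delta) by nra. lra. }
  apply hle_minus.
  - apply (hle_lower_le a b alpha Hab Hal k n n); [lia|lia|auto].
  - apply hle_opC; [|auto]. intros. apply (hle_lower_le a b alpha Hab Hal k n n); [lia|lia|auto].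
Qed.

(** Bootstrapping: order [k] of all derivatives below [r] gives order [k] of the top one, hence
    order [k + 1] of those below. The gain stops at [n], the order of the coefficients, and [r]
    integrations then lead to [n + r]. *)
Lemma ivp_hle_bound (KA : R) : 0 <= KA -> exists K, 0 <= K /\
  forall A f F delta D, 0 <= F -> 0 <= delta -> ivp a b alpha n m r KA A f F delta D ->
  forall i, (i < m)%nat -> hle (n + r) (D i 0%nat) (K * (F + delta)).
Proof.
  intros HKA.
  assert (Hk1 := kap_ge_1 a b alpha).
  destruct (ivp_sup_bound KA HKA) as [K0 [HK0 H0]].
  assert (Hc : forall k K, 0 <= K ->
    0 <= kap ^ n + INR r * (INR m * (mulc k * (kap ^ n * KA * K)))).
  { intros k K HK. pose proof (kap_pow_ge_1 a b alpha n). pose proof (mulc_ge_1 a b alpha k).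
    apply Rplus_le_le_0_compat; [lra|].
    repeat apply Rmult_le_pos; auto using pos_INR; lra. }
  assert (Hk : forall k, (k <= n)%nat -> exists K, 0 <= K /\
    forall A f F delta D, 0 <= F -> 0 <= delta -> ivp a b alpha n m r KA A f F delta D ->
    forall i p, (i < m)%nat -> (p < r)%nat -> hle k (D i p) (K * (F + delta))).
  { induction k as [|k IH]; intros Hkn.
    - exists (kap * K0). split; [nra|]. intros A f F delta D HF Hdel HD i p Hi Hp.
      rewrite Rmult_assoc. apply (hle_lipschitz a b alpha Hab Hal _ (D i (S p))).
      + apply HD; assumption.
      + intros. apply (H0 A f F delta D); auto; lia.
      + intros. apply (H0 A f F delta D); auto.
    - destruct (IH ltac:(lia)) as [K [HK H]].
      pose proof (Hc k K HK) as Hc'.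
      set (c := kap ^ n + INR r * (INR m * (mulc k * (kap ^ n * KA * K)))) in *.
      exists (K + c). split; [lra|]. intros A f F delta D HF Hdel HD i p Hi Hp.
      assert (Hfd : 0 <= F + delta) by lra.
      split.
      + intros t Ht. pose proof (hle_bound a b alpha _ _ _ (H A f F delta D HF Hdel HD i p Hi Hp) t Ht). nra.
      + exists (D i (S p)). split; [apply HD; assumption|].
        destruct (Nat.eq_dec (S p) r) as [->|Hne].
        * apply (hle_mono a b alpha k) with (c * (F + delta)); [nra|].
          apply (hle_ivp_top KA K k A f F delta D); auto. lia.
          intros; apply (H A f F delta D); auto.
        * apply (hle_mono a b alpha k) with (K * (F + delta)); [nra|].
          apply (H A f F delta D); auto. lia. }
  destruct (Hk n (Nat.le_refl _)) as [K [HK H]].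
  pose proof (Hc n K HK) as Hc'.
  set (c := kap ^ n + INR r * (INR m * (mulc n * (kap ^ n * KA * K)))) in *.
  exists (K0 + c). split; [lra|]. intros A f F delta D HF Hdel HD i Hi.
  assert (Hfd : 0 <= F + delta) by lra.
  (* Descent from the top derivative, each integration adding one order. *)
  assert (Hj : forall j, (j <= r)%nat -> hle (n + j) (D i (r - j)%nat) ((K0 + c) * (F + delta))).
  { induction j as [|j IH]; intros Hj.
    - rewrite Nat.add_0_r, Nat.sub_0_r. apply (hle_mono a b alpha n) with (c * (F + delta)); [nra|].
      apply (hle_ivp_top KA K n A f F delta D); auto. intros; apply (H A f F delta D); auto.
    - rewrite Nat.add_succ_r. split.
      + intros t Ht. pose proof (H0 A f F delta D HF Hdel HD i (r - S j)%nat t Hi ltac:(lia) Ht). nra.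
      + exists (D i (S (r - S j))). split; [apply HD; [assumption|lia]|].
        replace (S (r - S j)) with (r - j)%nat by lia. apply IH. lia. }
  specialize (Hj r (Nat.le_refl _)). rewrite Nat.sub_diag in Hj. exact Hj.
Qed.
End IVP.

(** * Linear systems *)

(** Gaussian elimination on [N + 1] vectors with [N] coordinates: a pivot clears the last coordinate
    of the other vectors, and induction applies to these. *)
Lemma linear_dependence (N : nat) (v : nat -> nat -> CC) :
  exists c, (exists j, (j < S N)%nat /\ c j <> RtoC 0) /\
    forall i, (i < N)%nat -> Csum (S N) (fun j => c j * v j i)%C = RtoC 0.
Proof.
  revert v. induction N as [|N IH]; intros v.
  - exists (fun _ => RtoC 1). split; [exists 0%nat; split; [lia|apply C1_nz]|intros; lia].
  - destruct (excluded_middle_informative (exists p, (p < S N)%nat /\ v p N <> RtoC 0))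
      as [[p [Hp Hpv]]|Hno].
    (* The vectors other than the pivot must be numbered from 0 to [N]; the one with index [S N]
       takes the vacant place [p]. *)
    + set (sg := fun j => if Nat.eq_dec j p then S N else j).
      destruct (IH (fun j i => v (sg j) i - v (sg j) N / v p N * v p i)%C)
        as [c [[j0 [Hj0 Hc0]] Hc]].
      (* The coefficient of the pivot vector, chosen to cancel the last coordinate of the
         combination. *)
      set (e := (- Csum (S N) (fun j => c j * v (sg j) N) / v p N)%C).
      set (c' := fun j => if Nat.eq_dec j p then e else if Nat.eq_dec j (S N) then c p else c j).
      assert (Hsum : forall i, Csum (S (S N)) (fun j => c' j * v j i)%C =
        (e * v p i + Csum (S N) (fun j => c j * v (sg j) i))%C).
      { intros i. rewrite (Csum_pick (S (S N)) p) by lia. f_equal.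
        - unfold c'. destruct (Nat.eq_dec p p); [reflexivity|lia].
        - change (Csum (S (S N)) ?F) with (Csum (S N) F + F (S N))%C. cbv beta.
          rewrite (Csum_pick (S N) p (fun j => c j * v (sg j) i)%C) by lia. rewrite Cplus_comm. f_equal.
          + destruct (Nat.eq_dec (S N) p); [lia|]. unfold c', sg.
            destruct (Nat.eq_dec (S N) p); [lia|]. destruct (Nat.eq_dec (S N) (S N)); [|lia].
            destruct (Nat.eq_dec p p); [reflexivity|lia].
          + apply Csum_ext. intros j Hj. unfold c', sg.
            destruct (Nat.eq_dec j p); [reflexivity|].
            destruct (Nat.eq_dec j (S N)); [lia|reflexivity]. }
      exists c'. split.
      * destruct (Nat.eq_dec j0 p) as [->|Hne].
        -- exists (S N). split; [lia|]. unfold c'.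
           destruct (Nat.eq_dec (S N) p); [lia|]. destruct (Nat.eq_dec (S N) (S N)); [assumption|lia].
        -- exists j0. split; [lia|]. unfold c'.
           destruct (Nat.eq_dec j0 p); [lia|]. destruct (Nat.eq_dec j0 (S N)); [lia|assumption].
      * intros i Hi. rewrite Hsum. destruct (Nat.eq_dec i N) as [->|Hne].
        -- unfold e. generalize (Csum (S N) (fun j => (c j * v (sg j) N)%C)). intros X. field. assumption.
        -- assert (Hc2 : Csum (S N) (fun j => c j * v (sg j) i
             - (v p i / v p N) * (c j * v (sg j) N))%C = RtoC 0).
           { rewrite <- (Hc i ltac:(lia)). apply Csum_ext. intros j _. field. assumption. }
           rewrite Csum_minus, Csum_scal in Hc2. rewrite <- Hc2. unfold e.
           generalize (Csum (S N) (fun j => (c j * v (sg j) N)%C)).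
           generalize (Csum (S N) (fun j => (c j * v (sg j) i)%C)). intros X X'. field. assumption.
    (* Here the first [S N] vectors have last coordinate 0, so they are dependent by themselves and
       the remaining vector gets coefficient 0. *)
    + destruct (IH v) as [c [[j0 [Hj0 Hc0]] Hc]].
      exists (fun j => if lt_dec j (S N) then c j else RtoC 0). split.
      * exists j0. split; [lia|]. destruct (lt_dec j0 (S N)); [assumption|lia].
      * intros i Hi. change (Csum (S (S N)) ?F) with (Csum (S N) F + F (S N))%C. cbv beta.
        destruct (lt_dec (S N) (S N)); [lia|].
        rewrite (Csum_ext (S N) _ (fun j => c j * v j i)%C).
        2:{ intros j Hj. destruct (lt_dec j (S N)); [reflexivity|lia]. }
        destruct (Nat.eq_dec i N) as [->|Hne].
        -- rewrite Csum_0; [ring|]. intros j Hj.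
           assert (v j N = RtoC 0) as ->; [|ring].
           apply NNPP. intros H. apply Hno. exists j. auto.
        -- rewrite Hc by lia. ring.
Qed.

(** The columns of [M] together with [g] are dependent. Injectivity keeps the coefficient of [g]
    from vanishing, and division by it solves the system. *)
Lemma injective_surjective (N : nat) (M : nat -> nat -> CC) :
  (forall d, (forall i, (i < N)%nat -> Csum N (fun j => d j * M i j)%C = RtoC 0) ->
     forall j, (j < N)%nat -> d j = RtoC 0) ->
  forall g, exists d, forall i, (i < N)%nat -> Csum N (fun j => d j * M i j)%C = g i.
Proof.
  intros Hinj g.
  destruct (linear_dependence N (fun j i => if Nat.eq_dec j N then g i else M i j))
    as [c [[j0 [Hj0 Hc0]] Hc]].
  assert (Hc' : forall i, (i < N)%nat ->
    (Csum N (fun j => c j * M i j) + c N * g i)%C = RtoC 0).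
  { intros i Hi. rewrite <- (Hc i Hi). change (Csum (S N) ?F) with (Csum N F + F N)%C. cbv beta.
    destruct (Nat.eq_dec N N); [|lia]. f_equal. apply Csum_ext. intros j Hj.
    destruct (Nat.eq_dec j N); [lia|reflexivity]. }
  assert (HcN : c N <> RtoC 0).
  { intros H0. apply Hc0. destruct (Nat.eq_dec j0 N) as [->|Hne]; [assumption|].
    apply Hinj; [|lia]. intros i Hi. rewrite <- (Hc' i Hi), H0. ring. }
  exists (fun j => - / c N * c j)%C. intros i Hi.
  rewrite (Csum_ext N _ (fun j => (- / c N) * (c j * M i j))%C) by (intros; ring).
  rewrite Csum_scal.
  replace (Csum N (fun j => c j * M i j)%C) with
    ((Csum N (fun j => c j * M i j) + c N * g i) - c N * g i)%C by ring.
  rewrite Hc' by assumption. field. assumption.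
Qed.

Lemma bound_all (n : nat) (P : nat -> R -> Prop) :
  (forall i K L, K <= L -> P i K -> P i L) ->
  (forall i, (i < n)%nat -> exists K, 0 <= K /\ P i K) ->
  exists K, 0 <= K /\ forall i, (i < n)%nat -> P i K.
Proof.
  intros Hm. induction n as [|n IH]; intros H.
  - exists 0. split; [lra|]. intros; lia.
  - destruct IH as [K [HK HK']]; [auto|]. destruct (H n ltac:(lia)) as [L [HL HL']].
    exists (K + L). split; [lra|]. intros i Hi. destruct (Nat.eq_dec i n) as [->|Hne].
    + apply (Hm n L); [lra|assumption].
    + apply (Hm i K); [lra|]. apply HK'. lia.
Qed.

(** The absorption argument: every bound [D] improves to [c + D / 2], whose fixed point is [2 * c].
    The sum of all terms serves as the initial bound. *)
Lemma halving_bound (N : nat) (x : nat -> R) (c : R) : 0 <= c -> (forall l, (l < N)%nat -> 0 <= x l) ->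
  (forall D, 0 <= D -> (forall l, (l < N)%nat -> x l <= D) -> forall l, (l < N)%nat -> x l <= c + D / 2) ->
  forall l, (l < N)%nat -> x l <= 2 * c.
Proof.
  intros Hc Hx H l Hl. set (D := fsum N x).
  assert (HD : 0 <= D) by (apply fsum_nonneg; assumption).
  assert (Hk : forall k l, (l < N)%nat -> x l <= 2 * c + D * (/2) ^ k).
  { induction k as [|k IH]; intros j Hj.
    - pose proof (fsum_ge_term N x j Hx Hj) as H1. fold D in H1. simpl. lra.
    - replace (2 * c + D * (/2) ^ S k) with (c + (2 * c + D * (/2) ^ k) / 2) by (simpl; field).
      apply H; auto. assert (0 <= D * (/2) ^ k) by (apply Rmult_le_pos; [assumption|apply pow_le; lra]).
      lra. }
  apply le_all_eps. intros e He. destruct (pow_half_small D e HD He) as [k Hk'].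
  specialize (Hk k l Hl). lra.
Qed.

Definition matvec (N : nat) (M : nat -> nat -> CC) (d : nat -> CC) (i : nat) : CC :=
  Csum N (fun j => d j * M i j)%C.

(** [u l] is the [l]-th column of the inverse matrix. The expansion of [d] in these columns with
    coefficients [matvec N M d l] holds because the difference lies in the kernel. *)
Lemma injective_bounded_below (N : nat) (M : nat -> nat -> CC) :
  (forall d, (forall i, (i < N)%nat -> matvec N M d i = RtoC 0) ->
     forall j, (j < N)%nat -> d j = RtoC 0) ->
  exists K, 0 <= K /\ forall d g, 0 <= g -> (forall i, (i < N)%nat -> Cmod (matvec N M d i) <= g) ->
    forall j, (j < N)%nat -> Cmod (d j) <= K * g.
Proof.
  intros Hinj.
  destruct (choice_fun nat (nat -> CC) (fun l u => forall i, (i < N)%nat ->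
    matvec N M u i = if Nat.eq_dec i l then RtoC 1 else RtoC 0)) as [u Hu].
  { intros l. apply (injective_surjective N M Hinj (fun i => if Nat.eq_dec i l then RtoC 1 else RtoC 0)). }
  destruct (bound_all N (fun l K => forall j, (j < N)%nat -> Cmod (u l j) <= K)) as [K [HK HuK]].
  - intros l K L HKL H j Hj. specialize (H j Hj). lra.
  - intros l _. apply (bound_all N (fun j K => Cmod (u l j) <= K)).
    + intros; lra.
    + intros j _. exists (Cmod (u l j)). split; [apply Cmod_ge_0|lra].
  - exists (INR N * K). split; [apply Rmult_le_pos; auto using pos_INR|].
    intros d g Hg Hd j Hj.
    assert (E : d j = Csum N (fun l => matvec N M d l * u l j)%C).
    { apply Cminus_eq_0.
      apply (Hinj (fun j => d j - Csum N (fun l => matvec N M d l * u l j))%C); [|assumption].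
      intros i Hi. unfold matvec at 1.
      rewrite (Csum_ext N _ (fun k => d k * M i k
        - Csum N (fun l => matvec N M d l * (u l k * M i k)))%C).
      2:{ intros k _. rewrite (Csum_ext N (fun l => matvec N M d l * (u l k * M i k))%C
              (fun l => M i k * (matvec N M d l * u l k))%C)
            by (intros; ring). rewrite Csum_scal. ring. }
      rewrite Csum_minus, Csum_exchange. fold (matvec N M d i).
      rewrite (Csum_ext N _ (fun l => matvec N M d l * (if Nat.eq_dec i l then RtoC 1 else RtoC 0))%C).
      2:{ intros l Hl. rewrite Csum_scal. f_equal. apply Hu. assumption. }
      rewrite (Csum_single N i);
        [|assumption|intros l _ Hl; destruct (Nat.eq_dec i l); [congruence|ring]].
      destruct (Nat.eq_dec i i); [ring|lia]. }
    rewrite E. replace (INR N * K * g) with (INR N * (g * K)) by ring.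
    apply Csum_le. intros l Hl. rewrite Cmod_mult.
    apply Rmult_le_compat; auto using Cmod_ge_0.
Qed.

(** If [d] is bounded by [D], replacing [M'] by [M] costs [INR N * (D * tau)], and the smallness of
    [tau] turns this into [D / 2], which is absorbed. *)
Lemma bounded_below_perturb (N : nat) (M M' : nat -> nat -> CC) (K tau : R) : 0 <= K ->
  K * (INR N * tau) <= / 2 ->
  (forall d g, 0 <= g -> (forall i, (i < N)%nat -> Cmod (matvec N M d i) <= g) ->
    forall j, (j < N)%nat -> Cmod (d j) <= K * g) ->
  (forall i j, (i < N)%nat -> (j < N)%nat -> Cmod (M' i j - M i j)%C <= tau) ->
  forall d g, 0 <= g -> (forall i, (i < N)%nat -> Cmod (matvec N M' d i) <= g) ->
    forall j, (j < N)%nat -> Cmod (d j) <= 2 * K * g.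
Proof.
  intros HK Htau HM HMM d g Hg Hd j Hj. rewrite Rmult_assoc.
  apply (halving_bound N (fun j => Cmod (d j)) (K * g)); [nra|intros; apply Cmod_ge_0| |assumption].
  intros D HD HdD l Hl.
  assert (Ht : 0 <= tau).
  { eapply Rle_trans; [apply Cmod_ge_0|apply (HMM l l Hl Hl)]. }
  assert (HNt : 0 <= INR N * tau) by (apply Rmult_le_pos; auto using pos_INR).
  apply Rle_trans with (K * (g + INR N * (D * tau))).
  2:{ assert (K * (INR N * tau) * D <= / 2 * D) by (apply Rmult_le_compat_r; assumption). lra. }
  apply (HM d); [assert (0 <= INR N * tau * D) by (apply Rmult_le_pos; assumption); lra| |assumption].
  intros i Hi.
  replace (matvec N M d i) with (matvec N M' d i - matvec N (fun i j => M' i j - M i j)%C d i)%C.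
  - eapply Rle_trans; [apply Cmod_minus_le|]. apply Rplus_le_compat; [auto|].
    apply Csum_le. intros k Hk. rewrite Cmod_mult. apply Rmult_le_compat; auto using Cmod_ge_0.
  - unfold matvec. rewrite <- Csum_minus. apply Csum_ext. intros; ring.
Qed.

(** * Properties valid for all sufficiently small positive parameters *)

Definition ev (P : R -> Prop) : Prop := exists delta, 0 < delta /\ forall eps, 0 < eps < delta -> P eps.

Lemma ev_and (P Q : R -> Prop) : ev P -> ev Q -> ev (fun e => P e /\ Q e).
Proof.
  intros [d1 [H1 H1']] [d2 [H2 H2']]. exists (Rmin d1 d2). split; [apply Rmin_pos; assumption|].
  intros e He. pose proof (Rmin_l d1 d2). pose proof (Rmin_r d1 d2).
  split; [apply H1'|apply H2']; lra.
Qed.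

Lemma ev_imp (P Q : R -> Prop) : (forall e, P e -> Q e) -> ev P -> ev Q.
Proof. intros H [d [Hd Hd']]. exists d. auto. Qed.

Lemma ev_lt (e0 : R) : 0 < e0 -> ev (fun e => 0 < e < e0).
Proof. intros H. exists e0. auto. Qed.

Lemma ev_all (n : nat) (P : nat -> R -> Prop) :
  (forall i, (i < n)%nat -> ev (P i)) -> ev (fun e => forall i, (i < n)%nat -> P i e).
Proof.
  induction n as [|n IH]; intros H.
  - exists 1. split; [lra|]. intros; lia.
  - apply (ev_imp (fun e => (forall i, (i < n)%nat -> P i e) /\ P n e)).
    + intros e [H1 H2] i Hi. destruct (Nat.eq_dec i n) as [->|Hne]; [assumption|]. apply H1. lia.
    + apply ev_and; auto.
Qed.

Lemma cnorm_to0 (N : nat) (c : R -> nat -> CC) :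
  to0 (fun eps => cnorm N (c eps)) <->
  forall e, 0 < e -> ev (fun eps => forall i, (i < N)%nat -> Cmod (c eps i) <= e).
Proof.
  split; intros H e He.
  - destruct (H e He) as [d [Hd Hd']]. exists d. split; [assumption|]. intros eps Heps i Hi.
    specialize (Hd' eps Heps).
    pose proof (fsum_ge_term N (fun i => Cmod (c eps i)) i (fun _ _ => Cmod_ge_0 _) Hi) as H1.
    unfold cnorm in Hd'. simpl in H1. lra.
  - assert (Hp : 0 < e / (INR N + 1)) by (apply Rdiv_lt_0_compat; [|pose proof (pos_INR N)]; lra).
    destruct (H _ Hp) as [d [Hd Hd']]. exists d. split; [assumption|]. intros eps Heps.
    eapply Rle_lt_trans; [apply fsum_le; apply (Hd' eps Heps)|].
    pose proof (pos_INR N).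
    apply Rlt_le_trans with ((INR N + 1) * (e / (INR N + 1))); [nra|]. right. field. lra.
Qed.

(** * Vector-valued functions *)

Section Vectors.
Context (a b alpha : R) (Hab : a < b) (Hal : 0 < alpha <= 1) (m : nat).
Notation hle := (hle a b alpha).

Definition vle (N : nat) (y : nat -> R -> CC) (K : R) : Prop :=
  forall i, (i < m)%nat -> hle N (y i) K.

Lemma vle_mono (N : nat) (y : nat -> R -> CC) (K L : R) : K <= L -> vle N y K -> vle N y L.
Proof. intros HKL H i Hi. apply (hle_mono a b alpha N _ K L HKL). auto. Qed.

Lemma vle_ext (N : nat) (y z : nat -> R -> CC) (K : R) :
  (forall i t, (i < m)%nat -> a <= t <= b -> y i t = z i t) -> vle N y K -> vle N z K.
Proof. intros E H i Hi. apply (hle_ext a b alpha N (y i)); auto. Qed.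

Lemma vle_InCv (N : nat) (y : nat -> R -> CC) (K : R) : vle N y K -> InCv a b N alpha m y.
Proof. intros H i Hi. apply (hle_InC a b alpha Hab Hal N _ K). auto. Qed.

Lemma InCv_vle (N : nat) (y : nat -> R -> CC) : InCv a b N alpha m y ->
  exists K, 0 <= K /\ vle N y K.
Proof.
  intros H. apply (bound_all m (fun i K => hle N (y i) K)).
  - intros i K L. apply hle_mono.
  - intros i Hi. apply (InC_hle a b alpha Hab Hal). auto.
Qed.

Lemma vle_plus (N : nat) (y z : nat -> R -> CC) (K L : R) : vle N y K -> vle N z L ->
  vle N (fun j t => y j t + z j t)%C (K + L).
Proof. intros H1 H2 i Hi. apply hle_plus; auto. Qed.

Lemma vle_scal (N : nat) (c : CC) (y : nat -> R -> CC) (K : R) : vle N y K ->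
  vle N (fun j t => c * y j t)%C (Cmod c * K).
Proof. intros H1 i Hi. apply hle_scal; auto. Qed.

Lemma vle_minus (N : nat) (y z : nat -> R -> CC) (K L : R) : vle N y K -> vle N z L ->
  vle N (vsub y z) (K + L).
Proof. intros H1 H2 i Hi. apply hle_minus; auto. Qed.

Lemma vle_vsub_sym (N : nat) (y z : nat -> R -> CC) (K : R) : vle N (vsub y z) K -> vle N (vsub z y) K.
Proof.
  intros H. apply (vle_ext N (fun j t => - RtoC 1 * vsub y z j t)%C).
  - intros i t _ _. unfold vsub. ring.
  - replace K with (Cmod (- RtoC 1)%C * K) by (rewrite Cmod_opp, Cmod_1; ring).
    apply vle_scal. assumption.
Qed.

Lemma vle_vsub_triangle (N : nat) (x y z : nat -> R -> CC) (K L : R) :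
  vle N (vsub x y) K -> vle N (vsub y z) L -> vle N (vsub x z) (K + L).
Proof.
  intros H1 H2. apply (vle_ext N (fun j t => vsub x y j t + vsub y z j t)%C).
  - intros i t _ _. unfold vsub. ring.
  - apply vle_plus; assumption.
Qed.

Lemma vle_zero (N : nat) (K : R) : 0 <= K -> vle N (fun _ _ => RtoC 0) K.
Proof. intros HK i Hi. apply hle_zero. assumption. Qed.

Lemma vle_0_eq (N : nat) (y : nat -> R -> CC) : vle N y 0 ->
  forall i t, (i < m)%nat -> a <= t <= b -> y i t = RtoC 0.
Proof. intros H i t Hi Ht. apply Cmod_le_0. apply (hle_bound a b alpha N _ _ (H i Hi) t Ht). Qed.

Lemma vle_0 (N : nat) (y : nat -> R -> CC) :
  (forall i t, (i < m)%nat -> a <= t <= b -> y i t = RtoC 0) -> vle N y 0.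
Proof.
  intros H. apply (vle_ext N (fun _ _ => RtoC 0)); [|apply vle_zero; lra].
  intros; symmetry; auto.
Qed.

Definition vlin (M : nat) (d : nat -> CC) (Y : nat -> nat -> R -> CC) : nat -> R -> CC :=
  fun j t => Csum M (fun l => d l * Y l j t)%C.

Lemma vnorm_le (N : nat) (y : nat -> R -> CC) (K : R) : vle N y K ->
  vnorm a b N alpha m y <= INR m * ((INR N + 2) * K).
Proof. intros H. apply fsum_le. intros i Hi. apply (hnorm_le a b alpha Hab Hal). auto. Qed.

Lemma hnorm_nonneg (N : nat) (g : R -> CC) : InC a b N alpha g -> 0 <= hnorm a b N alpha g.
Proof.
  intros H. destruct (InC_hle a b alpha Hab Hal N g H) as [K [_ HK]].
  apply (hle_nonneg a b alpha Hab N g). apply (hle_hnorm a b alpha Hab Hal N g K HK).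
Qed.

Lemma vle_vnorm (N : nat) (y : nat -> R -> CC) : InCv a b N alpha m y ->
  vle N y (vnorm a b N alpha m y).
Proof.
  intros H i Hi. destruct (InC_hle a b alpha Hab Hal N (y i) (H i Hi)) as [K [_ HK]].
  apply (hle_mono a b alpha N) with (hnorm a b N alpha (y i)).
  - apply (fsum_ge_term m (fun i => hnorm a b N alpha (y i))); [|assumption].
    intros j Hj. apply hnorm_nonneg. auto.
  - apply (hle_hnorm a b alpha Hab Hal N (y i) K HK).
Qed.

(** Membership in the space is required because a small value of [vnorm] says nothing about a
    function outside it. *)
Lemma vnorm_to0 (N : nat) (z : R -> nat -> R -> CC) :
  ev (fun eps => InCv a b N alpha m (z eps)) ->
  (to0 (fun eps => vnorm a b N alpha m (z eps)) <->
   forall e, 0 < e -> ev (fun eps => vle N (z eps) e)).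
Proof.
  intros Hz. split; intros H e He.
  - apply (ev_imp (fun eps => InCv a b N alpha m (z eps) /\ vnorm a b N alpha m (z eps) < e)).
    + intros eps [H1 H2]. apply (vle_mono N _ (vnorm a b N alpha m (z eps))); [lra|].
      apply vle_vnorm. assumption.
    + apply ev_and; [assumption|]. apply (H e He).
  - set (c := INR m * (INR N + 2) + 1).
    assert (Hc : 1 <= c).
    { unfold c. pose proof (pos_INR m). pose proof (pos_INR N). nra. }
    assert (Hp : 0 < e / c) by (apply Rdiv_lt_0_compat; lra).
    apply (ev_imp (fun eps => vle N (z eps) (e / c))); [|apply H; assumption].
    intros eps H1. eapply Rle_lt_trans; [apply vnorm_le; exact H1|].
    replace (INR m * ((INR N + 2) * (e / c))) with ((c - 1) * (e / c)) by (unfold c; ring).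
    apply Rlt_le_trans with (c * (e / c)); [lra|]. right. field. lra.
Qed.

Lemma vle_complete (N : nat) (x : nat -> nat -> R -> CC) (rho : nat -> R) :
  (forall k, InCv a b N alpha m (x k)) ->
  (forall k j, (k <= j)%nat -> vle N (vsub (x j) (x k)) (rho k)) ->
  (forall d, 0 < d -> exists k, rho k < d) ->
  exists y, forall k, vle N (vsub y (x k)) (rho k).
Proof.
  intros Hx Hc Hr.
  destruct (choice_fun nat (R -> CC) (fun i y => (i < m)%nat ->
    forall k, hle N (fun t => y t - x k i t)%C (rho k))) as [y Hy].
  - intros i. destruct (lt_dec i m) as [Hi|Hi].
    + destruct (hle_complete a b alpha Hab Hal N (fun k => x k i) rho) as [y Hy].
      * intros k. destruct (InCv_vle N (x k) (Hx k)) as [K [_ HK]]. exists K. auto.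
      * intros k j Hkj. apply (Hc k j Hkj i Hi).
      * assumption.
      * exists y. auto.
    + exists (fun _ => RtoC 0). intros; lia.
  - exists y. intros k i Hi. apply Hy; assumption.
Qed.

End Vectors.

(** * Boundary operators and the boundary-value problem *)

Section Operators.
Context (a b alpha : R) (Hab : a < b) (Hal : 0 < alpha <= 1) (n m r : nat).
Notation hle := (hle a b alpha).
Notation vX := (vle a b alpha m (n + r)).
Notation vY := (vle a b alpha m n).
Notation InX := (InCv a b (n + r) alpha m).
Notation CLO := (ContLinOp a b m r n alpha).

Lemma CLO_bound (T : (nat -> R -> CC) -> nat -> CC) : CLO T ->
  exists K, 0 <= K /\ forall y rho, vX y rho ->
    forall i, (i < r * m)%nat -> Cmod (T y i) <= K * rho.
Proof.
  intros [_ [_ [K HK]]].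
  set (c := INR m * (INR (n + r) + 2)).
  assert (Hc : 0 <= c).
  { unfold c. pose proof (pos_INR m). pose proof (pos_INR (n + r)). nra. }
  exists (Rabs K * c). split; [apply Rmult_le_pos; [apply Rabs_pos|assumption]|].
  intros y rho Hy i Hi. pose proof (vle_InCv a b alpha Hab Hal m _ _ _ Hy) as HX.
  specialize (HK y HX).
  pose proof (fsum_ge_term (r * m) (fun i => Cmod (T y i)) i (fun _ _ => Cmod_ge_0 _) Hi) as H1.
  unfold cnorm in HK. cbv beta in H1.
  pose proof (vnorm_le a b alpha Hab Hal m _ _ _ Hy) as H2.
  assert (H0 : 0 <= vnorm a b (n + r) alpha m y).
  { apply fsum_nonneg. intros j Hj. apply (hnorm_nonneg a b alpha Hab Hal). auto. }
  pose proof (Rle_abs K). pose proof (Rabs_pos K).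
  apply Rle_trans with (Rabs K * vnorm a b (n + r) alpha m y); [nra|].
  rewrite Rmult_assoc. apply Rmult_le_compat_l; [assumption|]. unfold c. lra.
Qed.

(** Vectors here are total functions on the line with components for all indices. Boundedness forces
    [T] to ignore values off [[a, b]] and components from [m] on, since such a function satisfies
    [vle] with constant 0; extensionality of [T] follows by linearity. *)
Lemma CLO_zero (T : (nat -> R -> CC) -> nat -> CC) (y : nat -> R -> CC) : CLO T ->
  (forall i t, (i < m)%nat -> a <= t <= b -> y i t = RtoC 0) ->
  forall i, (i < r * m)%nat -> T y i = RtoC 0.
Proof.
  intros HT Hy i Hi. destruct (CLO_bound T HT) as [K [HK H]].
  apply Cmod_le_0. rewrite <- (Rmult_0_r K). apply H; [|assumption].
  apply vle_0; assumption.
Qed.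

Lemma CLO_comb (T : (nat -> R -> CC) -> nat -> CC) (c : CC) (y z : nat -> R -> CC) : CLO T ->
  InX y -> InX z -> forall i, (i < r * m)%nat ->
  T (fun j t => y j t + c * z j t)%C i = (T y i + c * T z i)%C.
Proof.
  intros [H1 [H2 _]] Hy Hz i Hi.
  rewrite (H1 y (fun j t => c * z j t)%C); [|assumption| |assumption].
  - rewrite H2 by assumption. reflexivity.
  - destruct (InCv_vle a b alpha Hab Hal m _ z Hz) as [K [_ HK]].
    apply (vle_InCv a b alpha Hab Hal m _ _ (Cmod c * K)). apply vle_scal. assumption.
Qed.

Lemma CLO_ext (T : (nat -> R -> CC) -> nat -> CC) (y z : nat -> R -> CC) : CLO T ->
  InX y -> (forall i t, (i < m)%nat -> a <= t <= b -> y i t = z i t) ->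
  forall i, (i < r * m)%nat -> T y i = T z i.
Proof.
  intros HT Hy E i Hi.
  assert (Hz : InX z).
  { destruct (InCv_vle a b alpha Hab Hal m _ y Hy) as [K [_ HK]].
    apply (vle_InCv a b alpha Hab Hal m _ _ K). apply (vle_ext a b alpha m _ y); assumption. }
  apply Cminus_eq_0. replace (T y i - T z i)%C with (T y i + (- RtoC 1) * T z i)%C by ring.
  rewrite <- (CLO_comb T (- RtoC 1)%C y z HT Hy Hz i Hi).
  apply CLO_zero; try assumption. intros j t Hj Ht. rewrite E by assumption. ring.
Qed.

Lemma InX_comb (c : CC) (y z : nat -> R -> CC) : InX y -> InX z ->
  InX (fun j t => y j t + c * z j t)%C.
Proof.
  intros Hy Hz. destruct (InCv_vle a b alpha Hab Hal m _ y Hy) as [K [_ HK]].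
  destruct (InCv_vle a b alpha Hab Hal m _ z Hz) as [L [_ HL]].
  apply (vle_InCv a b alpha Hab Hal m _ _ (K + Cmod c * L)).
  apply vle_plus; [assumption|]. apply vle_scal. assumption.
Qed.

Lemma InX_vsub (y z : nat -> R -> CC) : InX y -> InX z -> InX (vsub y z).
Proof.
  intros Hy Hz. destruct (InCv_vle a b alpha Hab Hal m _ y Hy) as [K [_ HK]].
  destruct (InCv_vle a b alpha Hab Hal m _ z Hz) as [L [_ HL]].
  apply (vle_InCv a b alpha Hab Hal m _ _ (K + L)). apply vle_minus; assumption.
Qed.

Lemma CLO_vsub (T : (nat -> R -> CC) -> nat -> CC) (y z : nat -> R -> CC) : CLO T ->
  InX y -> InX z -> forall i, (i < r * m)%nat -> T (vsub y z) i = (T y i - T z i)%C.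
Proof.
  intros HT Hy Hz i Hi.
  rewrite (CLO_ext T (vsub y z) (fun j t => y j t + (- RtoC 1) * z j t)%C HT); auto.
  - rewrite CLO_comb by assumption. ring.
  - apply InX_vsub; assumption.
  - intros. unfold vsub. ring.
Qed.

Lemma InX_vlin (M : nat) (d : nat -> CC) (Y : nat -> nat -> R -> CC) :
  (forall l, (l < M)%nat -> InX (Y l)) -> InX (vlin M d Y).
Proof.
  intros HY. induction M as [|M IH].
  - apply (vle_InCv a b alpha Hab Hal m _ _ 0). apply vle_zero. lra.
  - apply (InX_comb (d M) (vlin M d Y) (Y M)); auto.
Qed.

Lemma CLO_vlin (T : (nat -> R -> CC) -> nat -> CC) (M : nat) (d : nat -> CC)
  (Y : nat -> nat -> R -> CC) : CLO T -> (forall l, (l < M)%nat -> InX (Y l)) ->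
  forall i, (i < r * m)%nat -> T (vlin M d Y) i = Csum M (fun l => d l * T (Y l) i)%C.
Proof.
  intros HT HY i Hi. induction M as [|M IH].
  - simpl. apply CLO_zero; auto.
  - simpl. rewrite <- IH by auto.
    apply (CLO_comb T (d M) (vlin M d Y) (Y M)); auto. apply InX_vlin. auto.
Qed.

(* Gliding hump: if boundedness fails, one of x + z, x - z has a large image whenever z does,
   so nested balls can be chosen on which T eps gets arbitrarily large along eps -> 0+. *)
Lemma uniform_boundedness (T : R -> (nat -> R -> CC) -> nat -> CC) (eps0 : R) : 0 < eps0 ->
  (forall eps, 0 <= eps < eps0 -> CLO (T eps)) ->
  (forall y, InX y -> exists K, ev (fun eps => forall i, (i < r * m)%nat -> Cmod (T eps y i) <= K)) ->
  exists K, 0 <= K /\ ev (fun eps => forall y rho, vX y rho ->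
    forall i, (i < r * m)%nat -> Cmod (T eps y i) <= K * rho).
Proof.
  intros He0 HT Hpt. apply NNPP. intros Hno.
  assert (Hbad : forall K d, 0 <= K -> 0 < d -> exists eps z sg i, 0 < eps < d /\ eps < eps0 /\
    0 < sg /\ vX z sg /\ (i < r * m)%nat /\ K * sg < Cmod (T eps z i)).
  { intros K d HK Hd. apply NNPP. intros H. apply Hno. exists K. split; [assumption|].
    exists (Rmin d eps0). split; [apply Rmin_pos; assumption|].
    intros eps Heps y rho Hy i Hi. pose proof (Rmin_l d eps0). pose proof (Rmin_r d eps0).
    apply Rnot_lt_le. intros Hlt. apply H.
    assert (Hm : (0 < m)%nat) by (destruct m; [rewrite Nat.mul_0_r in Hi; lia|lia]).
    pose proof (hle_nonneg a b alpha Hab _ _ _ (Hy 0%nat Hm)) as Hrho.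
    (* A counterexample of radius 0 is ruled out by the boundedness of the single operator [T eps];
       the positive radius allows rescaling below. *)
    destruct (Req_dec rho 0) as [->|Hne].
    - destruct (CLO_bound (T eps) (HT eps ltac:(lra))) as [L [_ HL]].
      specialize (HL y 0 Hy i Hi). lra.
    - exists eps, y, rho, i. repeat split; auto; lra. }
  set (St := ((nat -> R -> CC) * R)%type).
  set (good := fun s : St => InX (fst s) /\ 0 < snd s).
  (* A state is a ball given by centre and radius. The centre moves by at most half the old radius
     and the new radius is at most the other half, so the balls are nested; on the new ball some
     [T eps] with [eps < 1 / (k + 1)] exceeds [k]. *)
  set (step := fun (k : nat) (s s' : St) => good s' /\ snd s' <= snd s / 2 /\
    vX (vsub (fst s') (fst s)) (snd s / 2) /\
    exists eps, 0 < eps < / (INR k + 1) /\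
      forall y, InX y -> vX (vsub y (fst s')) (snd s') ->
      exists i, (i < r * m)%nat /\ INR k < Cmod (T eps y i)).
  assert (Hstep : forall k s, good s -> exists s', step k s s').
  { intros k [x rho] [Hx Hrho]. simpl in Hx, Hrho. pose proof (pos_INR k) as Hk.
    assert (HK : 0 <= 2 * (INR k + 1) / rho) by (apply Rdiv_le_0_compat; lra).
    destruct (Hbad _ (/ (INR k + 1)) HK ltac:(apply Rinv_0_lt_compat; lra))
      as [eps [z [sg [i [H1 [H2 [H3 [H4 [H5 H6]]]]]]]]].
    pose proof (HT eps ltac:(lra)) as HTe.
    (* Rescales [z] to size [rho / 2]; the constant [2 * (INR k + 1) / rho] was chosen so that its
       image then exceeds [INR k + 1]. *)
    set (q := RtoC (rho / (2 * sg))).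
    assert (Hq0 : 0 < rho / (2 * sg)) by (apply Rdiv_lt_0_compat; lra).
    assert (Hq : Cmod q = rho / (2 * sg)) by (unfold q; rewrite Cmod_R; apply Rabs_pos_eq; lra).
    assert (HzX : InX z) by (apply (vle_InCv a b alpha Hab Hal m _ _ sg); assumption).
    assert (Hbig : INR k + 1 < Cmod (q * T eps z i)%C).
    { rewrite Cmod_mult, Hq.
      apply Rmult_lt_compat_l with (r := rho / (2 * sg)) in H6; [|assumption].
      eapply Rle_lt_trans; [|exact H6]. right. field. lra. }
    assert (Hpm : exists s : CC, Cmod s = 1 /\ INR k + 1 < Cmod (T eps x i + s * q * T eps z i)%C).
    { destruct (Rlt_dec (INR k + 1) (Cmod (T eps x i + q * T eps z i)%C)) as [Hlt|Hge].
      - exists (RtoC 1). split; [apply Cmod_1|]. rewrite Cmult_1_l. assumption.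
      - exists (- RtoC 1)%C. split; [rewrite Cmod_opp; apply Cmod_1|].
        apply Rnot_lt_le in Hge. apply Rnot_le_lt. intros Hle.
        assert (Cmod (RtoC 2 * (q * T eps z i))%C <= 2 * (INR k + 1)).
        { replace (RtoC 2 * (q * T eps z i))%C with
            ((T eps x i + q * T eps z i) - (T eps x i + - RtoC 1 * q * T eps z i))%C
            by (replace (RtoC 2) with (RtoC 1 + RtoC 1)%C by (rewrite <- RtoC_plus; f_equal; lra); ring).
          eapply Rle_trans; [apply Cmod_minus_le|]. lra. }
        rewrite Cmod_mult, Cmod_R, Rabs_pos_eq in H by lra. lra. }
    destruct Hpm as [s [Hs Hpm]].
    set (x' := fun j t => (x j t + (s * q) * z j t)%C).
    assert (Hx' : InX x') by (apply InX_comb; assumption).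
    assert (HTx' : T eps x' i = (T eps x i + s * q * T eps z i)%C) by (apply CLO_comb; assumption).
    destruct (CLO_bound _ HTe) as [K [HK0 HKb]].
    (* On a ball of radius [/ (K + 1)] the values of [T eps] vary by at most 1, so more than [INR k]
       is left of the excess over [INR k + 1]. *)
    set (rho' := Rmin (rho / 2) (/ (K + 1))).
    assert (Hr' : 0 < rho') by (apply Rmin_pos; [lra|apply Rinv_0_lt_compat; lra]).
    exists (x', rho'). split; [split; assumption|]. simpl. split; [apply Rmin_l|]. split.
    - apply (vle_ext a b alpha m _ (fun j t => (s * q) * z j t)%C).
      + intros. unfold vsub, x'. ring.
      + replace (rho / 2) with (Cmod (s * q)%C * sg).
        * apply vle_scal. assumption.
        * rewrite Cmod_mult, Hs, Hq. field. lra.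
    - exists eps. split; [assumption|]. intros y Hy Hyx. exists i. split; [assumption|].
      specialize (HKb _ _ Hyx i H5). rewrite CLO_vsub in HKb by assumption.
      pose proof (Cmod_le_minus (T eps x' i) (T eps y i)) as Htri.
      rewrite Cmod_minus_sym in Htri. rewrite HTx' in Htri at 1.
      assert (K * rho' <= 1).
      { assert (rho' <= / (K + 1)) by apply Rmin_r.
        apply Rle_trans with ((K + 1) * / (K + 1)); [|right; field; lra].
        apply Rmult_le_compat; lra. }
      lra. }
  destruct (choice_fun (nat * St) St (fun ks s' => good (snd ks) -> step (fst ks) (snd ks) s'))
    as [nxt Hnxt].
  { intros [k s]. simpl. destruct (excluded_middle_informative (good s)) as [H|H].
    - destruct (Hstep k s H) as [s' Hs']. exists s'. auto.
    - exists s. intros; contradiction. }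
  set (sq := fix sq (k : nat) : St := match k with
    | O => ((fun _ _ => RtoC 0), 1) | S k' => nxt (k', sq k') end).
  assert (Hgood : forall k, good (sq k)).
  { induction k as [|k IH].
    - split; [|simpl; lra]. apply (vle_InCv a b alpha Hab Hal m _ _ 0). apply vle_zero. lra.
    - apply (Hnxt (k, sq k) IH). }
  assert (Hsq : forall k, step k (sq k) (sq (S k))).
  { intros k. apply (Hnxt (k, sq k) (Hgood k)). }
  assert (Hgeo : forall k, snd (sq k) <= 1 * (/2) ^ k).
  { induction k as [|k IH]; [simpl; lra|]. destruct (Hsq k) as [_ [H _]]. simpl pow. lra. }
  destruct (vle_complete a b alpha Hab Hal m (n + r) (fun k => fst (sq k)) (fun k => snd (sq k)))
    as [y Hy].
  - intros k. apply Hgood.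
  - intros k j Hkj. replace j with ((j - k) + k)%nat by lia. generalize (j - k)%nat. intros l.
    (* Telescoping: each move of the centre is at most half the current radius, while the radius
       drops by at least that half. The total displacement is thus at most the total drop. *)
    apply (vle_mono a b alpha m _ _ (snd (sq k) - snd (sq (l + k)%nat))).
    { destruct (Hgood (l + k)%nat) as [_ H]. lra. }
    induction l as [|l IH].
    + apply (vle_mono a b alpha m _ _ 0); [simpl; lra|]. apply vle_0.
      intros. unfold vsub. simpl. ring.
    + destruct (Hsq (l + k)%nat) as [_ [H1 [H2 _]]].
      change (S l + k)%nat with (S (l + k)).
      apply (vle_mono a b alpha m _ _ (snd (sq (l + k)%nat) / 2 + (snd (sq k) - snd (sq (l + k)%nat)))); [lra|].
      apply (vle_vsub_triangle a b alpha m _ _ (fst (sq (l + k)%nat))); assumption.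
  - intros d Hd. destruct (pow_half_small 1 d ltac:(lra) Hd) as [k Hk]. exists k.
    specialize (Hgeo k). lra.
  - assert (HyX : InX y).
    { destruct (InCv_vle a b alpha Hab Hal m _ _ (proj1 (Hgood 0%nat))) as [K [_ HK]].
      apply (vle_InCv a b alpha Hab Hal m _ _ (snd (sq 0%nat) + K)).
      apply (vle_ext a b alpha m _ (fun j t => vsub y (fst (sq 0%nat)) j t + fst (sq 0%nat) j t)%C).
      - intros. unfold vsub. ring.
      - apply vle_plus; [apply (Hy 0%nat)|assumption]. }
    destruct (Hpt y HyX) as [K [d [Hd Hd']]].
    destruct (INR_unbounded (Rmax K (/ d))) as [k Hk].
    pose proof (Rmax_l K (/ d)). pose proof (Rmax_r K (/ d)).
    assert (Hid : 0 < / d) by (apply Rinv_0_lt_compat; assumption).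
    destruct (Hsq k) as [_ [_ [_ [eps [He1 He2]]]]].
    destruct (He2 y HyX (Hy (S k))) as [i [Hi Hbig]].
    assert (eps < d).
    { apply Rlt_le_trans with (/ (INR k + 1)); [lra|].
      rewrite <- (Rinv_inv d). apply Rinv_le_contravar; lra. }
    specialize (Hd' eps ltac:(lra) i Hi). lra.
Qed.

(* [Lop] with the coefficient family at a fixed parameter value. *)
Definition LL (A : nat -> nat -> nat -> R -> CC) (y : nat -> R -> CC) (i : nat) (t : R) : CC :=
  (dW a b (n + r) (y i) r t + opC m r A (fun k p => dW a b (n + r) (y k) p) i t)%C.

Definition coef_le (KA : R) (A : nat -> nat -> nat -> R -> CC) : Prop :=
  forall p i k, (p < r)%nat -> (i < m)%nat -> (k < m)%nat -> hle n (A p i k) KA.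

Lemma InX_hle (y : nat -> R -> CC) : InX y -> forall i, (i < m)%nat -> exists K, hle (n + r) (y i) K.
Proof.
  intros Hy i Hi. destruct (InC_hle a b alpha Hab Hal _ _ (Hy i Hi)) as [K [_ HK]].
  exists K. assumption.
Qed.

Lemma dW_comb (c : CC) (y z : nat -> R -> CC) : InX y -> InX z ->
  forall i j t, (i < m)%nat -> (j <= n + r)%nat -> a <= t <= b ->
  dW a b (n + r) (fun s => y i s + c * z i s)%C j t =
    (dW a b (n + r) (y i) j t + c * dW a b (n + r) (z i) j t)%C.
Proof.
  intros Hy Hz i j t Hi Hj Ht. destruct (InX_hle y Hy i Hi) as [K HK]. destruct (InX_hle z Hz i Hi) as [L HL].
  rewrite (dW_plus a b alpha Hab Hal (n + r) (y i) (fun s => c * z i s)%C K (Cmod c * L)); auto.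
  - rewrite (dW_scal a b alpha Hab Hal (n + r) c (z i) L); auto.
  - apply hle_scal. assumption.
Qed.

Lemma LL_comb (A : nat -> nat -> nat -> R -> CC) (c : CC) (y z : nat -> R -> CC) : InX y -> InX z ->
  forall i t, (i < m)%nat -> a <= t <= b ->
  LL A (fun j t => y j t + c * z j t)%C i t = (LL A y i t + c * LL A z i t)%C.
Proof.
  intros Hy Hz i t Hi Ht. unfold LL. rewrite dW_comb by (assumption || lia).
  assert (E : opC m r A (fun k p => dW a b (n + r) (fun t => y k t + c * z k t)%C p) i t =
    (opC m r A (fun k p => dW a b (n + r) (y k) p) i t
     + c * opC m r A (fun k p => dW a b (n + r) (z k) p) i t)%C).
  { unfold opC. rewrite <- Csum_scal, <- Csum_plus. apply Csum_ext. intros p Hp.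
    rewrite <- Csum_scal, <- Csum_plus. apply Csum_ext. intros k Hk.
    rewrite dW_comb by (assumption || lia). ring. }
  rewrite E. ring.
Qed.

Lemma LL_ext (A : nat -> nat -> nat -> R -> CC) (y z : nat -> R -> CC) : InX y ->
  (forall i t, (i < m)%nat -> a <= t <= b -> y i t = z i t) ->
  forall i t, (i < m)%nat -> a <= t <= b -> LL A y i t = LL A z i t.
Proof.
  intros Hy E i t Hi Ht. unfold LL.
  assert (Ed : forall k j, (k < m)%nat -> (j <= n + r)%nat ->
    dW a b (n + r) (y k) j t = dW a b (n + r) (z k) j t).
  { intros k j Hk Hj. destruct (InX_hle y Hy k Hk) as [K HK].
    apply (dW_ext a b alpha Hab Hal (n + r) (y k) (z k) K); auto. }
  rewrite Ed by (assumption || lia). f_equal. apply opC_ext; [reflexivity|].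
  intros p k Hp Hk. apply Ed; [assumption|lia].
Qed.

Lemma LL_vsub (A : nat -> nat -> nat -> R -> CC) (y z : nat -> R -> CC) : InX y -> InX z ->
  forall i t, (i < m)%nat -> a <= t <= b ->
  LL A (vsub y z) i t = (LL A y i t - LL A z i t)%C.
Proof.
  intros Hy Hz i t Hi Ht.
  rewrite (LL_ext A (vsub y z) (fun j t => y j t + (- RtoC 1) * z j t)%C); auto.
  - rewrite LL_comb by assumption. ring.
  - apply InX_vsub; assumption.
  - intros. unfold vsub. ring.
Qed.

Lemma LL_zero (A : nat -> nat -> nat -> R -> CC) (y : nat -> R -> CC) :
  (forall i t, (i < m)%nat -> a <= t <= b -> y i t = RtoC 0) ->
  forall i t, (i < m)%nat -> a <= t <= b -> LL A y i t = RtoC 0.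
Proof.
  intros Hy i t Hi Ht.
  assert (HyX : InX y) by (apply (vle_InCv a b alpha Hab Hal m _ _ 0), vle_0; assumption).
  rewrite (LL_ext A y (vsub y y)); auto.
  - rewrite LL_vsub by assumption. ring.
  - intros j s Hj Hs. unfold vsub. rewrite Hy by assumption. ring.
Qed.

Lemma LL_vlin (A : nat -> nat -> nat -> R -> CC) (M : nat) (d : nat -> CC)
  (Y : nat -> nat -> R -> CC) : (forall l, (l < M)%nat -> InX (Y l)) ->
  forall i t, (i < m)%nat -> a <= t <= b ->
  LL A (vlin M d Y) i t = Csum M (fun l => d l * LL A (Y l) i t)%C.
Proof.
  intros HY i t Hi Ht. induction M as [|M IH].
  - simpl. apply LL_zero; auto.
  - simpl. rewrite <- IH by auto.
    apply (LL_comb A (d M) (vlin M d Y) (Y M)); auto. apply InX_vlin. auto.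
Qed.

(** The norm of the bilinear map that sends coefficients and [y] to the lower-order part of the
    equation, from orders [n] and [n + r] to order [n]: the number of terms, the product constant,
    and the cost of lowering the derivatives of [y]. *)
Definition opc : R := INR r * (INR m * (mulc a b alpha n * kap a b alpha ^ (n + r))).

Lemma opc_nonneg : 0 <= opc.
Proof.
  pose proof (kap_pow_ge_1 a b alpha (n + r)). pose proof (mulc_ge_1 a b alpha n).
  unfold opc. repeat apply Rmult_le_pos; auto using pos_INR; lra.
Qed.

Lemma opC_dW_hle (C : nat -> nat -> nat -> R -> CC) (y : nat -> R -> CC) (sg rho : R) :
  coef_le sg C -> vX y rho ->
  vY (opC m r C (fun k p => dW a b (n + r) (y k) p)) (opc * (sg * rho)).
Proof.
  intros HC Hy i Hi.
  replace (opc * (sg * rho)) with (INR r * (INR m * (mulc a b alpha n * (sg * (kap a b alpha ^ (n + r) * rho)))))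
    by (unfold opc; ring).
  apply (hle_opC a b alpha Hab Hal).
  - intros p k Hp Hk. apply HC; assumption.
  - intros p k Hp Hk. apply (hle_dW_le a b alpha Hab Hal); [lia|]. apply Hy. assumption.
Qed.

Lemma LL_hle (A : nat -> nat -> nat -> R -> CC) (KA : R) (y : nat -> R -> CC) (rho : R) :
  coef_le KA A -> vX y rho ->
  vY (LL A y) (kap a b alpha ^ (n + r) * rho + opc * (KA * rho)).
Proof.
  intros HA Hy i Hi. apply hle_plus.
  - apply (hle_dW_le a b alpha Hab Hal); [lia|]. apply Hy. assumption.
  - apply opC_dW_hle; assumption.
Qed.

Lemma LL_InCv (A : nat -> nat -> nat -> R -> CC) (KA : R) (y : nat -> R -> CC) :
  coef_le KA A -> InX y -> InCv a b n alpha m (LL A y).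
Proof.
  intros HA Hy. destruct (InCv_vle a b alpha Hab Hal m _ y Hy) as [K [_ HK]].
  eapply (vle_InCv a b alpha Hab Hal). apply (LL_hle A KA y K); assumption.
Qed.

Lemma LL_minus_A (A A' : nat -> nat -> nat -> R -> CC) (y : nat -> R -> CC) (i : nat) (t : R) :
  (LL A y i t - LL A' y i t)%C =
  opC m r (fun p i k t => A p i k t - A' p i k t)%C (fun k p => dW a b (n + r) (y k) p) i t.
Proof. rewrite opC_minus_A. unfold LL. ring. Qed.

(* Cauchy data of [y] at [a]; the entry (p, k), i.e. y_k^(p) (a), has index [p * m + k]. *)
Definition cauchy (y : nat -> R -> CC) (l : nat) : CC :=
  dW a b (n + r) (y (l mod m)) (l / m) a.

Lemma cauchy_index (l : nat) : (l < r * m)%nat -> (l mod m < m)%nat /\ (l / m < r)%nat.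
Proof.
  intros Hl. assert (m <> 0)%nat by (intros ->; lia). split.
  - apply Nat.mod_upper_bound. assumption.
  - apply Nat.Div0.div_lt_upper_bound. lia.
Qed.

Lemma cauchy_comb (c : CC) (y z : nat -> R -> CC) : InX y -> InX z ->
  forall l, (l < r * m)%nat ->
  cauchy (fun j t => y j t + c * z j t)%C l = (cauchy y l + c * cauchy z l)%C.
Proof.
  intros Hy Hz l Hl. destruct (cauchy_index l Hl). unfold cauchy.
  apply dW_comb; try assumption; [lia|lra].
Qed.

Lemma cauchy_ext (y z : nat -> R -> CC) : InX y ->
  (forall i t, (i < m)%nat -> a <= t <= b -> y i t = z i t) ->
  forall l, (l < r * m)%nat -> cauchy y l = cauchy z l.
Proof.
  intros Hy E l Hl. destruct (cauchy_index l Hl) as [H1 H2]. unfold cauchy.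
  destruct (InX_hle y Hy _ H1) as [K HK].
  apply (dW_ext a b alpha Hab Hal (n + r) _ _ K); auto; [lia|lra].
Qed.

Lemma cauchy_vsub (y z : nat -> R -> CC) : InX y -> InX z ->
  forall l, (l < r * m)%nat -> cauchy (vsub y z) l = (cauchy y l - cauchy z l)%C.
Proof.
  intros Hy Hz l Hl.
  rewrite (cauchy_ext (vsub y z) (fun j t => y j t + (- RtoC 1) * z j t)%C); auto.
  - rewrite cauchy_comb by assumption. ring.
  - apply InX_vsub; assumption.
  - intros. unfold vsub. ring.
Qed.

Lemma cauchy_zero (y : nat -> R -> CC) :
  (forall i t, (i < m)%nat -> a <= t <= b -> y i t = RtoC 0) ->
  forall l, (l < r * m)%nat -> cauchy y l = RtoC 0.
Proof.
  intros Hy l Hl.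
  assert (HyX : InX y) by (apply (vle_InCv a b alpha Hab Hal m _ _ 0), vle_0; assumption).
  rewrite (cauchy_ext y (vsub y y)); auto.
  - rewrite cauchy_vsub by assumption. ring.
  - intros j s Hj Hs. unfold vsub. rewrite Hy by assumption. ring.
Qed.

Lemma cauchy_vlin (M : nat) (d : nat -> CC) (Y : nat -> nat -> R -> CC) :
  (forall l, (l < M)%nat -> InX (Y l)) ->
  forall l, (l < r * m)%nat ->
  cauchy (vlin M d Y) l = Csum M (fun j => d j * cauchy (Y j) l)%C.
Proof.
  intros HY l Hl. induction M as [|M IH].
  - simpl. apply cauchy_zero; auto.
  - simpl. rewrite <- IH by auto.
    apply (cauchy_comb (d M) (vlin M d Y) (Y M)); auto. apply InX_vlin. auto.
Qed.

Lemma cauchy_at (y : nat -> R -> CC) (p k : nat) : (k < m)%nat ->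
  cauchy y (p * m + k)%nat = dW a b (n + r) (y k) p a.
Proof.
  intros Hk. unfold cauchy.
  replace ((p * m + k) mod m)%nat with k.
  - replace ((p * m + k) / m)%nat with p; [reflexivity|].
    rewrite Nat.div_add_l by lia. rewrite Nat.div_small by assumption. lia.
  - rewrite Nat.add_comm, Nat.Div0.mod_add. symmetry. apply Nat.mod_small. assumption.
Qed.

Lemma cauchy_index_lt (p k : nat) : (p < r)%nat -> (k < m)%nat -> (p * m + k < r * m)%nat.
Proof. intros Hp Hk. nia. Qed.

(** The constant depends on the coefficients through [KA] alone; this is the source of all
    uniformity in the parameter. *)
Lemma ivp_estimate (KA : R) : 0 <= KA -> exists K, 0 <= K /\
  forall A y F delta, 0 <= F -> 0 <= delta -> coef_le KA A -> InX y -> vY (LL A y) F ->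
  (forall l, (l < r * m)%nat -> Cmod (cauchy y l) <= delta) -> vX y (K * (F + delta)).
Proof.
  intros HKA. destruct (ivp_hle_bound a b alpha Hab Hal n m r KA HKA) as [K [HK H]].
  exists K. split; [assumption|]. intros A y F delta HF Hdel HA Hy HL Hd i Hi.
  destruct (InCv_vle a b alpha Hab Hal m _ y Hy) as [S [_ HS]].
  apply (hle_ext a b alpha _ (dW a b (n + r) (y i) 0)).
  { apply (dW_0 a b alpha Hab Hal _ _ S). apply HS. assumption. }
  apply (H A (LL A y) F delta (fun i p => dW a b (n + r) (y i) p)); try assumption.
  split; [assumption|]. split; [assumption|]. split; [|split; [|split]].
  - intros j p Hj Hp. destruct (hle_IsDerivs a b alpha Hab Hal _ _ _ (HS j Hj)) as [_ [H1 _]].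
    apply H1. lia.
  - intros j t Hj Ht. unfold LL. ring.
  - intros j p Hj Hp. rewrite <- cauchy_at by assumption. apply Hd. apply cauchy_index_lt; assumption.
  - exists S. intros j p t Hj Hp Ht.
    apply (hle_dW_bounds a b alpha Hab Hal _ _ _ (HS j Hj)); [lia|assumption].
Qed.

Lemma ivp_unique (KA : R) (A : nat -> nat -> nat -> R -> CC) (y : nat -> R -> CC) :
  0 <= KA -> coef_le KA A -> InX y ->
  (forall i t, (i < m)%nat -> a <= t <= b -> LL A y i t = RtoC 0) ->
  (forall l, (l < r * m)%nat -> cauchy y l = RtoC 0) ->
  forall i t, (i < m)%nat -> a <= t <= b -> y i t = RtoC 0.
Proof.
  intros HKA HA Hy HL Hc. destruct (ivp_estimate KA HKA) as [K [HK H]].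
  apply (vle_0_eq a b alpha m (n + r)). replace 0 with (K * (0 + 0)) by ring.
  apply (H A); auto; try lra.
  - apply vle_0. assumption.
  - intros l Hl. rewrite Hc, Cmod_0 by assumption. lra.
Qed.

Lemma dW_tower (g : R -> CC) (D : nat -> R -> CC) (K : R) : hle (n + r) g K ->
  (forall t, a <= t <= b -> D 0%nat t = g t) ->
  (forall p, (p < r)%nat -> DerivOn a b (D p) (D (S p))) ->
  forall j t, (j <= r)%nat -> a <= t <= b -> dW a b (n + r) g j t = D j t.
Proof.
  intros Hg H0 HD. destruct (hle_IsDerivs a b alpha Hab Hal _ _ _ Hg) as [H1 [H2 _]].
  induction j as [|j IH]; intros t Hj Ht.
  - rewrite H1, H0 by assumption. reflexivity.
  - apply (DerivOn_unique a b Hab (D j)); [|apply HD; lia|assumption].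
    apply (DerivOn_ext a b (dW a b (n + r) g j) (dW a b (n + r) g (S j))).
    + intros s Hs. apply IH; [lia|assumption].
    + reflexivity.
    + apply H2. lia.
Qed.

Lemma ivp_solve (KA : R) (A : nat -> nat -> nat -> R -> CC) (f : nat -> R -> CC) (d : nat -> CC) :
  (1 <= r)%nat -> 0 <= KA -> coef_le KA A -> InCv a b n alpha m f ->
  exists y, InX y /\ (forall i t, (i < m)%nat -> a <= t <= b -> LL A y i t = f i t) /\
    (forall l, (l < r * m)%nat -> cauchy y l = d l).
Proof.
  intros Hr HKA HA Hf. destruct (InCv_vle a b alpha Hab Hal m _ f Hf) as [F [HF HfF]].
  destruct (bound_all (r * m) (fun l K => Cmod (d l) <= K)) as [delta [Hdel Hd]].
  { intros; lra. }
  { intros l _. exists (Cmod (d l)). split; [apply Cmod_ge_0|lra]. }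
  destruct (ivp_exists_tower a b alpha Hab Hal n m r KA A f F delta
    (fun i p => d (p * m + i)%nat)) as [D [HD HDa]]; auto.
  { intros i p Hi Hp. apply Hd. apply cauchy_index_lt; assumption. }
  destruct (ivp_hle_bound a b alpha Hab Hal n m r KA HKA) as [K [HK H]].
  specialize (H A f F delta D HF Hdel HD).
  assert (Hy : vX (fun i => D i 0%nat) (K * (F + delta))) by exact H.
  destruct HD as [_ [_ [HD [Heq _]]]].
  assert (Ed : forall i j t, (i < m)%nat -> (j <= r)%nat -> a <= t <= b ->
    dW a b (n + r) (D i 0%nat) j t = D i j t).
  { intros i j t Hi Hj Ht. apply (dW_tower _ (D i) _ (H i Hi)); auto. }
  exists (fun i => D i 0%nat). split; [|split].
  - apply (vle_InCv a b alpha Hab Hal m _ _ _ Hy).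
  - intros i t Hi Ht. unfold LL. rewrite Ed, Heq by (assumption || lia).
    rewrite (opC_ext m r A A (fun k p => dW a b (n + r) (D k 0%nat) p) D); [ring|reflexivity|].
    intros p k Hp Hk. apply Ed; [assumption|lia|assumption].
  - intros l Hl. destruct (cauchy_index l Hl) as [H1 H2].
    unfold cauchy. rewrite Ed, HDa by (assumption || lia || lra).
    f_equal. rewrite Nat.mul_comm. symmetry. apply Nat.div_mod_eq.
Qed.

(** * The boundary-value problem reduced to a matrix of boundary values *)

Definition bvp_estimate (A : nat -> nat -> nat -> R -> CC) (T : (nat -> R -> CC) -> nat -> CC) (K : R) : Prop :=
  forall y F g, 0 <= F -> 0 <= g -> InX y -> vY (LL A y) F ->
    (forall i, (i < r * m)%nat -> Cmod (T y i) <= g) -> vX y (K * (F + g)).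

Definition bvp_solvable (A : nat -> nat -> nat -> R -> CC) (T : (nat -> R -> CC) -> nat -> CC) : Prop :=
  forall f c, InCv a b n alpha m f -> exists y, InX y /\
    (forall i t, (i < m)%nat -> a <= t <= b -> LL A y i t = f i t) /\
    (forall i, (i < r * m)%nat -> T y i = c i).

Definition fundamental (A : nat -> nat -> nat -> R -> CC) (phi : nat -> nat -> R -> CC) : Prop :=
  forall l, (l < r * m)%nat -> InX (phi l) /\
    (forall i t, (i < m)%nat -> a <= t <= b -> LL A (phi l) i t = RtoC 0) /\
    (forall k, (k < r * m)%nat -> cauchy (phi l) k = if Nat.eq_dec l k then RtoC 1 else RtoC 0).

Lemma fundamental_exists (KA : R) (A : nat -> nat -> nat -> R -> CC) :
  (1 <= r)%nat -> 0 <= KA -> coef_le KA A -> exists phi, fundamental A phi.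
Proof.
  intros Hr HKA HA.
  destruct (choice_fun nat (nat -> R -> CC) (fun l y => InX y /\
    (forall i t, (i < m)%nat -> a <= t <= b -> LL A y i t = RtoC 0) /\
    (forall k, (k < r * m)%nat -> cauchy y k = if Nat.eq_dec l k then RtoC 1 else RtoC 0))) as [phi Hphi].
  - intros l. apply (ivp_solve KA A (fun _ _ => RtoC 0)
      (fun k => if Nat.eq_dec l k then RtoC 1 else RtoC 0)); auto.
    apply (vle_InCv a b alpha Hab Hal m _ _ 0). apply vle_zero. lra.
  - exists phi. intros l _. apply Hphi.
Qed.

Lemma cauchy_fundamental (A : nat -> nat -> nat -> R -> CC) (phi : nat -> nat -> R -> CC) (d : nat -> CC) :
  fundamental A phi -> forall l, (l < r * m)%nat -> cauchy (vlin (r * m) d phi) l = d l.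
Proof.
  intros Hphi l Hl. rewrite cauchy_vlin; [|apply Hphi|assumption].
  rewrite (Csum_single (r * m) l); [|assumption|].
  - destruct (Hphi l Hl) as [_ [_ H]]. rewrite H by assumption.
    destruct (Nat.eq_dec l l); [ring|lia].
  - intros j Hj Hne. destruct (Hphi j Hj) as [_ [_ H]]. rewrite H by assumption.
    destruct (Nat.eq_dec j l); [lia|ring].
Qed.

Lemma LL_fundamental (A : nat -> nat -> nat -> R -> CC) (phi : nat -> nat -> R -> CC) (d : nat -> CC) :
  fundamental A phi -> forall i t, (i < m)%nat -> a <= t <= b ->
  LL A (vlin (r * m) d phi) i t = RtoC 0.
Proof.
  intros Hphi i t Hi Ht. rewrite LL_vlin; [|apply Hphi|assumption|assumption].
  apply Csum_0. intros l Hl. destruct (Hphi l Hl) as [_ [H _]]. rewrite H by assumption. ring.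
Qed.

(* y = z + sum_l d_l phi_l, where z solves the equation with zero Cauchy data and d are the
   Cauchy data of y: this reduces the boundary conditions to a linear system for d. *)
Lemma bvp_of_matrix (KA KT C K1 : R) (A : nat -> nat -> nat -> R -> CC)
  (T : (nat -> R -> CC) -> nat -> CC) (phi : nat -> nat -> R -> CC) :
  (1 <= r)%nat -> 0 <= KA -> 0 <= KT -> 0 <= C -> 0 <= K1 -> coef_le KA A -> CLO T ->
  (forall y rho, vX y rho -> forall i, (i < r * m)%nat -> Cmod (T y i) <= KT * rho) ->
  (forall y F delta, 0 <= F -> 0 <= delta -> InX y -> vY (LL A y) F ->
     (forall l, (l < r * m)%nat -> Cmod (cauchy y l) <= delta) -> vX y (K1 * (F + delta))) ->
  fundamental A phi ->
  (forall d g, 0 <= g ->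
     (forall i, (i < r * m)%nat -> Cmod (matvec (r * m) (fun i l => T (phi l) i) d i) <= g) ->
     forall l, (l < r * m)%nat -> Cmod (d l) <= C * g) ->
  bvp_estimate A T (K1 * (1 + C * (1 + KT * K1))) /\ bvp_solvable A T.
Proof.
  intros Hr HKA HKT HC HK1 HA HT HTb Hest Hphi HM.
  assert (HphiX : forall l, (l < r * m)%nat -> InX (phi l)) by apply Hphi.
  assert (HTv : forall d i, (i < r * m)%nat ->
    T (vlin (r * m) d phi) i = matvec (r * m) (fun i l => T (phi l) i) d i).
  { intros d i Hi. apply CLO_vlin; assumption. }
  split.
  - intros y F g HF Hg Hy HL HTy.
    destruct (ivp_solve KA A (LL A y) (fun _ => RtoC 0) Hr HKA HA (LL_InCv A KA y HA Hy))
      as [z [Hz [HzL Hzc]]].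
    assert (HzK : vX z (K1 * (F + 0))).
    { apply Hest; auto; try lra.
      - apply (vle_ext a b alpha m n (LL A y)); [|assumption]. intros; symmetry; auto.
      - intros l Hl. rewrite Hzc, Cmod_0 by assumption. lra. }
    assert (Hw : forall i t, (i < m)%nat -> a <= t <= b ->
      vsub (vsub y z) (vlin (r * m) (cauchy y) phi) i t = RtoC 0).
    { assert (Hyz : InX (vsub y z)) by (apply InX_vsub; assumption).
      assert (Hv : InX (vlin (r * m) (cauchy y) phi)) by (apply InX_vlin; assumption).
      apply (ivp_unique KA A); try assumption.
      - apply InX_vsub; assumption.
      - intros i t Hi Ht. rewrite !LL_vsub, LL_fundamental, HzL by assumption. ring.
      - intros l Hl. rewrite !cauchy_vsub, Hzc by assumption.
        rewrite (cauchy_fundamental A) by assumption. ring. }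
    assert (Hd : forall l, (l < r * m)%nat -> Cmod (cauchy y l) <= C * (g + KT * (K1 * (F + 0)))).
    { apply HM.
      - assert (0 <= KT * (K1 * (F + 0))) by (repeat apply Rmult_le_pos; lra). lra.
      - intros i Hi. rewrite <- HTv by assumption.
        rewrite <- (CLO_ext T (vsub y z) (vlin (r * m) (cauchy y) phi) HT); [|apply InX_vsub; assumption| |assumption].
        + rewrite CLO_vsub by assumption. eapply Rle_trans; [apply Cmod_minus_le|].
          apply Rplus_le_compat; [auto|]. apply HTb; assumption.
        + intros j t Hj Ht. apply Cminus_eq_0. apply (Hw j t); assumption. }
    assert (HKK : 0 <= KT * K1) by nra.
    assert (Hd0 : 0 <= C * (g + KT * (K1 * (F + 0)))).
    { apply Rmult_le_pos; [assumption|]. assert (0 <= KT * K1 * F) by nra. lra. }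
    (* The initial value estimate is used a second time, now for [y] itself with the bound on its
       Cauchy data obtained from the linear system. *)
    apply (vle_mono a b alpha m _ _ (K1 * (F + C * (g + KT * (K1 * (F + 0)))))).
    2:{ apply Hest; assumption. }
    rewrite Rmult_assoc. apply Rmult_le_compat_l; [assumption|].
    assert (0 <= C * F) by nra. assert (0 <= C * (KT * K1) * g) by (repeat apply Rmult_le_pos; lra).
    lra.
  - intros f c Hf.
    destruct (ivp_solve KA A f (fun _ => RtoC 0) Hr HKA HA Hf) as [z [Hz [HzL Hzc]]].
    destruct (injective_surjective (r * m) (fun i l => T (phi l) i)) with (g := fun i => (c i - T z i)%C)
      as [d Hd].
    { intros d Hd l Hl. apply Cmod_le_0. rewrite <- (Rmult_0_r C). apply (HM d); [lra| |assumption].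
      intros i Hi. unfold matvec. rewrite Hd, Cmod_0 by assumption. lra. }
    assert (Hv : InX (vlin (r * m) d phi)) by (apply InX_vlin; assumption).
    exists (fun j t => z j t + RtoC 1 * vlin (r * m) d phi j t)%C. split; [|split].
    + apply InX_comb; assumption.
    + intros i t Hi Ht. rewrite LL_comb, LL_fundamental, HzL by assumption. ring.
    + intros i Hi. rewrite CLO_comb, HTv by assumption. unfold matvec. rewrite Hd by assumption. ring.
Qed.

Definition coef_conv (A : R -> nat -> nat -> nat -> R -> CC) : Prop :=
  forall e, 0 < e -> ev (fun eps => coef_le e (fun p i k t => A eps p i k t - A 0 p i k t)%C).

Definition strong_conv (B : R -> (nat -> R -> CC) -> nat -> CC) : Prop :=
  forall y, InX y -> forall e, 0 < e ->
    ev (fun eps => forall i, (i < r * m)%nat -> Cmod (B eps y i - B 0 y i)%C <= e).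

Lemma coef_le_plus (K L : R) (A A' : nat -> nat -> nat -> R -> CC) : coef_le K A ->
  coef_le L (fun p i k t => A' p i k t - A p i k t)%C -> coef_le (K + L) A'.
Proof.
  intros H1 H2 p i k Hp Hi Hk.
  apply (hle_ext a b alpha n (fun t => A p i k t + (A' p i k t - A p i k t))%C); [intros; ring|].
  apply hle_plus; auto.
Qed.

Lemma coef_le_exists (A : nat -> nat -> nat -> R -> CC) :
  (forall p, (p < r)%nat -> InCm a b n alpha m (A p)) -> exists K, 0 <= K /\ coef_le K A.
Proof.
  intros HA.
  destruct (bound_all r (fun p K => forall i, (i < m)%nat -> forall k, (k < m)%nat -> hle n (A p i k) K))
    as [K [HK H]].
  - intros p K L HKL H i Hi k Hk. apply (hle_mono a b alpha n _ K L HKL). auto.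
  - intros p Hp. apply (bound_all m (fun i K => forall k, (k < m)%nat -> hle n (A p i k) K)).
    + intros i K L HKL H k Hk. apply (hle_mono a b alpha n _ K L HKL). auto.
    + intros i Hi. apply (bound_all m (fun k K => hle n (A p i k) K)).
      * intros k K L. apply hle_mono.
      * intros k Hk. apply (InC_hle a b alpha Hab Hal). apply HA; assumption.
  - exists K. split; [assumption|]. intros p i k Hp Hi Hk. auto.
Qed.

(** Strong convergence supplies the pointwise bounds, [B eps y] being eventually within 1 of
    [B 0 y]. The sum of two constants covers the parameter 0, about which [ev] says nothing. *)
Lemma uniform_boundedness_at_0 (B : R -> (nat -> R -> CC) -> nat -> CC) (eps0 : R) : 0 < eps0 ->
  (forall eps, 0 <= eps < eps0 -> CLO (B eps)) -> strong_conv B ->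
  exists K, 0 <= K /\ 
    (forall y rho, vX y rho -> forall i, (i < r * m)%nat -> Cmod (B 0 y i) <= K * rho) /\
    ev (fun eps => forall y rho, vX y rho -> forall i, (i < r * m)%nat -> Cmod (B eps y i) <= K * rho).
Proof.
  intros He HB HII.
  destruct (CLO_bound (B 0) (HB 0 ltac:(lra))) as [K0 [HK0 H0]].
  destruct (uniform_boundedness B eps0 He HB) as [K [HK H]].
  - intros y Hy. destruct (InCv_vle a b alpha Hab Hal m _ y Hy) as [M [HM HyM]].
    exists (K0 * M + 1). apply (ev_imp _ _) with (2 := HII y Hy 1 ltac:(lra)).
    intros eps He1 i Hi. eapply Rle_trans; [apply (Cmod_le_minus _ (B 0 y i))|].
    apply Rplus_le_compat; auto.
  - exists (K0 + K). split; [lra|].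
    assert (Hr : forall y rho, vX y rho -> forall i, (i < r * m)%nat -> 0 <= rho).
    { intros y rho Hy i Hi. assert (Hm : (0 < m)%nat) by (destruct m; [rewrite Nat.mul_0_r in Hi; lia|lia]).
      apply (hle_nonneg a b alpha Hab _ _ _ (Hy 0%nat Hm)). }
    split.
    + intros y rho Hy i Hi. specialize (H0 y rho Hy i Hi). specialize (Hr y rho Hy i Hi). nra.
    + apply (ev_imp _ _) with (2 := H). intros eps H1 y rho Hy i Hi.
      specialize (H1 y rho Hy i Hi). specialize (Hr y rho Hy i Hi). nra.
Qed.

(** The matrix converges because B(eps) phi(eps) - B(0) phi(0) splits into B(eps) (phi(eps) -
    phi(0)), small by the uniform bound on B(eps), and (B(eps) - B(0)) phi(0), small by strong
    convergence on finitely many fixed functions. *)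
Lemma bvp_uniform (A : R -> nat -> nat -> nat -> R -> CC) (B : R -> (nat -> R -> CC) -> nat -> CC)
  (eps0 : R) : (1 <= r)%nat -> 0 < eps0 ->
  (forall p, (p < r)%nat -> InCm a b n alpha m (A 0 p)) ->
  (forall eps, 0 <= eps < eps0 -> CLO (B eps)) ->
  (forall y, InX y ->
     (forall i t, (i < m)%nat -> a <= t <= b -> LL (A 0) y i t = RtoC 0) ->
     (forall i, (i < r * m)%nat -> B 0 y i = RtoC 0) ->
     forall i t, (i < m)%nat -> a <= t <= b -> y i t = RtoC 0) ->
  coef_conv A -> strong_conv B ->
  exists K delta, 0 <= K /\ 0 < delta /\ forall eps, 0 <= eps < delta ->
    bvp_estimate (A eps) (B eps) K /\ bvp_solvable (A eps) (B eps).
Proof.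
  intros Hr He0 HA0 HB H0 HI HII.
  destruct (coef_le_exists (A 0) HA0) as [KA0 [HKA0 HA0']].
  (* One bound for the coefficients at 0 and at all small parameters, whose difference is eventually
     at most 1. *)
  set (KA := KA0 + 1). assert (HKA : 0 <= KA) by (unfold KA; lra).
  assert (HA0K : coef_le KA (A 0)).
  { intros p i k Hp Hi Hk. apply (hle_mono a b alpha n _ KA0); [unfold KA; lra|]. auto. }
  assert (HAev : ev (fun eps => coef_le KA (A eps))).
  { apply (ev_imp _ _) with (2 := HI 1 ltac:(lra)). intros eps H. apply (coef_le_plus KA0 1 (A 0)); assumption. }
  destruct (ivp_estimate KA HKA) as [K1 [HK1 Hest]].
  destruct (uniform_boundedness_at_0 B eps0 He0 HB HII) as [KB [HKB [HB0 HBev]]].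
  destruct (choice_fun R (nat -> nat -> R -> CC) (fun eps phi => coef_le KA (A eps) -> fundamental (A eps) phi))
    as [phi Hphi].
  { intros eps. destruct (excluded_middle_informative (coef_le KA (A eps))) as [H|H].
    - destruct (fundamental_exists KA (A eps) Hr HKA H) as [ph Hph]. exists ph. auto.
    - exists (fun _ _ _ => RtoC 0). intros; contradiction. }
  pose proof (Hphi 0 HA0K) as Hphi0.
  set (M := fun eps i l => B eps (phi eps l) i).
  (* A kernel vector [d] gives a combination of the [phi 0 l] that solves the homogeneous problem at
     0. It vanishes, and so do its Cauchy data, which are [d]. *)
  assert (Hinj : forall d, (forall i, (i < r * m)%nat -> matvec (r * m) (M 0) d i = RtoC 0) ->
    forall j, (j < r * m)%nat -> d j = RtoC 0).
  { intros d Hd j Hj. rewrite <- (cauchy_fundamental (A 0) (phi 0) d Hphi0 j Hj).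
    apply cauchy_zero; [|assumption]. apply H0.
    - apply InX_vlin. apply Hphi0.
    - apply LL_fundamental. assumption.
    - intros i Hi. rewrite CLO_vlin; [|apply HB; lra|apply Hphi0|assumption]. apply Hd. assumption. }
  destruct (injective_bounded_below (r * m) (M 0) Hinj) as [C [HC HM0]].
  assert (HphiK : forall l, (l < r * m)%nat -> vX (phi 0 l) (K1 * (0 + 1))).
  { intros l Hl. destruct (Hphi0 l Hl) as [H1 [H2 H3]]. apply (Hest (A 0)); auto; try lra.
    - apply vle_0. assumption.
    - intros k Hk. rewrite H3 by assumption. destruct (Nat.eq_dec l k).
      + rewrite Cmod_1. lra.
      + rewrite Cmod_0. lra. }
  assert (Hconv : forall tau, 0 < tau -> ev (fun eps => coef_le KA (A eps) /\
    forall l, (l < r * m)%nat -> forall i, (i < r * m)%nat -> Cmod (M eps i l - M 0 i l)%C <= tau)).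
  { intros tau Htau.
    assert (Hoc := opc_nonneg).
    (* The amplification of a coefficient error [sg]: [K1] bounds [phi 0 l], [opc] the action of the
       error on it, the other [K1] the solution of the initial value problem, [KB] the boundary
       operator. The 1 makes division safe. *)
    set (q := KB * (K1 * (opc * K1)) + 1).
    assert (Hq : 1 <= q).
    { unfold q. assert (0 <= KB * (K1 * (opc * K1))) by (repeat (apply Rmult_le_pos; [assumption|]); assumption). lra. }
    set (sg := tau / 2 / q). assert (Hsg : 0 < sg) by (apply Rdiv_lt_0_compat; lra).
    apply (ev_imp (fun eps => (coef_le KA (A eps) /\
        coef_le sg (fun p i k t => A eps p i k t - A 0 p i k t)%C) /\
      ((forall y rho, vX y rho -> forall i, (i < r * m)%nat -> Cmod (B eps y i) <= KB * rho) /\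
       (0 < eps < eps0)) /\
      (forall l, (l < r * m)%nat -> forall i, (i < r * m)%nat ->
         Cmod (B eps (phi 0 l) i - B 0 (phi 0 l) i)%C <= tau / 2))).
    - intros eps [[H1 H2] [[H3 Heps] H4]]. split; [assumption|]. intros l Hl i Hi.
      destruct (Hphi eps H1 l Hl) as [P1 [P2 P3]]. destruct (Hphi0 l Hl) as [Q1 [Q2 Q3]].
      (* Both functions have the same Cauchy data, and L(eps) maps their difference to -(L(eps) -
         L(0)) phi(0), which is of the size of the coefficient error. *)
      assert (Hd : vX (vsub (phi eps l) (phi 0 l)) (K1 * (opc * (sg * (K1 * (0 + 1))) + 0))).
      { apply (Hest (A eps)); auto; try lra.
        - apply Rmult_le_pos; [assumption|]. apply Rmult_le_pos; lra.
        - apply InX_vsub; assumption.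
        - apply (vle_ext a b alpha m n (vsub (fun _ _ => RtoC 0)
            (opC m r (fun p i k t => A eps p i k t - A 0 p i k t)%C
              (fun k p => dW a b (n + r) (phi 0 l k) p)))).
          + intros j t Hj Ht. unfold vsub at 1. rewrite <- LL_minus_A.
            rewrite LL_vsub, P2, Q2 by assumption. ring.
          + rewrite <- (Rplus_0_l (opc * _)). apply vle_minus; [apply vle_zero; lra|].
            apply opC_dW_hle; auto.
        - intros k Hk. rewrite cauchy_vsub, P3, Q3 by assumption.
          replace (_ - _)%C with (RtoC 0) by (destruct (Nat.eq_dec l k); ring).
          rewrite Cmod_0. lra. }
      unfold M. eapply Rle_trans; [apply (Cmod_triangle3 _ (B eps (phi 0 l) i))|].
      specialize (H4 l Hl i Hi). specialize (H3 _ _ Hd i Hi).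
      rewrite (CLO_vsub (B eps) _ _ (HB eps ltac:(lra)) P1 Q1 i Hi) in H3.
      assert (KB * (K1 * (opc * (sg * (K1 * (0 + 1))) + 0)) <= tau / 2).
      { replace (KB * (K1 * (opc * (sg * (K1 * (0 + 1))) + 0))) with ((q - 1) * sg) by (unfold q; ring).
        apply Rle_trans with (q * sg); [lra|]. unfold sg. right. field. lra. }
      lra.
    - apply ev_and; [|apply ev_and].
      + apply ev_and; [assumption|]. apply HI. assumption.
      + apply ev_and; [assumption|]. apply ev_lt. assumption.
      + apply (ev_all (r * m)). intros l Hl. apply HII; [apply Hphi0; assumption|lra]. }
  set (q := C * INR (r * m) + 1).
  assert (Hq : 1 <= q).
  { unfold q. assert (0 <= C * INR (r * m)) by (apply Rmult_le_pos; auto using pos_INR). lra. }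
  set (tau := / 2 / q). assert (Htau : 0 < tau) by (apply Rdiv_lt_0_compat; lra).
  assert (HCt : C * (INR (r * m) * tau) <= / 2).
  { replace (C * (INR (r * m) * tau)) with ((q - 1) * tau) by (unfold q; ring).
    apply Rle_trans with (q * tau); [lra|]. unfold tau. right. field. lra. }
  assert (Hfin : forall eps, coef_le KA (A eps) -> CLO (B eps) ->
    (forall y rho, vX y rho -> forall i, (i < r * m)%nat -> Cmod (B eps y i) <= KB * rho) ->
    (forall l, (l < r * m)%nat -> forall i, (i < r * m)%nat -> Cmod (M eps i l - M 0 i l)%C <= tau) ->
    bvp_estimate (A eps) (B eps) (K1 * (1 + 2 * C * (1 + KB * K1))) /\ bvp_solvable (A eps) (B eps)).
  { intros eps H1 H2 H3 H4. apply (bvp_of_matrix KA KB (2 * C) K1 (A eps) (B eps) (phi eps)); auto; try lra.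
    - intros y F delta HF Hdel Hy HL Hc. apply (Hest (A eps)); assumption.
    - apply (bounded_below_perturb (r * m) (M 0) (M eps) C tau); auto. }
  destruct (ev_and _ _ (Hconv tau Htau) (ev_and _ _ HBev (ev_lt eps0 He0))) as [delta [Hdel Hev]].
  exists (K1 * (1 + 2 * C * (1 + KB * K1))), delta.
  split; [|split; [assumption|]].
  - assert (0 <= KB * K1) by (apply Rmult_le_pos; assumption).
    apply Rmult_le_pos; [assumption|]. assert (0 <= 2 * C * (1 + KB * K1)) by (apply Rmult_le_pos; lra). lra.
  (* The eventual statements exclude the parameter 0, where the perturbation of the matrix is
     zero. *)
  - intros eps Heps. destruct (Req_dec eps 0) as [->|Hne].
    + apply Hfin; auto.
      * apply HB. lra.
      * intros l _ i _. replace (M 0 i l - M 0 i l)%C with (RtoC 0) by ring. rewrite Cmod_0. lra.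
    + destruct (Hev eps ltac:(lra)) as [[H1 H2] [H3 H4]]. apply Hfin; auto. apply HB. lra.
Qed.

Definition bvp_unique (A : nat -> nat -> nat -> R -> CC) (T : (nat -> R -> CC) -> nat -> CC) : Prop :=
  forall y z, InX y -> InX z ->
    (forall i t, (i < m)%nat -> a <= t <= b -> LL A y i t = LL A z i t) ->
    (forall i, (i < r * m)%nat -> T y i = T z i) ->
    forall i t, (i < m)%nat -> a <= t <= b -> y i t = z i t.

Lemma bvp_estimate_unique (A : nat -> nat -> nat -> R -> CC) (T : (nat -> R -> CC) -> nat -> CC) (K : R) :
  CLO T -> bvp_estimate A T K -> bvp_unique A T.
Proof.
  intros HT HE y z Hy Hz HL HTT i t Hi Ht. apply Cminus_eq_0.
  apply (vle_0_eq a b alpha m (n + r) (vsub y z)); [|assumption|assumption].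
  replace 0 with (K * (0 + 0)) by ring. apply HE; try lra.
  - apply InX_vsub; assumption.
  - apply vle_0. intros j s Hj Hs. rewrite LL_vsub, HL by assumption. ring.
  - intros j Hj. rewrite CLO_vsub, HTT by assumption.
    replace (_ - _)%C with (RtoC 0) by ring. rewrite Cmod_0. lra.
Qed.

(** * Monomials as test functions for the coefficients *)

Definition monomial (k : nat) (t : R) : CC := RtoC ((t - a) ^ k / INR (fact k)).

Lemma DerivOn_monomial (k : nat) : DerivOn a b (monomial (S k)) (monomial k).
Proof.
  apply (DerivOn_pair a b (fun t => (t - a) ^ S k / INR (fact (S k))) (fun t => (t - a) ^ k / INR (fact k))
    (fun _ => 0) (fun _ => 0)).
  - intros t _.
    assert (Hc : INR (fact (S k)) = INR (S k) * INR (fact k)) by (rewrite fact_simpl, mult_INR; reflexivity).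
    generalize (INR (fact (S k))) Hc. intros c ->.
    pose proof (INR_fact_neq_0 k). pose proof (not_0_INR (S k) ltac:(lia)).
    auto_derive; [trivial|]. change (Init.Nat.pred (S k)) with k. unfold Rminus. field. auto.
  - intros t _. auto_derive; [trivial|reflexivity].
Qed.

Lemma monomial_hle (k N : nat) : exists K, 0 <= K /\ hle N (monomial k) K.
Proof.
  revert N. induction k as [|k IH]; intros N.
  - exists 1. split; [lra|]. apply (hle_ext a b alpha N (fun _ => RtoC 1)).
    + intros. unfold monomial. simpl. f_equal. field.
    + pose proof (hle_const a b alpha N (RtoC 1)) as H. rewrite Cmod_1 in H. exact H.
  - destruct (IH N) as [K [HK H]].
    pose proof (Cmod_ge_0 (monomial (S k) a)) as H0.
    set (L := Cmod (monomial (S k) a) + K * (1 + (b - a))).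
    assert (HL : K <= L) by (unfold L; nra).
    exists (kap a b alpha * L). split.
    + pose proof (kap_ge_1 a b alpha). apply Rmult_le_pos; lra.
    + apply (hle_pred a b alpha Hab Hal). split.
      * intros t Ht. eapply Rle_trans; [apply (Cmod_le_minus _ (monomial (S k) a))|].
        unfold L. apply Rplus_le_compat_l.
        eapply Rle_trans; [apply (DerivOn_lipschitz a b Hab _ _ K (DerivOn_monomial k)); try lra|nra].
        apply (hle_bound a b alpha N _ _ H).
      * exists (monomial k). split; [apply DerivOn_monomial|].
        apply (hle_mono a b alpha N _ K); assumption.
Qed.

(** The test [q <= p] matters: for [q > p] truncated subtraction would give [monomial 0], that is 1,
    instead of 0. *)
Definition monomial_deriv (p q : nat) (t : R) : CC :=
  if le_dec q p then monomial (p - q) t else RtoC 0.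

Lemma DerivOn_monomial_deriv (p q : nat) : DerivOn a b (monomial_deriv p q) (monomial_deriv p (S q)).
Proof.
  destruct (lt_eq_lt_dec q p) as [[H|H]|H].
  - apply (DerivOn_ext a b (monomial (S (p - S q))) (monomial (p - S q))); [| |apply DerivOn_monomial].
    + intros t _. unfold monomial_deriv. destruct (le_dec q p); [|lia]. f_equal. lia.
    + intros t _. unfold monomial_deriv. destruct (le_dec (S q) p); [reflexivity|lia].
  - apply (DerivOn_ext a b (fun _ => RtoC 1) (fun _ => RtoC 0)); [| |apply DerivOn_const].
    + intros t _. unfold monomial_deriv. destruct (le_dec q p); [|lia].
      replace (p - q)%nat with 0%nat by lia. unfold monomial. simpl. f_equal. field.
    + intros t _. unfold monomial_deriv. destruct (le_dec (S q) p); [lia|reflexivity].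
  - apply (DerivOn_ext a b (fun _ => RtoC 0) (fun _ => RtoC 0)); [| |apply DerivOn_const].
    + intros t _. unfold monomial_deriv. destruct (le_dec q p); [lia|reflexivity].
    + intros t _. unfold monomial_deriv. destruct (le_dec (S q) p); [lia|reflexivity].
Qed.

Definition test_fun (p k : nat) : nat -> R -> CC :=
  fun j t => if Nat.eq_dec j k then monomial p t else RtoC 0.

Lemma test_fun_InX (p k : nat) : InX (test_fun p k).
Proof.
  destruct (monomial_hle p (n + r)) as [K [HK H]].
  apply (vle_InCv a b alpha Hab Hal m _ _ K). intros j Hj. unfold test_fun.
  destruct (Nat.eq_dec j k); [exact H|apply hle_zero; assumption].
Qed.

Lemma test_fun_dW (p k j q : nat) (t : R) : (q <= r)%nat -> a <= t <= b ->
  dW a b (n + r) (test_fun p k j) q t =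
    if Nat.eq_dec j k then monomial_deriv p q t else RtoC 0.
Proof.
  intros Hq Ht. destruct (monomial_hle p (n + r)) as [K [HK H]].
  unfold test_fun. destruct (Nat.eq_dec j k) as [Hjk|Hjk].
  - apply (dW_tower (fun t => monomial p t) (monomial_deriv p) K); auto.
    + intros s Hs. unfold monomial_deriv. destruct (le_dec 0 p); [|lia]. f_equal. lia.
    + intros. apply DerivOn_monomial_deriv.
  - apply (dW_tower (fun _ => RtoC 0) (fun _ _ => RtoC 0) 0); auto.
    + apply hle_zero. lra.
    + intros. apply DerivOn_const.
Qed.

(** The test function has only its [k]-th component, which selects column [k], and its [p]-th
    derivative is 1, which isolates [C p i k]. In the remaining sum the orders [q > p] carry the
    factor 0. *)
Lemma opC_test_fun (C : nat -> nat -> nat -> R -> CC) (p k i : nat) (t : R) :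
  (p < r)%nat -> (k < m)%nat -> a <= t <= b ->
  opC m r C (fun j q => dW a b (n + r) (test_fun p k j) q) i t =
  (C p i k t + Csum r (fun q => if Nat.eq_dec q p then RtoC 0 else C q i k t * monomial_deriv p q t))%C.
Proof.
  intros Hp Hk Ht. unfold opC.
  rewrite (Csum_ext r _ (fun q => C q i k t * monomial_deriv p q t)%C).
  - rewrite (Csum_pick r p) by assumption. f_equal. unfold monomial_deriv.
    destruct (le_dec p p); [|lia]. rewrite Nat.sub_diag. unfold monomial. simpl.
    replace (1 / 1) with 1 by field. ring.
  - intros q Hq. rewrite (Csum_single m k); [|assumption|].
    + rewrite test_fun_dW by (assumption || lia). destruct (Nat.eq_dec k k); [reflexivity|lia].
    + intros j Hj Hne. rewrite test_fun_dW by (assumption || lia).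
      destruct (Nat.eq_dec j k); [lia|ring].
Qed.

Definition cont_dep (A : R -> nat -> nat -> nat -> R -> CC) (B : R -> (nat -> R -> CC) -> nat -> CC)
  (eps1 : R) : Prop :=
  forall f c y, (forall eps, 0 <= eps < eps1 -> InCv a b n alpha m (f eps)) ->
    (forall eps, 0 <= eps < eps1 -> InX (y eps) /\
       (forall i t, (i < m)%nat -> a <= t <= b -> LL (A eps) (y eps) i t = f eps i t) /\
       (forall i, (i < r * m)%nat -> B eps (y eps) i = c eps i)) ->
    (forall e, 0 < e -> ev (fun eps => vY (vsub (f eps) (f 0)) e)) ->
    (forall e, 0 < e -> ev (fun eps => forall i, (i < r * m)%nat -> Cmod (c eps i - c 0 i)%C <= e)) ->
    forall e, 0 < e -> ev (fun eps => vX (vsub (y eps) (y 0)) e).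

Lemma ev_true (P : R -> Prop) : (forall e, P e) -> ev P.
Proof. intros H. exists 1. split; [lra|auto]. Qed.

(** Turns a relative estimate into an absolute one. As [e <= / 2], a bound [2 * e + x] improves to
    [2 * e + x / 2]; after finitely many steps the remainder is below the third [e]. *)
Lemma coef_halving (e : R) (C : nat -> nat -> nat -> R -> CC) : 0 < e <= / 2 ->
  (exists K, 0 <= K /\ coef_le K C) ->
  (forall K, 0 <= K -> coef_le K C -> coef_le (e * (1 + K)) C) -> coef_le (3 * e) C.
Proof.
  intros He [K [HK H0]] H.
  assert (Hk : forall j, coef_le (2 * e + K * (/2) ^ j) C).
  { induction j as [|j IH].
    - intros p i k Hp Hi Hk. apply (hle_mono a b alpha n _ K); [simpl; lra|]. auto.
    - assert (Hj : 0 <= K * (/2) ^ j) by (apply Rmult_le_pos; [assumption|apply pow_le; lra]).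
      intros p i k Hp Hi Hk.
      apply (hle_mono a b alpha n _ (e * (1 + (2 * e + K * (/2) ^ j)))).
      + simpl. replace (K * (/2 * (/2)^j)) with (/2 * (K * (/2)^j)) by ring. nra.
      + apply H; auto. lra. }
  destruct (pow_half_small K e HK ltac:(lra)) as [j Hj].
  intros p i k Hp Hi Hk'. apply (hle_mono a b alpha n _ (2 * e + K * (/2) ^ j)); [lra|].
  apply Hk; assumption.
Qed.

(** * Necessity *)

Section Forward.
Context (A : R -> nat -> nat -> nat -> R -> CC) (B : R -> (nat -> R -> CC) -> nat -> CC) (eps0 eps1 : R).
Context (Heps : 0 < eps1 < eps0)
  (HA : forall eps, 0 <= eps < eps0 -> forall p, (p < r)%nat -> InCm a b n alpha m (A eps p))
  (HB : forall eps, 0 <= eps < eps0 -> CLO (B eps))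
  (Hsolv : forall eps, 0 <= eps < eps1 -> bvp_solvable (A eps) (B eps))
  (Huniq : forall eps, 0 <= eps < eps1 -> bvp_unique (A eps) (B eps))
  (Hdep : cont_dep A B eps1).

Lemma coef_le_at (eps : R) : 0 <= eps < eps0 -> exists K, 0 <= K /\ coef_le K (A eps).
Proof. intros He. apply coef_le_exists. apply HA. assumption. Qed.

Lemma LL_InCv_at (eps : R) (y : nat -> R -> CC) : 0 <= eps < eps0 -> InX y ->
  InCv a b n alpha m (LL (A eps) y).
Proof. intros He Hy. destruct (coef_le_at eps He) as [K [_ HK]]. apply (LL_InCv _ K); assumption. Qed.

Lemma solution_family (f : R -> nat -> R -> CC) (c : R -> nat -> CC) :
  (forall eps, 0 <= eps < eps1 -> InCv a b n alpha m (f eps)) ->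
  exists y, forall eps, 0 <= eps < eps1 -> InX (y eps) /\
    (forall i t, (i < m)%nat -> a <= t <= b -> LL (A eps) (y eps) i t = f eps i t) /\
    (forall i, (i < r * m)%nat -> B eps (y eps) i = c eps i).
Proof.
  intros Hf. apply (choice_fun R (nat -> R -> CC) (fun eps y => 0 <= eps < eps1 -> InX y /\
    (forall i t, (i < m)%nat -> a <= t <= b -> LL (A eps) y i t = f eps i t) /\
    (forall i, (i < r * m)%nat -> B eps y i = c eps i))).
  intros eps. destruct (excluded_middle_informative (0 <= eps < eps1)) as [H|H].
  - destruct (Hsolv eps H (f eps) (c eps) (Hf eps H)) as [y Hy]. exists y. auto.
  - exists (fun _ _ => RtoC 0). intros; contradiction.
Qed.

(** The solutions at each parameter are chosen together; continuous dependence makes them converge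
    to their value at 0, which is [y] by uniqueness there. This approximates a prescribed [y] by
    solutions of perturbed problems. *)
Lemma solution_family_conv (f : R -> nat -> R -> CC) (c : R -> nat -> CC) (y : nat -> R -> CC) :
  (forall eps, 0 <= eps < eps1 -> InCv a b n alpha m (f eps)) -> InX y ->
  (forall i t, (i < m)%nat -> a <= t <= b -> LL (A 0) y i t = f 0 i t) ->
  (forall i, (i < r * m)%nat -> B 0 y i = c 0 i) ->
  (forall e, 0 < e -> ev (fun eps => vY (vsub (f eps) (f 0)) e)) ->
  (forall e, 0 < e -> ev (fun eps => forall i, (i < r * m)%nat -> Cmod (c eps i - c 0 i)%C <= e)) ->
  exists z, (forall eps, 0 <= eps < eps1 -> InX (z eps) /\
    (forall i t, (i < m)%nat -> a <= t <= b -> LL (A eps) (z eps) i t = f eps i t) /\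
    (forall i, (i < r * m)%nat -> B eps (z eps) i = c eps i)) /\
    forall e, 0 < e -> ev (fun eps => vX (vsub y (z eps)) e).
Proof.
  intros Hf Hy HyL HyB Hfc Hcc. destruct (solution_family f c Hf) as [z Hz].
  exists z. split; [assumption|]. intros e He.
  apply (ev_imp _ _) with (2 := Hdep f c z Hf Hz Hfc Hcc e He). intros eps H.
  destruct (Hz 0 ltac:(lra)) as [H1 [H2 H3]].
  apply vle_vsub_sym. apply (vle_ext a b alpha m _ (vsub (z eps) (z 0))); [|assumption].
  intros i t Hi Ht. unfold vsub. rewrite (Huniq 0 ltac:(lra) (z 0) y); auto.
  - intros j s Hj Hs. rewrite H2, HyL by assumption. reflexivity.
  - intros j Hj. rewrite H3, HyB by assumption. reflexivity.
Qed.

Lemma vY_const_small (f : nat -> R -> CC) (e : R) : 0 < e -> ev (fun _ => vY (vsub f f) e).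
Proof.
  intros He. apply ev_true. intros _. apply (vle_mono a b alpha m _ _ 0); [lra|]. apply vle_0.
  intros. unfold vsub. ring.
Qed.

Lemma c_const_small (c : nat -> CC) (e : R) : 0 < e ->
  ev (fun _ => forall i, (i < r * m)%nat -> Cmod (c i - c i)%C <= e).
Proof.
  intros He. apply ev_true. intros _ i _. replace (c i - c i)%C with (RtoC 0) by ring.
  rewrite Cmod_0. lra.
Qed.

(* For y = (t - a)^p / p! e_k and z(eps) -> y with L(eps) z(eps) = L(0) y one has
   (L(eps) - L(0)) y = L(eps) (y - z(eps)); the left side involves A_q for q <= p only, and
   the coefficient of A_p in it is 1. *)
Lemma coef_conv_step (p : nat) : (p < r)%nat -> forall e, 0 < e ->
  ev (fun eps => forall N, 0 <= N -> coef_le N (fun p i k t => A eps p i k t - A 0 p i k t)%C ->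
    forall k, (k < m)%nat -> forall i, (i < m)%nat ->
      hle n (fun t => A eps p i k t - A 0 p i k t)%C (e * (1 + N))).
Proof.
  induction p as [p IH] using lt_wf_ind. intros Hp e He.
  destruct (coef_le_at 0 ltac:(lra)) as [KA [HKA HA0]].
  destruct (bound_all (S p) (fun j K => hle n (monomial j) K)) as [P [HP HmP]].
  { intros j K L. apply hle_mono. }
  { intros j _. apply monomial_hle. }
  assert (Hoc := opc_nonneg). pose proof (kap_pow_ge_1 a b alpha (n + r)) as Hkap.
  (* Bounds L(eps) on a function of size 1 relative to [1 + N]: the top derivative, the coefficients
     at 0, and the differences, which contribute [opc * N]. *)
  set (c2 := kap a b alpha ^ (n + r) + opc * KA + opc).
  assert (Hc2 : 1 <= c2).
  { assert (0 <= opc * KA) by (apply Rmult_le_pos; assumption). unfold c2. lra. }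
  set (e1 := e / 2 / c2). assert (He1 : 0 < e1) by (apply Rdiv_lt_0_compat; lra).
  pose proof (mulc_ge_1 a b alpha n) as Hmu.
  (* Collects the terms of lower order [q < p], each a coefficient difference already estimated
     times a monomial bounded by [P]. *)
  set (c3 := INR r * (mulc a b alpha n * P) + 1).
  assert (Hc3 : 1 <= c3).
  { assert (0 <= INR r * (mulc a b alpha n * P)).
    { apply Rmult_le_pos; [apply pos_INR|]. apply Rmult_le_pos; lra. }
    unfold c3. lra. }
  set (e2 := e / 2 / c3). assert (He2 : 0 < e2) by (apply Rdiv_lt_0_compat; lra).
  assert (HIH : ev (fun eps => forall q, (q < p)%nat ->
    forall N, 0 <= N -> coef_le N (fun p i k t => A eps p i k t - A 0 p i k t)%C ->
    forall k, (k < m)%nat -> forall i, (i < m)%nat ->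
      hle n (fun t => A eps q i k t - A 0 q i k t)%C (e2 * (1 + N)))).
  { apply (ev_all p). intros q Hq. apply IH; [assumption|lia|assumption]. }
  assert (Hz : exists z : nat -> R -> nat -> R -> CC, forall k,
    (forall eps, 0 <= eps < eps1 -> InX (z k eps) /\
      (forall i t, (i < m)%nat -> a <= t <= b -> LL (A eps) (z k eps) i t = LL (A 0) (test_fun p k) i t)) /\
    forall e, 0 < e -> ev (fun eps => vX (vsub (test_fun p k) (z k eps)) e)).
  { apply (choice_fun nat (R -> nat -> R -> CC) (fun k z =>
      (forall eps, 0 <= eps < eps1 -> InX (z eps) /\
        (forall i t, (i < m)%nat -> a <= t <= b -> LL (A eps) (z eps) i t = LL (A 0) (test_fun p k) i t)) /\
      forall e, 0 < e -> ev (fun eps => vX (vsub (test_fun p k) (z eps)) e))).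
    intros k.
    destruct (solution_family_conv (fun _ => LL (A 0) (test_fun p k)) (fun _ => B 0 (test_fun p k)) (test_fun p k))
      as [z [Hz1 Hz2]]; auto.
    - intros. apply LL_InCv_at; [lra|apply test_fun_InX].
    - apply test_fun_InX.
    - intros. apply vY_const_small. assumption.
    - intros. apply c_const_small. assumption.
    - exists z. split; [|assumption]. intros eps H. destruct (Hz1 eps H) as [H1 [H2 _]]. auto. }
  destruct Hz as [z Hz].
  assert (Hzev : ev (fun eps => forall k, (k < m)%nat -> vX (vsub (test_fun p k) (z k eps)) e1)).
  { apply (ev_all m). intros k _. apply Hz. assumption. }
  apply (ev_imp _ _) with (2 := ev_and _ _ HIH (ev_and _ _ Hzev (ev_lt eps1 ltac:(lra)))).
  intros eps [H1 [H2 H3]] N HN HC k Hk i Hi.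
  specialize (H2 k Hk). destruct (Hz k) as [Hzk _]. destruct (Hzk eps ltac:(lra)) as [HzX HzL].
  set (w := vsub (test_fun p k) (z k eps)) in *.
  set (C := fun p i k t => (A eps p i k t - A 0 p i k t)%C) in *.
  set (S := fun t => Csum r (fun q => if Nat.eq_dec q p then RtoC 0 else C q i k t * monomial_deriv p q t)%C).
  (* L(eps) w is split as L(0) w plus the action of the differences [C] on [w], since [C] is
     controlled only by the hypothetical bound [N]. This is how [N] enters the right-hand side. *)
  apply (hle_ext a b alpha n (fun t => LL (A 0) w i t
    + opC m r C (fun k p => dW a b (n + r) (w k) p) i t - S t)%C).
  { intros t Ht. change (A eps p i k t - A 0 p i k t)%C with (C p i k t).
    replace (C p i k t) with (opC m r C (fun j q => dW a b (n + r) (test_fun p k j) q) i t - S t)%C.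
    2:{ rewrite opC_test_fun by assumption. unfold S. ring. }
    unfold C at 1 2. rewrite <- !LL_minus_A.
    unfold w. rewrite !LL_vsub by (assumption || apply test_fun_InX).
    rewrite HzL by assumption. ring. }
  apply (hle_mono a b alpha n _ ((kap a b alpha ^ (n + r) * e1 + opc * (KA * e1) + opc * (N * e1))
    + INR r * (mulc a b alpha n * (e2 * (1 + N) * P)))).
  { assert (E1 : kap a b alpha ^ (n + r) * e1 + opc * (KA * e1) + opc * (N * e1) <= e / 2 * (1 + N)).
    { apply Rle_trans with (c2 * e1 * (1 + N)).
      - unfold c2. assert (0 <= opc * e1) by (apply Rmult_le_pos; lra).
        assert (0 <= (kap a b alpha ^ (n + r) * e1 + opc * KA * e1) * N).
        { apply Rmult_le_pos; [|assumption]. assert (0 <= opc * KA * e1) by (apply Rmult_le_pos; [apply Rmult_le_pos|]; lra).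
          assert (0 <= kap a b alpha ^ (n + r) * e1) by (apply Rmult_le_pos; lra). lra. }
        lra.
      - right. unfold e1. field. lra. }
    assert (E2 : INR r * (mulc a b alpha n * (e2 * (1 + N) * P)) <= e / 2 * (1 + N)).
    { replace (INR r * (mulc a b alpha n * (e2 * (1 + N) * P))) with ((c3 - 1) * (e2 * (1 + N))) by (unfold c3; ring).
      assert (0 <= e2 * (1 + N)) by (apply Rmult_le_pos; lra).
      apply Rle_trans with (c3 * (e2 * (1 + N))); [lra|]. right. unfold e2. field. lra. }
    lra. }
  apply hle_minus; [apply hle_plus|].
  - apply (LL_hle (A 0) KA w e1); assumption.
  - apply opC_dW_hle; assumption.
  - apply (hle_Csum a b alpha n r (fun q t => if Nat.eq_dec q p then RtoC 0 else (C q i k t * monomial_deriv p q t)%C)).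
    intros q Hq.
    assert (H0 : 0 <= mulc a b alpha n * (e2 * (1 + N) * P)).
    { apply Rmult_le_pos; [lra|]. apply Rmult_le_pos; [|assumption]. apply Rmult_le_pos; lra. }
    destruct (Nat.eq_dec q p) as [->|Hne]; [apply hle_zero; assumption|].
    unfold monomial_deriv. destruct (le_dec q p) as [Hqp|Hqp].
    + apply (hle_mult a b alpha Hab Hal).
      * apply (H1 q ltac:(lia) N HN HC k Hk i Hi).
      * apply HmP. lia.
    + apply (hle_ext a b alpha n (fun _ => RtoC 0)); [intros; ring|]. apply hle_zero. assumption.
Qed.

(** For a fixed parameter [A eps - A 0] has some finite bound, with no uniformity; [coef_halving]
    removes it from the relative estimates of [coef_conv_step]. *)
Lemma forward_coef_conv : coef_conv A.
Proof.
  (* The third compensates the final [3 * e']; the bound [/ 2] is what the halving requires. *)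
  intros e He. set (e' := Rmin (e / 3) (/ 2)).
  assert (He' : 0 < e') by (apply Rmin_pos; lra).
  assert (He1 : e' <= e / 3) by apply Rmin_l. assert (He2 : e' <= / 2) by apply Rmin_r.
  assert (Hall := ev_all r _ (fun p Hp => coef_conv_step p Hp e' He')).
  apply (ev_imp _ _) with (2 := ev_and _ _ Hall (ev_lt eps0 ltac:(lra))).
  intros eps [H1 H2]. intros p i k Hp Hi Hk.
  apply (hle_mono a b alpha n _ (3 * e')); [lra|].
  revert p i k Hp Hi Hk. apply coef_halving; [lra| |].
  - destruct (coef_le_at 0 ltac:(lra)) as [K [HK HK']].
    destruct (coef_le_at eps ltac:(lra)) as [L [HL HL']].
    exists (L + K). split; [lra|]. intros p i k Hp Hi Hk. apply hle_minus; auto.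
  - intros N HN HC p i k Hp Hi Hk. apply (H1 p Hp N HN HC k Hk i Hi).
Qed.

Lemma matvec_id (N : nat) (d : nat -> CC) (i : nat) : (i < N)%nat ->
  matvec N (fun i l => if Nat.eq_dec i l then RtoC 1 else RtoC 0) d i = d i.
Proof.
  intros Hi. unfold matvec. rewrite (Csum_single N i); [|assumption|].
  - destruct (Nat.eq_dec i i); [ring|lia].
  - intros j _ Hne. destruct (Nat.eq_dec i j); [congruence|ring].
Qed.

(* If B(eps) Y_l(eps) = e_l and B(eps) z(eps) = B(0) y, L(eps) z(eps) = L(eps) y, then
   y - z(eps) = sum_l d_l Y_l(eps) with d = B(eps) y - B(0) y; applying B(0) recovers d
   up to a small relative error. *)
Lemma forward_strong_conv : strong_conv B.
Proof.
  intros y Hy e He.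
  pose proof (HB 0 ltac:(lra)) as HB0.
  destruct (CLO_bound (B 0) HB0) as [K [HK HKb]].
  destruct (InCv_vle a b alpha Hab Hal m _ y Hy) as [Ky [HKy Hyb]].
  assert (Hoc := opc_nonneg).
  destruct (solution_family_conv (fun eps => LL (A eps) y) (fun _ => B 0 y) y) as [z [Hz Hzc]]; auto.
  { intros. apply LL_InCv_at; [lra|assumption]. }
  (* The convergence of the coefficients, already proved, enters here: it yields L(eps) y -> L(0) y,
     the convergence of the right-hand sides. *)
  { intros e1 He1. set (q := opc * Ky + 1).
    assert (Hq : 1 <= q) by (unfold q; assert (0 <= opc * Ky) by (apply Rmult_le_pos; assumption); lra).
    assert (Hsg : 0 < e1 / q) by (apply Rdiv_lt_0_compat; lra).
    apply (ev_imp _ _) with (2 := forward_coef_conv _ Hsg). intros eps H.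
    apply (vle_mono a b alpha m _ _ (opc * (e1 / q * Ky))).
    - replace (opc * (e1 / q * Ky)) with ((q - 1) * (e1 / q)) by (unfold q; ring).
      apply Rle_trans with (q * (e1 / q)); [lra|]. right. field. lra.
    - apply (vle_ext a b alpha m n (opC m r (fun p i k t => A eps p i k t - A 0 p i k t)%C
        (fun k p => dW a b (n + r) (y k) p))).
      + intros. rewrite <- LL_minus_A. reflexivity.
      + apply opC_dW_hle; assumption. }
  { intros. apply c_const_small. assumption. }
  set (delta := fun l k : nat => if Nat.eq_dec k l then RtoC 1 else RtoC 0).
  assert (HY : exists Y : nat -> R -> nat -> R -> CC, forall l,
    (forall eps, 0 <= eps < eps1 -> InX (Y l eps) /\
      (forall i t, (i < m)%nat -> a <= t <= b -> LL (A eps) (Y l eps) i t = RtoC 0) /\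
      (forall i, (i < r * m)%nat -> B eps (Y l eps) i = delta l i)) /\
    forall e, 0 < e -> ev (fun eps => vX (vsub (Y l eps) (Y l 0)) e)).
  { apply (choice_fun nat (R -> nat -> R -> CC) (fun l Y =>
      (forall eps, 0 <= eps < eps1 -> InX (Y eps) /\
        (forall i t, (i < m)%nat -> a <= t <= b -> LL (A eps) (Y eps) i t = RtoC 0) /\
        (forall i, (i < r * m)%nat -> B eps (Y eps) i = delta l i)) /\
      forall e, 0 < e -> ev (fun eps => vX (vsub (Y eps) (Y 0)) e))).
    intros l.
    assert (H0 : forall eps, 0 <= eps < eps1 -> InCv a b n alpha m (fun _ _ => RtoC 0)).
    { intros _ _. apply (vle_InCv a b alpha Hab Hal m _ _ 0). apply vle_zero. lra. }
    destruct (solution_family (fun _ _ _ => RtoC 0) (fun _ => delta l) H0) as [Y HYl].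
    exists Y. split; [assumption|].
    apply (Hdep (fun _ _ _ => RtoC 0) (fun _ => delta l)); try assumption.
    - intros. apply vY_const_small. assumption.
    - intros. apply c_const_small. assumption. }
  destruct HY as [Y HY].
  set (q := K * INR (r * m) + 1).
  assert (Hq : 1 <= q) by (unfold q; assert (0 <= K * INR (r * m)) by (apply Rmult_le_pos; auto using pos_INR); lra).
  (* The matrix of the values B(0) Y_l(eps) then differs from the identity by at most [K * tau] in
     each entry, small enough for [bounded_below_perturb]. *)
  set (tau := / 2 / q). assert (Htau : 0 < tau) by (apply Rdiv_lt_0_compat; lra).
  set (e2 := e / 2 / (K + 1)). assert (He2 : 0 < e2) by (apply Rdiv_lt_0_compat; lra).
  assert (HYev : ev (fun eps => forall l, (l < r * m)%nat -> vX (vsub (Y l eps) (Y l 0)) tau)).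
  { apply (ev_all (r * m)). intros l _. apply HY. assumption. }
  apply (ev_imp _ _) with (2 := ev_and _ _ HYev (ev_and _ _ (Hzc e2 He2) (ev_lt eps1 ltac:(lra)))).
  intros eps [H1 [H2 H3]] i Hi.
  assert (HYX : forall l, (l < r * m)%nat -> InX (Y l eps)) by (intros l _; apply HY; lra).
  destruct (Hz eps ltac:(lra)) as [HzX [HzL HzB]].
  set (d := fun l => (B eps y l - B 0 y l)%C).
  assert (E : forall i t, (i < m)%nat -> a <= t <= b ->
    vsub y (z eps) i t = vlin (r * m) d (fun l => Y l eps) i t).
  { apply (Huniq eps ltac:(lra)).
    - apply InX_vsub; assumption.
    - apply InX_vlin; assumption.
    - intros j t Hj Ht. rewrite LL_vsub, HzL by assumption. rewrite LL_vlin by assumption.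
      rewrite Csum_0; [ring|]. intros l Hl. destruct (HY l) as [HYl _].
      destruct (HYl eps ltac:(lra)) as [_ [HL _]]. rewrite HL by assumption. ring.
    - intros j Hj. pose proof (HB eps ltac:(lra)) as HBe.
      rewrite CLO_vsub, HzB, CLO_vlin by assumption.
      rewrite <- (matvec_id (r * m) d j Hj : _ = (B eps y j - B 0 y j)%C). apply Csum_ext. intros l Hl.
      destruct (HY l) as [HYl _]. destruct (HYl eps ltac:(lra)) as [_ [_ HBl]].
      rewrite HBl by assumption. unfold delta. reflexivity. }
  change (Cmod (d i) <= e).
  (* [1] is the lower-bound constant of the identity matrix, 2 the loss from its perturbation, and
     [K * e2] bounds B(0) (y - z(eps)). *)
  apply Rle_trans with (2 * 1 * (K * e2)).
  2:{ apply Rle_trans with (2 * ((K + 1) * e2)); [lra|]. right. unfold e2. field. lra. }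
  apply (bounded_below_perturb (r * m) (fun i l => if Nat.eq_dec i l then RtoC 1 else RtoC 0)
    (fun i l => B 0 (Y l eps) i) 1 (K * tau)); try lra; try assumption.
  - replace (1 * (INR (r * m) * (K * tau))) with ((q - 1) * tau) by (unfold q; ring).
    apply Rle_trans with (q * tau); [lra|]. unfold tau. right. field. lra.
  - intros d' g Hg Hd j Hj. specialize (Hd j Hj). rewrite matvec_id in Hd by assumption. lra.
  - intros j l Hj Hl. destruct (HY l) as [HYl _]. destruct (HYl 0 ltac:(lra)) as [HX0 [_ HBl]].
    replace (if Nat.eq_dec j l then RtoC 1 else RtoC 0) with (B 0 (Y l 0) j).
    2:{ rewrite HBl by assumption. reflexivity. }
    rewrite <- CLO_vsub; auto.
  - apply Rmult_le_pos; lra.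
  - intros j Hj. change (matvec (r * m) (fun i l => B 0 (Y l eps) i) d j)
      with (Csum (r * m) (fun l => d l * B 0 (Y l eps) j)%C).
    rewrite <- (CLO_vlin (B 0) (r * m) d (fun l => Y l eps)) by assumption.
    rewrite <- (CLO_ext (B 0) (vsub y (z eps))); auto.
    apply InX_vsub; assumption.
Qed.

End Forward.

(** * Sufficiency from the uniform estimate, and the return to the norms of the statement *)

Lemma mnorm_to0 (C : R -> nat -> nat -> R -> CC) :
  ev (fun eps => InCm a b n alpha m (C eps)) ->
  (to0 (fun eps => mnorm a b n alpha m (C eps)) <->
   forall e, 0 < e -> ev (fun eps => forall i, (i < m)%nat -> vY (C eps i) e)).
Proof.
  intros HC. split; intros H e He.
  - apply (ev_imp _ _) with (2 := ev_and _ _ HC (H e He)). intros eps [H1 H2] i Hi.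
    apply (vle_mono a b alpha m n _ (vnorm a b n alpha m (C eps i))).
    + apply Rle_trans with (mnorm a b n alpha m (C eps)); [|lra].
      apply (fsum_ge_term m (fun i => vnorm a b n alpha m (C eps i))); [|assumption].
      intros j Hj. apply fsum_nonneg. intros k Hk. apply (hnorm_nonneg a b alpha Hab Hal). auto.
    + apply (vle_vnorm a b alpha Hab Hal). intros k Hk. auto.
  - set (c := INR m * (INR m * (INR n + 2)) + 1).
    assert (Hc : 1 <= c).
    { unfold c. assert (0 <= INR m * (INR m * (INR n + 2))).
      { repeat apply Rmult_le_pos; try apply pos_INR. pose proof (pos_INR n). lra. }
      lra. }
    assert (Hp : 0 < e / c) by (apply Rdiv_lt_0_compat; lra).
    apply (ev_imp _ _) with (2 := H _ Hp). intros eps H1.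
    apply Rle_lt_trans with (INR m * (INR m * ((INR n + 2) * (e / c)))).
    + apply fsum_le. intros i Hi. apply (vnorm_le a b alpha Hab Hal). apply H1. assumption.
    + replace (INR m * (INR m * ((INR n + 2) * (e / c)))) with ((c - 1) * (e / c)) by (unfold c; ring).
      apply Rlt_le_trans with (c * (e / c)); [lra|]. right. field. lra.
Qed.

Lemma coef_conv_mnorm (A : R -> nat -> nat -> nat -> R -> CC) (eps0 : R) : 0 < eps0 ->
  (forall eps, 0 <= eps < eps0 -> forall p, (p < r)%nat -> InCm a b n alpha m (A eps p)) ->
  (coef_conv A <->
   forall p, (p < r)%nat -> to0 (fun eps => mnorm a b n alpha m (msub (A eps p) (A 0 p)))).
Proof.
  intros He0 HA.
  assert (HC : forall p, (p < r)%nat -> ev (fun eps => InCm a b n alpha m (msub (A eps p) (A 0 p)))).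
  { intros p Hp. apply (ev_imp _ _) with (2 := ev_lt eps0 He0). intros eps H i k Hi Hk.
    destruct (InC_hle a b alpha Hab Hal _ _ (HA eps ltac:(lra) p Hp i k Hi Hk)) as [K [_ HK]].
    destruct (InC_hle a b alpha Hab Hal _ _ (HA 0 ltac:(lra) p Hp i k Hi Hk)) as [L [_ HL]].
    apply (hle_InC a b alpha Hab Hal n _ (K + L)). apply hle_minus; assumption. }
  split.
  - intros H p Hp. apply mnorm_to0; [auto|]. intros e He.
    apply (ev_imp _ _) with (2 := H e He). intros eps H1 i Hi k Hk. apply (H1 p i k); assumption.
  - intros H e He.
    assert (Hall : ev (fun eps => forall p, (p < r)%nat -> forall i, (i < m)%nat ->
      vY (msub (A eps p) (A 0 p) i) e)).
    { apply (ev_all r). intros p Hp. apply (mnorm_to0 (fun eps => msub (A eps p) (A 0 p))); auto. }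
    apply (ev_imp _ _) with (2 := Hall). intros eps H1 p i k Hp Hi Hk. apply (H1 p Hp i Hi k Hk).
Qed.

Lemma strong_conv_cnorm (B : R -> (nat -> R -> CC) -> nat -> CC) :
  strong_conv B <->
  forall y, InX y -> to0 (fun eps => cnorm (r * m) (csub (B eps y) (B 0 y))).
Proof.
  split; intros H y Hy.
  - apply cnorm_to0. apply (H y Hy).
  - apply (cnorm_to0 (r * m) (fun eps => csub (B eps y) (B 0 y))). auto.
Qed.

(** For [y eps - y 0] the equation has the data (f(eps) - f(0)) - (L(eps) - L(0)) y(0), and the
    boundary condition (c(eps) - c(0)) - (B(eps) - B(0)) y(0). Both operator differences act on the
    fixed function [y 0], so strong convergence of [B] suffices. *)
Lemma backward (A : R -> nat -> nat -> nat -> R -> CC) (B : R -> (nat -> R -> CC) -> nat -> CC)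
  (eps1 K : R) : 0 < eps1 -> 0 <= K ->
  (forall eps, 0 <= eps < eps1 -> CLO (B eps)) ->
  (forall eps, 0 <= eps < eps1 -> bvp_estimate (A eps) (B eps) K) ->
  coef_conv A -> strong_conv B -> cont_dep A B eps1.
Proof.
  intros He1 HK HB HE HI HII f c y Hf Hy Hfc Hcc e He.
  destruct (Hy 0 ltac:(lra)) as [Hy0 [Hy0L Hy0B]].
  destruct (InCv_vle a b alpha Hab Hal m _ _ Hy0) as [K0 [HK0 HyK]].
  assert (Hoc := opc_nonneg).
  (* Four error terms, each at most [s], multiplied by the constant [K] of the estimate. *)
  set (s := e / (4 * (K + 1))). assert (Hs : 0 < s) by (apply Rdiv_lt_0_compat; lra).
  set (q := opc * K0 + 1).
  assert (Hq : 1 <= q) by (unfold q; assert (0 <= opc * K0) by (apply Rmult_le_pos; assumption); lra).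
  assert (Hsq : 0 < s / q) by (apply Rdiv_lt_0_compat; lra).
  apply (ev_imp _ _) with (2 := ev_and _ _ (ev_and _ _ (Hfc s Hs) (Hcc s Hs))
    (ev_and _ _ (ev_and _ _ (HI _ Hsq) (HII _ Hy0 s Hs)) (ev_lt eps1 He1))).
  intros eps [[H1 H2] [[H3 H4] H5]].
  destruct (Hy eps ltac:(lra)) as [Hye [HyeL HyeB]].
  pose proof (HB eps ltac:(lra)) as HBe.
  apply (vle_mono a b alpha m _ _ (K * ((s + s) + (s + s)))).
  { apply Rle_trans with ((K + 1) * (4 * s)).
    - replace (s + s + (s + s)) with (4 * s) by ring. apply Rmult_le_compat_r; lra.
    - right. unfold s. field. lra. }
  apply (HE eps ltac:(lra)); try lra.
  - apply InX_vsub; assumption.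
  - apply (vle_ext a b alpha m n (vsub (vsub (f eps) (f 0))
      (opC m r (fun p i k t => A eps p i k t - A 0 p i k t)%C (fun k p => dW a b (n + r) (y 0 k) p)))).
    + intros i t Hi Ht. rewrite LL_vsub, HyeL by assumption. unfold vsub.
      rewrite <- LL_minus_A, Hy0L by assumption. ring.
    + apply vle_minus; [assumption|].
      apply (vle_mono a b alpha m _ _ (opc * (s / q * K0))).
      * replace (opc * (s / q * K0)) with ((q - 1) * (s / q)) by (unfold q; ring).
        apply Rle_trans with (q * (s / q)); [lra|]. right. field. lra.
      * apply opC_dW_hle; assumption.
  - intros i Hi. rewrite CLO_vsub, HyeB by assumption.
    replace (c eps i - B eps (y 0) i)%C with
      ((c eps i - c 0 i) - (B eps (y 0) i - B 0 (y 0) i))%C by (rewrite Hy0B by assumption; ring).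
    eapply Rle_trans; [apply Cmod_minus_le|]. apply Rplus_le_compat; auto.
Qed.

Lemma vnorm_vsub_to0 (N : nat) (f : R -> nat -> R -> CC) (eps1 : R) : 0 < eps1 ->
  (forall eps, 0 <= eps < eps1 -> InCv a b N alpha m (f eps)) ->
  (to0 (fun eps => vnorm a b N alpha m (vsub (f eps) (f 0))) <->
   forall e, 0 < e -> ev (fun eps => vle a b alpha m N (vsub (f eps) (f 0)) e)).
Proof.
  intros He Hf. apply (vnorm_to0 a b alpha Hab Hal m N (fun eps => vsub (f eps) (f 0))).
  apply (ev_imp _ _) with (2 := ev_lt eps1 He). intros eps Heps.
  destruct (InCv_vle a b alpha Hab Hal m N _ (Hf eps ltac:(lra))) as [K [_ HK]].
  destruct (InCv_vle a b alpha Hab Hal m N _ (Hf 0 ltac:(lra))) as [L [_ HL]].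
  apply (vle_InCv a b alpha Hab Hal m N _ (K + L)). apply vle_minus; assumption.
Qed.

(** Uniqueness in [ContDep] is stated for given data. To compare two functions with equal images,
    the data are taken to be those of the first one, admissible because [LL] maps into the space of
    order [n]. *)
Lemma ContDep_iff (A : R -> nat -> nat -> nat -> R -> CC) (B : R -> (nat -> R -> CC) -> nat -> CC)
  (eps0 : R) :
  (forall eps, 0 <= eps < eps0 -> forall p, (p < r)%nat -> InCm a b n alpha m (A eps p)) ->
  (ContDep a b m r n alpha eps0 A B <->
   exists eps1, 0 < eps1 < eps0 /\
    (forall eps, 0 <= eps < eps1 -> bvp_solvable (A eps) (B eps) /\ bvp_unique (A eps) (B eps)) /\
    cont_dep A B eps1).
Proof.
  intros HA. split; intros [eps1 [He [H1 H2]]]; exists eps1; (split; [assumption|]); split.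
  - intros eps Heps. specialize (H1 eps Heps). split.
    + intros f c Hf. exact (proj1 (H1 f c Hf)).
    + intros y z Hy Hz HL HT.
      destruct (coef_le_exists (A eps)) as [K [_ HK]]; [apply HA; lra|].
      apply (proj2 (H1 (LL (A eps) y) (B eps y) (LL_InCv _ K y HK Hy))).
      * split; [assumption|]. split; intros; reflexivity.
      * split; [assumption|]. split; intros; symmetry; [apply HL|apply HT]; assumption.
  - intros f c y Hf Hy Hfc Hcc.
    apply (vnorm_vsub_to0 (n + r) y eps1 (proj1 He) (fun eps Heps => proj1 (Hy eps Heps))).
    apply (H2 f c y Hf Hy).
    + apply (vnorm_vsub_to0 n f eps1 (proj1 He) Hf). assumption.
    + apply cnorm_to0. assumption.
  - intros eps Heps f c Hf. destruct (H1 eps Heps) as [Hs Hu]. split.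
    + exact (Hs f c Hf).
    + intros y z [Hy [HyL HyB]] [Hz [HzL HzB]]. apply Hu; try assumption.
      * intros i t Hi Ht. transitivity (f i t); [apply HyL|symmetry; apply HzL]; assumption.
      * intros i Hi. rewrite HyB, HzB by assumption. reflexivity.
  - intros f c y Hf Hy Hfc Hcc.
    apply (vnorm_vsub_to0 (n + r) y eps1 (proj1 He) (fun eps Heps => proj1 (Hy eps Heps))).
    apply (H2 f c y Hf Hy).
    + apply (vnorm_vsub_to0 n f eps1 (proj1 He) Hf). assumption.
    + apply (cnorm_to0 (r * m) (fun eps => csub (c eps) (c 0))). assumption.
Qed.

End Operators.

Theorem mainTheorem1 (a b : R) (m r n : nat) (alpha eps0 : R)
  (A : R -> nat -> nat -> nat -> R -> CC) (B : R -> (nat -> R -> CC) -> nat -> CC) :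
  a < b -> (1 <= m)%nat -> (2 <= r)%nat -> 0 < alpha <= 1 -> 0 < eps0 ->
  (forall eps, 0 <= eps < eps0 -> forall p, (p < r)%nat -> InCm a b n alpha m (A eps p)) ->
  (forall eps, 0 <= eps < eps0 -> ContLinOp a b m r n alpha (B eps)) ->
  (ContDep a b m r n alpha eps0 A B <->
   ((* (0) *)
    (forall y, InCv a b (n + r) alpha m y ->
       (forall i t, (i < m)%nat -> a <= t <= b -> Lop a b m r n alpha A 0 y i t = RtoC 0) ->
       (forall i, (i < r * m)%nat -> B 0 y i = RtoC 0) ->
       forall i t, (i < m)%nat -> a <= t <= b -> y i t = RtoC 0) /\
    (* (I) *)
    (forall p, (p < r)%nat -> to0 (fun eps => mnorm a b n alpha m (msub (A eps p) (A 0 p)))) /\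
    (* (II) *)
    (forall y, InCv a b (n + r) alpha m y ->
       to0 (fun eps => cnorm (r * m) (csub (B eps y) (B 0 y)))))).
Proof.
  intros Hab _ Hr Hal He0 HA HB.
  rewrite (ContDep_iff a b alpha Hab Hal n m r A B eps0 HA).
  rewrite <- (coef_conv_mnorm a b alpha Hab Hal n m r A eps0 He0 HA).
  rewrite <- (strong_conv_cnorm a b alpha n m r B).
  split.
  - intros [eps1 [He1 [H1 H2]]].
    assert (Hsolv := fun eps H => proj1 (H1 eps H)). assert (Huniq := fun eps H => proj2 (H1 eps H)).
    split; [|split].
    + intros y Hy HyL HyB.
      assert (H0 : vle a b alpha m (n + r) (fun _ _ => RtoC 0) 0) by (apply vle_zero; lra).
      apply (Huniq 0 ltac:(lra) y (fun _ _ => RtoC 0)); [assumption|apply (vle_InCv a b alpha Hab Hal m _ _ 0 H0)|..].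
      * intros i t Hi Ht. rewrite (LL_zero a b alpha Hab Hal n m r (A 0) (fun _ _ => RtoC 0)) by auto.
        apply HyL; assumption.
      * intros i Hi. rewrite HyB by assumption. symmetry.
        apply (CLO_zero a b alpha Hab Hal n m r (B 0)); auto. apply HB. lra.
    + exact (forward_coef_conv a b alpha Hab Hal n m r A B eps0 eps1 He1 HA Hsolv Huniq H2).
    + exact (forward_strong_conv a b alpha Hab Hal n m r A B eps0 eps1 He1 HA HB Hsolv Huniq H2).
  - intros [H0 [HI HII]].
    destruct (bvp_uniform a b alpha Hab Hal n m r A B eps0) as [K [delta [HK [Hdel H]]]];
      try assumption; [lia|apply HA; lra|].
    (* Half of [eps0] secures the strict inequality [eps1 < eps0] demanded by [ContDep]. *)
    set (eps1 := Rmin delta (eps0 / 2)).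
    assert (He1 : 0 < eps1) by (apply Rmin_pos; lra).
    assert (He2 : eps1 <= delta) by apply Rmin_l. assert (He3 : eps1 <= eps0 / 2) by apply Rmin_r.
    exists eps1. split; [lra|]. split.
    + intros eps Heps. destruct (H eps ltac:(lra)) as [HE HS]. split; [assumption|].
      apply (bvp_estimate_unique a b alpha Hab Hal n m r (A eps) (B eps) K); [apply HB; lra|assumption].
    + apply (backward a b alpha Hab Hal n m r A B eps1 K); try assumption.
      * intros eps Heps. apply HB. lra.
      * intros eps Heps. apply H. lra.
Qed.
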